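(* Let $(M,\mathfrak{p})$ be a closed oriented properly convex projective surface of negative Euler characteristic. Then the Blaschke metric of $\mathfrak{p}$ is a critical point of the functional $\mathcal{E}$ associated with $\mathfrak{p}$, i.e. if $g$ denotes the Blaschke metric, then $\mathcal{E}'_g(h)=0$ for all $h\in\Gamma(S^2(T^*M))$.
   Context: Projective structures. Two torsion-free connections on $TM$ are projectively equivalent if every geodesic of one can be reparametrised to become a geodesic of the other; a projective structure $\mathfrak{p}$ on $M$ is an equivalence class of projectively equivalent torsion-free connections, and $(M,\mathfrak{p})$ is called a projective manifold (a projective surface if $\dim M=2$). Notation. Let $n=\dim M$ (here $n=2$) and $E=S^2(T^*M)\otimes TM$. For $\Phi=(\Phi^i_{jk})\in\Gamma(E)$ let $[\mathrm{Con}(\Phi)]_i=\Phi^k_{ik}$, for a $1$-form $\alpha$ let $[\mathrm{Sym}(\alpha)]^i_{jk}=\delta^i_j\alpha_k+\delta^i_k\alpha_j$, and let $\Phi_0:=\Phi-\tfrac1{n+1}\mathrm{Sym}(\mathrm{Con}(\Phi))$. For a Riemannian metric $g$, ${}^g\nabla$ is its Levi-Civita connection, $d\mu_g$ its volume form, and $|\Phi|_g^2=\Phi^i_{jk}g^{jb}g^{kc}g_{ia}\Phi^a_{bc}$. The functional. For a projective structure $\mathfrak{p}$ on a closed oriented surface $M$, $\mathcal{E}$ is the functional on the space $\mathrm{Riem}(M)$ of Riemannian metrics given by $\mathcal{E}(g)=\int_M|(\nabla-{}^g\nabla)_0|_g^2\,d\mu_g$, where $\nabla\in\mathfrak{p}$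 is any representative (the value does not depend on the choice). For $h\in\Gamma(S^2(T^*M))$, $\mathcal{E}'_g(h)=\lim_{t\to0}\tfrac1t(\mathcal{E}(g+th)-\mathcal{E}(g))$. Properly convex projective surfaces. $(M,\mathfrak{p})$ is properly convex if it is isomorphic, as a projective surface, to a quotient $\Omega/\Gamma$, where $\Omega\subset\mathbb{RP}^2$ is a properly convex open set (i.e. a bounded convex subset of some affine chart), equipped with the projective structure whose geodesics are the projective line segments, and $\Gamma$ is a discrete group of projective transformations preserving $\Omega$ and acting on it freely and properly discontinuously. Blaschke metric. Given a Riemannian metric $g$ on the oriented surface $M$, let $J$ be the counter-clockwise rotation of $TM$ by $\pi/2$, so that $(M,J)$ is a Riemann surface. For a cubic differential $C$ on $(M,J)$, let $A=\mathrm{Re}(C)$, a totally symmetric covariant $3$-tensor $A_{ijk}$ with $g^{ij}A_{ijk}=0$, and let $\alpha^i_{jk}=g^{il}A_{ljk}$. It is known (Labourie, Loftin) that for every properly convex projective structure $\mathfrak{p}$ on a closed oriented surface of negative Euler characteristic there is a unique pair $(g,C)$, with $C$ a holomorphic cubic differential on $(M,J)$, such that ${}^g\nabla+\alpha\in\mathfrak{p}$ and $K_g=-1+2|C|_g^2$, where $K_g$ is the Gauss curvature of $g$ and $|C|_g^2=|C(e,e,e)|^2$ for any $g$-unit tangent vector $e$. The metric $g$ is called the Blaschke metric of $\mathfrak{p}$. *)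

(* Defs.v *)
(* MathComp-Analysis, over an arbitrary [R : realType]. *)
From mathcomp Require Import all_boot all_order all_algebra.
From mathcomp Require Import all_classical all_reals all_analysis.
From mathcomp Require Import complex.

Set Implicit Arguments.
Unset Strict Implicit.
Unset Printing Implicit Defensive.

Import Order.TTheory GRing.Theory Num.Theory.
Import numFieldNormedType.Exports.

Local Open Scope classical_set_scope.
Local Open Scope ring_scope.

(** * Calculus in the plane *)

Section Plane.
Variable R : realType.

Definition crd (k : 'I_2) (x : R * R) : R := if k == 0 then x.1 else x.2.
Definition e_ (k : 'I_2) : R * R := ((k == 0)%:R, (k == 1)%:R).

(* For [U] open: all iterated partial derivatives of order [n] exist and are
   continuous on [U] (those of lower order are then continuous as well). *)
Fixpoint Ck (n : nat) (U : set (R * R)) (f : R * R -> R) : Prop :=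
  match n with
  | 0 => forall x, U x -> {for x, continuous f}
  | n'.+1 => forall i : 'I_2,
      (forall x, U x -> derivable f x (e_ i)) /\
      Ck n' U (fun x => 'D_(e_ i) f x)
  end.

Definition smooth_on (U : set (R * R)) (f : R * R -> R) : Prop :=
  forall n, Ck n U f.

End Plane.

(** * Closed oriented surfaces *)

(* The carrier is pointed, i.e. inhabited, because the library's generated
   sigma-algebras require it; the point plays no role.  The inverse [param a]
   of a chart [coord a] is part of the data; neither map means anything outside
   [dom a], resp. [coord a @` dom a].  The atlas is arbitrary, possibly maximal.
   Second countability follows from compactness. *)
Record closed_oriented_surface (R : realType) := ClosedOrientedSurface {
  carrier :> ptopologicalType;
  chart : choiceType;
  dom : chart -> set carrier;
  coord : chart -> carrier -> R * R;
  param : chart -> R * R -> carrier;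
  carrier_hausdorff : hausdorff_space carrier;
  carrier_compact : compact [set: carrier];
  dom_cover : forall m, exists a, dom a m;
  dom_open : forall a, open (dom a);
  coord_dom_open : forall a, open (coord a @` dom a);
  coord_continuous : forall a m, dom a m -> {for m, continuous (coord a)};
  param_continuous : forall a m, dom a m ->
    {for coord a m, continuous (param a)};
  coordK : forall a m, dom a m -> param a (coord a m) = m;
  transition_smooth : forall a b k,
    smooth_on (coord a @` (dom a `&` dom b))
      (fun x => crd k (coord b (param a x)));
  transition_oriented : forall a b m, dom a m -> dom b m ->
    0 < \det (\matrix_(k < 2, i < 2)
      'D_(e_ R i) (fun x => crd k (coord b (param a x))) (coord a m))
}.

Arguments dom {R _} _ _.
Arguments coord {R _} _ _.
Arguments param {R _} _ _.

Section Geometry.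
Variables (R : realType) (M : closed_oriented_surface R).

(* [pd a i f m] is the partial derivative of [f : M -> R] at [m] with respect
   to the [i]-th coordinate of the chart [a]. *)
Definition pd (a : chart M) (i : 'I_2) (f : M -> R) (m : M) : R :=
  'D_(e_ R i) (f \o param a) (coord a m).

Definition smooth_fun (W : set M) (f : M -> R) : Prop :=
  forall a, smooth_on (coord a @` (W `&` dom a)) (f \o param a).

(* dy^k/dx^i, for x, y the coordinates of the charts a, b *)
Definition jac (b a : chart M) (m : M) : 'M[R]_2 :=
  \matrix_(k, i) pd a i (fun m' => crd k (coord b m')) m.

(** ** Tensors and connections, given by their components in every chart *)

(* [T a m] holds the components at [m] in the chart [a]; it is meaningful only
   when [dom a m]. *)
Definition cov2 : Type := chart M -> M -> 'M[R]_2.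
(* [N a m i j k] is the component with upper index [i], lower indices [j], [k]:
   a Christoffel symbol or a component of a section of S^2(T^*M) (x) TM. *)
Definition comp12 : Type := chart M -> M -> 'I_2 -> 'I_2 -> 'I_2 -> R.

Definition sym2_field (h : cov2) : Prop :=
  [/\ forall a i j, smooth_fun (dom a) (fun m => h a m i j),
      forall a m, dom a m -> (h a m)^T = h a m
    & forall a b m, dom a m -> dom b m ->
        h a m = (jac b a m)^T *m h b m *m jac b a m].

Definition inner (g : 'M[R]_2) (v w : 'cV[R]_2) : R :=
  (v^T *m g *m w) 0 0.

Definition riemannian (g : cov2) : Prop :=
  sym2_field g /\
  forall a m, dom a m -> forall v, v != 0 -> 0 < inner (g a m) v v.

Definition torsionfree_connection (N : comp12) : Prop :=
  [/\ forall a i j k, smooth_fun (dom a) (fun m => N a m i j k),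
      forall a m, dom a m -> forall i j k, N a m i j k = N a m i k j
    & forall a b m, dom a m -> dom b m -> forall n j k,
        \sum_(i < 2) jac b a m n i * N a m i j k
        = pd a j (fun m' => jac b a m' n k) m
          + \sum_(l < 2) \sum_(q < 2)
              N b m n l q * jac b a m l j * jac b a m q k].

Definition levi_civita (g : cov2) : comp12 := fun a m i j k =>
  2^-1 * \sum_(l < 2) invmx (g a m) i l *
    (pd a j (fun m' => g a m' k l) m + pd a k (fun m' => g a m' j l) m
     - pd a l (fun m' => g a m' j k) m).

(* K = g(R(d_1,d_2)d_2, d_1) / det g *)
Definition gauss_curvature (g : cov2) (a : chart M) (m : M) : R :=
  let G := levi_civita g in
  let riem l :=
    pd a 0 (fun m' => G a m' l 1 1) m - pd a 1 (fun m' => G a m' l 0 1) m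
    + \sum_(q < 2) (G a m l 0 q * G a m q 1 1 - G a m l 1 q * G a m q 0 1) in
  (\sum_(l < 2) g a m 0 l * riem l) / \det (g a m).

(** ** Geodesics and projective structures *)

Definition open_interval (I : set R) : Prop := open I /\ is_interval I.

(* Geodesics are required to be twice differentiable only; the geodesic
   equation makes them smooth. *)
Definition geodesic (N : comp12) (I : set R) (c : R -> M) : Prop :=
  [/\ open_interval I,
      forall t, I t -> {for t, continuous c}
    & forall a t, I t -> dom a (c t) ->
        let x k := fun s : R => crd k (coord a (c s)) in
        forall i,
          [/\ \forall s \near t, derivable (x i) s 1,
              derivable (derive1 (x i)) t 1
            & derive1 (derive1 (x i)) t
              + \sum_(j < 2) \sum_(k < 2)
                  N a (c t) i j k * derive1 (x j) t * derive1 (x k) t = 0]].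

Definition reparametrisation (I' I : set R) (s : R -> R) : Prop :=
  [/\ open_interval I',
      forall n t, I' t -> derivable (derive1n n s) t 1,
      forall t, I' t -> derive1 s t != 0
    & s @` I' = I].

Definition reparametrises_to_geodesic (N : comp12) (I : set R) (c : R -> M) :=
  exists (I' : set R) (s : R -> R),
    reparametrisation I' I s /\ geodesic N I' (c \o s).

Definition projectively_equivalent (N N' : comp12) : Prop :=
  (forall I c, geodesic N I c -> reparametrises_to_geodesic N' I c) /\
  (forall I c, geodesic N' I c -> reparametrises_to_geodesic N I c).

Definition projective_structure (p : set comp12) : Prop :=
  exists2 N0, torsionfree_connection N0 &
    p = [set N | torsionfree_connection N /\ projectively_equivalent N0 N].

(** ** The functional *)

Definition con (Phi : comp12) (a : chart M) (m : M) (i : 'I_2) : R :=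
  \sum_(k < 2) Phi a m k i k.

Definition sym_form (al : chart M -> M -> 'I_2 -> R) : comp12 :=
  fun a m i j k => (i == j)%:R * al a m k + (i == k)%:R * al a m j.

(* The trace-free part; the factor 1/(n+1) is 1/3. *)
Definition tracefree (Phi : comp12) : comp12 := fun a m i j k =>
  Phi a m i j k - 3^-1 * sym_form (con Phi) a m i j k.

Definition sqnorm (g : cov2) (Phi : comp12) (a : chart M) (m : M) : R :=
  let gi := invmx (g a m) in
  \sum_(i < 2) \sum_(j < 2) \sum_(k < 2)
  \sum_(a' < 2) \sum_(b < 2) \sum_(c < 2)
    Phi a m i j k * gi j b * gi k c * g a m i a' * Phi a m a' b c.

Definition chart_at (m : M) : chart M := projT1 (cid (dom_cover m)).

Local Notation borel := (g_sigma_algebraType (@open M)).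

Definition is_volume (g : cov2) (mu : {measure set borel -> \bar R}) : Prop :=
  forall (a : chart M) (A : set borel), measurable A -> A `<=` dom a ->
    mu A = (\int[lebesgue_measure \x lebesgue_measure]_(x in coord a @` A)
              (Num.sqrt (\det (g a (param a x))))%:E)%E.

(* For a Riemannian metric [is_volume g] holds of exactly one measure, by the
   change of variables formula; the zero measure is a dummy value. *)
Definition volume (g : cov2) : {measure set borel -> \bar R} :=
  match pselect (exists mu, is_volume g mu) with
  | left ex => projT1 (cid ex)
  | right _ => mzero
  end.

(* The integrand at [m] does not depend on the chart around [m]. *)
Definition energy (N : comp12) (g : cov2) : R :=
  Rintegral (volume g) setT (fun m =>
    sqnorm g (tracefree (fun a m i j k => N a m i j k - levi_civita g a m i j k))
      (chart_at m) m).

Definition metric_shift (g h : cov2) (t : R) : cov2 :=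
  fun a m => g a m + t *: h a m.

(** ** Proper convexity *)

Definition homog (x : R * R) : 'cV[R]_3 :=
  \col_(i < 3) (if i == 0 then x.1 else if i == 1 then x.2 else 1).

(* [A] maps the point [x1 : x2 : 1] of RP^2 to [y1 : y2 : 1]. *)
Definition proj_maps (A : 'M[R]_3) (x y : R * R) : Prop :=
  exists2 c : R, c != 0 & A *m homog x = c *: homog y.

(* A projective transformation of RP^2 has a unique representative of
   determinant 1, so PGL_3(R) = SL_3(R).  [Om] is viewed as a subset of RP^2
   through [homog]. *)
Definition discrete_projective_group (Om : set (R * R)) (Ga : set 'M[R]_3) :=
  [/\ [/\ forall A, Ga A -> \det A = 1, Ga 1%:M,
          forall A B, Ga A -> Ga B -> Ga (A *m B)
        & forall A, Ga A -> Ga (invmx A)],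
      forall A, Ga A -> \forall B \near A, Ga B -> B = A,
      forall A x, Ga A -> Om x -> exists2 y, Om y & proj_maps A x y,
      forall A x, Ga A -> Om x -> proj_maps A x x -> A = 1%:M
    & forall K : set (R * R), compact K -> K `<=` Om ->
        finite_set [set A | Ga A /\ exists x y, [/\ K x, K y & proj_maps A x y]]].

(* [f : Om -> M] is a surjective local diffeomorphism whose fibres are the
   [Ga]-orbits, i.e. it induces a diffeomorphism from Om/Ga onto M. *)
Definition quotient_map (Om : set (R * R)) (Ga : set 'M[R]_3)
    (f : R * R -> M) : Prop :=
  [/\ forall x, Om x -> {for x, continuous f},
      forall a k, smooth_on (Om `&` f @^-1` dom a)
        (fun x => crd k (coord a (f x))),
      forall a x, Om x -> dom a (f x) ->
        \det (\matrix_(k < 2, i < 2)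
          'D_(e_ R i) (fun x' => crd k (coord a (f x'))) x) != 0,
      f @` Om = setT
    & forall x y, Om x -> Om y ->
        (f x = f y <-> exists2 A, Ga A & proj_maps A x y)].

Definition straight (I : set R) (c : R -> R * R) : Prop :=
  open_interval I /\ exists x v : R * R, forall t, I t -> c t = x + t *: v.

(* The pullback of [N] by [f] is projectively equivalent to the flat
   connection of [Om], whose geodesics are the straight curves. *)
Definition pulls_back_to_flat (Om : set (R * R)) (f : R * R -> M) (N : comp12) :=
  (forall I c, straight I c -> (forall t, I t -> Om (c t)) ->
     reparametrises_to_geodesic N I (f \o c)) /\
  (forall I c, (forall t, I t -> Om (c t) /\ {for t, continuous c}) ->
     geodesic N I (f \o c) ->
     exists (I' : set R) (s : R -> R),
       reparametrisation I' I s /\ straight I' (c \o s)).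

Definition properly_convex (p : set comp12) : Prop :=
  exists (Om : set (R * R)) (Ga : set 'M[R]_3) (f : R * R -> M),
    [/\ [/\ open Om, bounded_set Om & @convex_set R (R * R)%type Om],
        discrete_projective_group Om Ga,
        quotient_map Om Ga f
      & forall N, p N -> pulls_back_to_flat Om f N].

(** ** Euler characteristic *)

Definition simplicial_complex (N : nat) (K : {set {set 'I_N}}) : Prop :=
  finset.set0 \notin K /\
  forall s s' : {set 'I_N}, s \in K -> s' \subset s -> s' != finset.set0 ->
    s' \in K.

Definition realization (N : nat) (K : {set {set 'I_N}}) : set 'rV[R]_N :=
  [set x : 'rV[R]_N | [/\ forall i, 0 <= x 0 i, \sum_i x 0 i = 1
                       & finset (fun i => x 0 i != 0) \in K]].

(* A continuous bijection from a compact space onto the Hausdorff space [M] is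
   a homeomorphism. *)
Definition triangulation (N : nat) (K : {set {set 'I_N}})
    (T : 'rV[R]_N -> M) : Prop :=
  [/\ simplicial_complex K, {within realization K, continuous T},
      {in realization K &, injective T} & T @` realization K = setT].

Definition euler_characteristic (chi : int) : Prop :=
  exists (N : nat) (K : {set {set 'I_N}}) (T : 'rV[R]_N -> M),
    triangulation K T /\ chi = \sum_(s in K) (-1) ^+ #|s|.-1.

(** ** The Blaschke metric *)

(* [rot g i j] is the component J^i_j of the counter-clockwise rotation by pi/2:
   J d_1 = (- g_12 d_1 + g_11 d_2) / sqrt (det g) and
   J d_2 = (- g_22 d_1 + g_12 d_2) / sqrt (det g). *)
Definition rot (g : 'M[R]_2) : 'M[R]_2 :=
  (Num.sqrt (\det g))^-1 *:
  \matrix_(i, j) (if i == 0 then (if j == 0 then - g 0 1 else - g 1 1)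
                  else (if j == 0 then g 0 0 else g 0 1)).

Definition pdC (a : chart M) (i : 'I_2) (f : M -> R[i]) (m : M) : R[i] :=
  Complex (pd a i (fun m' => complex.Re (f m')) m)
          (pd a i (fun m' => complex.Im (f m')) m).

(* df o J = i df on [W] *)
Definition holomorphic_on (g : cov2) (W : set M) (f : M -> R[i]) : Prop :=
  [/\ smooth_fun W (fun m => complex.Re (f m)),
      smooth_fun W (fun m => complex.Im (f m))
    & forall a m, W m -> dom a m -> forall j,
        \sum_(i < 2) Complex (rot (g a m) i j) 0 * pdC a i f m
        = Complex 0 1 * pdC a j f m].

Definition holomorphic_coordinate (g : cov2) (W : set M) (z : M -> R[i]) :=
  [/\ holomorphic_on g W z, {in W &, injective z}
    & forall a m, W m -> dom a m -> exists i, pdC a i z m != 0].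

Definition comp3C : Type := chart M -> M -> 'I_2 -> 'I_2 -> 'I_2 -> R[i].

(* Locally C = c dz^3, with [z] a holomorphic coordinate and [c] holomorphic. *)
Definition holomorphic_cubic_differential (g : cov2) (C : comp3C) : Prop :=
  forall m0 : M, exists (W : set M) (z c : M -> R[i]),
    [/\ open W /\ W m0, holomorphic_coordinate g W z, holomorphic_on g W c
      & forall a m, W m -> dom a m -> forall i j k,
          C a m i j k = c m * pdC a i z m * pdC a j z m * pdC a k z m].

Definition cubic_eval (C : comp3C) (a : chart M) (m : M) (v : 'cV[R]_2) : R[i] :=
  \sum_(i < 2) \sum_(j < 2) \sum_(k < 2)
    C a m i j k * Complex (v i 0 * v j 0 * v k 0) 0.

(* alpha^i_jk = g^il A_ljk with A = Re C *)
Definition alpha (g : cov2) (C : comp3C) : comp12 := fun a m i j k =>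
  \sum_(l < 2) invmx (g a m) i l * complex.Re (C a m l j k).

Definition blaschke_metric (p : set comp12) (g : cov2) : Prop :=
  riemannian g /\
  exists C : comp3C,
    [/\ holomorphic_cubic_differential g C,
        p (fun a m i j k => levi_civita g a m i j k + alpha g C a m i j k)
      & forall a m (v : 'cV[R]_2), dom a m -> inner (g a m) v v = 1 ->
          gauss_curvature g a m
          = -1 + 2 * ((complex.Re (cubic_eval C a m v)) ^+ 2
                      + (complex.Im (cubic_eval C a m v)) ^+ 2)].

End Geometry.

(* Main.v *)
From HB Require Import structures.
Require Import Defs.
From mathcomp Require Import all_boot all_order all_algebra.
From mathcomp Require Import all_classical all_reals all_analysis.
From mathcomp Require Import measurable_realfun complex ring lra.

Set Implicit Arguments.
Unset Strict Implicit.
Unset Printing Implicit Defensive.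

Import Order.TTheory GRing.Theory Num.Theory.
Import numFieldNormedType.Exports.

Local Open Scope classical_set_scope.
Local Open Scope ring_scope.

Import Defs.

(** The energy of [g + t *: h] has the integrand [|Phi|^2 dmu], where [Phi] is the
    trace-free part of the difference between a connection of [p] and the
    Levi-Civita connection of [g + t *: h].  The following facts make its
    derivative at [t = 0] vanish.

    The connection of [p] is arbitrary.  Near every point of the surface the
    geodesics of all connections of [p] are the images of straight lines of the
    convex domain.  At a given point these have all directions, so two
    connections of [p] differ there by a tensor [B] such that [B w w] is a
    multiple of [w] for all [w]; such a tensor is a pure trace
    ([projective_tracefree]).  One can therefore use the connection
    [levi_civita g + alpha g C] that comes with the Blaschke metric, where [C] is
    the holomorphic cubic differential.  With [A] the real part of [C], the
    tensor [Phi] becomes the trace-free part of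
    [alpha g C - t S], where [S] is made of the covariant derivative of [h]
    ([levi_civita_shift], [sqnorm_shift]).

    To first order in [t] the metrics in [|Phi|^2] and the area form contribute
    opposite amounts, because [A] is symmetric and trace-free in dimension 2, and
    there remains [- <nabla h, A> dmu] ([density_first_variation]).

    This is an exact form.  In a holomorphic coordinate [z], with [C = c dz^3]
    and [Z] the gradient of [z], the imaginary part of [c h(Z, Z) dz] is a globally
    defined 1-form, and its exterior derivative is [<nabla h, A> dmu]: the function
    [c] is holomorphic, and [Z] is a geodesic field because it is an isotropic
    gradient ([isotropic_geodesic], [flux_form_exterior]).  By Stokes' theorem
    the integral is zero.

    The remaining work is analytic.  The expansion in [t] is uniform on the
    surface, by joint continuity of the derivative and compactness
    ([shift_uniform]).  All integrals are taken with respect to the area measure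
    of [g], by the change of density [integral_volume_change].  Stokes' theorem
    ([stokes]) is reduced by a partition of unity to compactly supported
    functions on the plane, where it follows from Fubini's theorem and the
    fundamental theorem of calculus.  It holds for forms with continuous first
    derivatives, so partitions of unity of class C^1 suffice. *)

(** * Calculus in the plane *)

Section PlaneCalculus.
Variable R : realType.
Implicit Types (U : set (R * R)) (f : R * R -> R) (x v w : R * R).

Lemma line_derive (V : normedModType R) (f : V -> R) (x v : V) (t : R) :
  derivable f (x + t *: v) v ->
  is_derive t 1 (fun s => f (x + s *: v)) ('D_v f (x + t *: v)).
Proof.
move=> df.
have E : (fun h => h^-1 *: (((fun s => f (x + s *: v)) \o shift t) (h *: 1) - f (x + t *: v))) =
         (fun h => h^-1 *: ((f \o shift (x + t *: v)) (h *: v) - f (x + t *: v))).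
  apply/funext => h /=; congr (_ *: (f _ - _)).
  by rewrite [h *: 1]mulr1 scalerDl addrCA.
by split; rewrite /derivable /derive E.
Qed.

(** With absolute values, so that increments of both signs are covered. *)
Lemma MVT0 (phi : R -> R) (d : R -> R) (t : R) :
  (forall s : R, `|s| <= `|t| -> is_derive s 1 phi (d s)) ->
  exists2 s, `|s| <= `|t| & phi t - phi 0 = d s * t.
Proof.
move=> H.
have C (a b : R) : `|a| <= `|t| -> `|b| <= `|t| -> a <= b ->
  exists2 c, c \in `[a, b]%R & phi b - phi a = d c * (b - a).
  rewrite !ler_norml => /andP[a1 a2] /andP[b1 b2] ab.
  apply: MVT_segment => // [x|].
    by rewrite in_itv /= => /andP[xa xb]; apply: H; rewrite ler_norml; apply/andP; split; lra.
  apply: derivable_within_continuous => x; rewrite in_itv /= => /andP[xa xb].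
  by apply: (@ex_derive _ _ _ _ _ _ (d x)); apply: H; rewrite ler_norml; apply/andP; split; lra.
have n0 : `|0 : R| <= `|t| by rewrite normr0.
have [t0|/ltW t0] := leP 0 t.
  have [c] := C 0 t n0 (lexx _) t0.
  rewrite in_itv /= => /andP[c0 ct] ->; exists c; last by rewrite subr0.
  by rewrite !ger0_norm.
have [c] := C t 0 (lexx _) n0 t0.
rewrite in_itv /= => /andP[c0 ct] E; exists c; last by lra.
by rewrite !ler0_norm ?lerN2.
Qed.

Lemma line_MVT (V : normedModType R) (f : V -> R) (x v : V) (t : R) :
  (forall s : R, `|s| <= `|t| -> derivable f (x + s *: v) v) ->
  exists2 s, `|s| <= `|t| & f (x + t *: v) - f x = 'D_v f (x + s *: v) * t.
Proof.
move=> H; have := @MVT0 (fun s => f (x + s *: v)) (fun s => 'D_v f (x + s *: v)) t.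
case=> [s st|s st E]; first exact/line_derive/H.
by exists s => //; rewrite -E scale0r addr0.
Qed.

Lemma plane_step x (s t : R) :
  x + s *: e_ R 0 + t *: e_ R 1 = (x.1 + s, x.2 + t).
Proof.
by apply: injective_projections;
  rewrite /= ?[_ *: 1%R]mulr1 ?[_ *: 0%R]mulr0 ?addr0 ?add0r.
Qed.

Lemma plane_decomp x : x = x.1 *: e_ R 0 + x.2 *: e_ R 1.
Proof.
by apply: injective_projections; rewrite /= ?[_ *: 1]mulr1 ?[_ *: 0]mulr0 ?addr0 ?add0r.
Qed.

Lemma plane_normP x (r : R) : (`|x| < r) = (`|x.1| < r) && (`|x.2| < r).
Proof. by rewrite {1}/Num.norm /= gt_max. Qed.

(** The norm of a product is a maximum, so neighbourhoods are squares. *)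
Lemma near_ballP x (P : R * R -> Prop) :
  (\forall y \near x, P y) <->
  exists2 r, 0 < r & forall s t : R, `|s| < r -> `|t| < r -> P (x + s *: e_ R 0 + t *: e_ R 1).
Proof.
split.
  move=> /nbhs_normP[r /= r0 H]; exists r => // s t sr tr; apply: H.
  by rewrite plane_step /ball_ /= plane_normP /= !opprD !addrA !subrr !add0r !normrN sr tr.
move=> [r r0 H]; apply/nbhs_normP; exists r => // y /=.
rewrite /ball_ /= plane_normP /= distrC => /andP[a]; rewrite distrC => b.
have := H _ _ a b; rewrite -addrA.
have -> : (y.1 - x.1) *: e_ R 0 + (y.2 - x.2) *: e_ R 1 = y - x by rewrite [RHS]plane_decomp.
by rewrite addrC subrK.
Qed.

Lemma differentiable_approx (V W : normedModType R) (F : V -> W)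
    (L : {linear V -> W}) (y : V) : continuous L ->
  (forall e, 0 < e ->
     \forall h \near (0 : V), `|F (h + y) - (F y + L h)| <= e * `|h|) ->
  differentiable F y.
Proof.
move=> cL H.
have E : F \o shift y = cst (F y) + L +o_ 0 id.
  by apply/eqaddoP => e e0; exact: H.
by apply/diff_locallyP; rewrite (diff_unique cL E).
Qed.

Lemma near_eq_differentiable (V W : normedModType R) (F G : V -> W) (y : V) :
  (\forall z \near y, F z = G z) -> differentiable F y -> differentiable G y.
Proof.
move=> E dF; apply: (@differentiable_approx _ _ _ ('d F y)); first exact: diff_continuous.
move=> e e0; have := diff_locally dF.
move=> /eqaddoP /(_ e e0); rewrite -nbhs_nearE => H.
have E' : \forall h \near (0 : V), F (h + y) = G (h + y).
  by move: E; rewrite (near_shift 0) subr0.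
apply: filterS2 E' H => h E1 /=.
by rewrite -(nbhs_singleton E) -E1.
Qed.

(** Moving first along one axis and then along the other, the mean value
    theorem turns continuity of the partial derivatives into a linear
    approximation of the function. *)
Lemma C1_differentiable f x :
  (\forall y \near x, derivable f y (e_ R 0) /\ derivable f y (e_ R 1)) ->
  {for x, continuous (fun y => 'D_(e_ R 0) f y)} ->
  {for x, continuous (fun y => 'D_(e_ R 1) f y)} ->
  differentiable f x.
Proof.
move=> df c0 c1.
pose L (h : R * R) : R := h.1 * 'D_(e_ R 0) f x + h.2 * 'D_(e_ R 1) f x.
have linL : linear L by move=> a u v; rewrite /L /= !mulrDl scalerDr -!scalerAl addrACA.
pose HL := GRing.isLinear.Build _ _ _ _ _ linL.
pose LL : {linear (R * R)%type -> R} := HB.pack L HL.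
have cL : continuous LL.
  move=> h; apply: cvgD; apply: cvgM; try exact: cvg_cst.
    exact: cvg_fst.
  exact: cvg_snd.
apply: (differentiable_approx cL) => e e0.
  have e2 : 0 < e / 2 by rewrite divr_gt0.
  have := c0; move/cvgrPdist_le => /(_ _ e2) K0.
  have := c1; move/cvgrPdist_le => /(_ _ e2) K1.
  have /near_ballP[r r0 H] : \forall y \near x,
    [/\ derivable f y (e_ R 0) /\ derivable f y (e_ R 1),
     `|'D_(e_ R 0) f x - 'D_(e_ R 0) f y| <= e / 2 &
     `|'D_(e_ R 1) f x - 'D_(e_ R 1) f y| <= e / 2].
    exact: (filterS3 _ (fun y A B C => And3 A B C) df K0 K1).
  suff key (h : R * R) : `|h.1| < r -> `|h.2| < r ->
      `|f (h + x) - (f x + L h)| <= e * `|h|.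
    apply/nbhs_normP; exists r => // h.
    by rewrite /= /ball_ /= sub0r normrN plane_normP => /andP[h1 h2]; exact: key.
  move=> h1 h2.
  have r00 : `|0 : R| < r by rewrite normr0.
  pose p := x + h.1 *: e_ R 0.
  have [s sh Es] : exists2 s, `|s| <= `|h.1| &
      f p - f x = 'D_(e_ R 0) f (x + s *: e_ R 0) * h.1.
    apply: line_MVT => s sh; have [[+ _] _ _] := H s 0 (le_lt_trans sh h1) r00.
    by rewrite scale0r addr0.
  have [t th Et] : exists2 t, `|t| <= `|h.2| &
      f (p + h.2 *: e_ R 1) - f p = 'D_(e_ R 1) f (p + t *: e_ R 1) * h.2.
    by apply: line_MVT => t th; have [[]] := H h.1 t h1 (le_lt_trans th h2).
  have Eh : h + x = p + h.2 *: e_ R 1 by rewrite addrC {1}[h]plane_decomp addrA.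
  have [_ Hs _] := H s 0 (le_lt_trans sh h1) r00.
  rewrite scale0r addr0 in Hs.
  have [_ _ Ht] := H h.1 t h1 (le_lt_trans th h2).
  rewrite Eh.
  have -> : f (p + h.2 *: e_ R 1) - (f x + L h) =
     ('D_(e_ R 1) f (p + t *: e_ R 1) - 'D_(e_ R 1) f x) * h.2 +
     ('D_(e_ R 0) f (x + s *: e_ R 0) - 'D_(e_ R 0) f x) * h.1.
    have A (a b c d1 d2 u w k1 k2 : R) : c - b = d2 * k2 -> b - a = d1 * k1 ->
      c - (a + (k1 * u + k2 * w)) = (d2 - w) * k2 + (d1 - u) * k1 by lra.
    exact: (A _ _ _ _ _ _ _ _ _ Et Es).
  have hn1 : `|h.1| <= `|h| by rewrite [leRHS]/Num.norm /= le_max lexx.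
  have hn2 : `|h.2| <= `|h| by rewrite [leRHS]/Num.norm /= le_max lexx orbT.
  have B (a b c k n : R) : `|a - b| <= e / 2 -> `|k| <= n -> `|(b - a) * k| <= e / 2 * n.
    by move=> H1 H2; rewrite normrM ler_pM // distrC.
  have S (a b n : R) : `|a| <= e / 2 * n -> `|b| <= e / 2 * n -> `|a + b| <= e * n.
    by move=> H1 H2; rewrite (le_trans (ler_normD _ _)) // [e]splitr mulrDl lerD.
  exact: S (B _ _ _ _ _ Ht hn2) (B _ _ _ _ _ Hs hn1).
Qed.

End PlaneCalculus.

Section Schwarz.
Variable R : realType.
Implicit Types (U : set (R * R)) (f : R * R -> R) (x v w : R * R).

(** The mean value theorem is applied to the increment along [w] as a function of
    the position along [v], and then to the derivative along [v] as a function
    of the position along [w]. *)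
Lemma mixed_MVT f x v w (d : R) :
  (forall s t : R, `|s| <= `|d| -> `|t| <= `|d| ->
     derivable f (x + s *: v + t *: w) v /\
     derivable (fun y => 'D_v f y) (x + s *: v + t *: w) w) ->
  exists s t : R, [/\ `|s| <= `|d|, `|t| <= `|d| &
    f (x + d *: v + d *: w) - f (x + d *: v) - (f (x + d *: w) - f x) =
    'D_w (fun y => 'D_v f y) (x + s *: v + t *: w) * d * d].
Proof.
move=> H.
have d0 : `|0 : R| <= `|d| by rewrite normr0.
pose phi s := f (x + d *: w + s *: v) - f (x + s *: v).
have [|s sd Es] := @MVT0 _ phi
    (fun s => 'D_v f (x + d *: w + s *: v) - 'D_v f (x + s *: v)) d.
  move=> s sd; apply: is_deriveB; apply: line_derive.
    by rewrite (addrAC x (d *: w)); have [] := H s d sd (lexx _).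
  by have [+ _] := H s 0 sd d0; rewrite scale0r addr0.
have [|t td Et] := @line_MVT _ _ (fun y => 'D_v f y) (x + s *: v) w d.
  by move=> t td; have [] := H s t sd td.
exists s, t; split=> //; rewrite -Et.
have -> : x + s *: v + d *: w = x + d *: w + s *: v by rewrite addrAC.
rewrite -Es /phi !scale0r !addr0.
by rewrite [x + d *: v + _]addrAC.
Qed.

(** Both iterated derivatives are limits of the same second difference. *)
Lemma schwarz f x :
  (\forall y \near x, forall i : 'I_2, derivable f y (e_ R i)) ->
  (\forall y \near x, forall i j : 'I_2,
     derivable (fun y => 'D_(e_ R i) f y) y (e_ R j)) ->
  (forall i j : 'I_2,
     {for x, continuous (fun y => 'D_(e_ R j) (fun y => 'D_(e_ R i) f y) y)}) ->
  'D_(e_ R 1) (fun y => 'D_(e_ R 0) f y) x =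
  'D_(e_ R 0) (fun y => 'D_(e_ R 1) f y) x.
Proof.
move=> d1 d2 c; set A := LHS; set B := RHS.
apply/eqP; rewrite -subr_eq0 -normr_le0; apply/ler_addgt0Pl => e e0; rewrite addr0.
have e2 : 0 < e / 2 by rewrite divr_gt0.
have := c 0 1; move/cvgrPdist_le => /(_ _ e2) KA.
have := c 1 0; move/cvgrPdist_le => /(_ _ e2) KB.
have [r r0 H] := (near_ballP _ _).1 (filterI (filterI d1 d2) (filterI KA KB)).
have rr (s : R) : `|s| <= `|r / 2| -> `|s| < r.
  by move=> /le_lt_trans; apply; rewrite ger0_norm ?divr_ge0 ?ltW //; lra.
have [|s [t [/rr sr /rr tr E1]]] := @mixed_MVT f x (e_ R 0) (e_ R 1) (r / 2).
  move=> s t /rr sr /rr tr; have [[D1 D2] _] := H s t sr tr.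
  by split; [exact: D1|exact: D2].
have [|s' [t' [/rr sr' /rr tr' E2]]] := @mixed_MVT f x (e_ R 1) (e_ R 0) (r / 2).
  move=> s' t' /rr sr' /rr tr'; have [[D1 D2] _] := H t' s' tr' sr'.
  by rewrite addrAC; split; [exact: D1|exact: D2].
have [_ [+ _]] := H s t sr tr; have [_ [_ ]] := H t' s' tr' sr'.
have {E1 E2} : 'D_(e_ R 1) (fun y => 'D_(e_ R 0) f y) (x + s *: e_ R 0 + t *: e_ R 1) =
   'D_(e_ R 0) (fun y => 'D_(e_ R 1) f y) (x + t' *: e_ R 0 + s' *: e_ R 1).
  have r2 : r / 2 != 0 by rewrite gt_eqF // divr_gt0.
  have alg (a b c' d k p q : R) : k != 0 -> a - b - (c' - d) = p * k * k ->
      a - c' - (b - d) = q * k * k -> p = q.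
    move=> k0 Ep Eq; apply: (mulIf k0); apply: (mulIf k0); rewrite -Ep -Eq; ring.
  rewrite (addrAC x (s' *: _)) (addrAC x (r / 2 *: e_ R 1)) in E2.
  exact: alg r2 E1 E2.
have tri (a b p q k : R) : p = q -> `|b - q| <= k / 2 -> `|a - p| <= k / 2 -> `|a - b| <= k.
  move=> -> Hq Hp; have -> : a - b = (a - q) - (b - q) by rewrite opprB addrA subrK.
  by rewrite (le_trans (ler_normB _ _)) // [k]splitr lerD.
exact: tri.
Qed.

End Schwarz.

(** * Differentiable functions on a surface, read in charts *)

Section SurfaceCalculus.
Variables (R : realType) (M : closed_oriented_surface R).
Implicit Types (a b : chart M) (m : M) (f h : M -> R) (W : set M).

Lemma near_dom a m : dom a m -> \forall m' \near m, dom a m'.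
Proof. by move=> am; apply: open_nbhs_nbhs; split => //; exact: dom_open. Qed.

Lemma near_param a m (P : M -> Prop) : dom a m ->
  (\forall m' \near m, P m') -> \forall x \near coord a m, P (param a x).
Proof. by move=> am Pm; have := param_continuous am; apply; rewrite coordK. Qed.

Lemma near_coord a m (Q : R * R -> Prop) : dom a m ->
  (\forall x \near coord a m, Q x) -> \forall m' \near m, Q (coord a m').
Proof. by move=> am Qm; have := coord_continuous am; apply. Qed.

Lemma near_coordK a m : dom a m ->
  \forall x \near coord a m, coord a (param a x) = x.
Proof.
move=> am; have : \forall x \near coord a m, (coord a @` dom a) x.
  by apply: open_nbhs_nbhs; split; [exact: coord_dom_open|exists m].
by apply: filterS => x [m' am' <-]; rewrite coordK.
Qed.

Lemma continuous_chart a m (F : R * R -> R) f : dom a m ->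
  {for coord a m, continuous F} ->
  (\forall m' \near m, f m' = F (coord a m')) -> {for m, continuous f}.
Proof.
move=> am cF E; have Em := nbhs_singleton E.
rewrite /prop_for /continuous_at Em.
have : F (coord a m') @[m' --> m] --> F (coord a m).
  by apply: continuous_comp => //; exact: coord_continuous.
by apply: cvg_trans; apply: near_eq_cvg; apply: filterS E => m' ->.
Qed.

Lemma continuous_near m f h : (\forall m' \near m, f m' = h m') ->
  {for m, continuous f} -> {for m, continuous h}.
Proof.
move=> E; rewrite /prop_for /continuous_at -(nbhs_singleton E).
by apply: cvg_trans; apply: near_eq_cvg.
Qed.

Definition diff_in a f m := differentiable (f \o param a) (coord a m).

(** Continuity of the partial derivatives is required at [m] only: the condition
    will be imposed at all points. *)
Definition C1at a m f :=
  (\forall m' \near m, diff_in a f m') /\ forall i, {for m, continuous (pd a i f)}.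

Lemma pd_near a m i f h : dom a m ->
  (\forall m' \near m, f m' = h m') -> pd a i f m = pd a i h m.
Proof. by move=> am E; apply: near_eq_derive; exact: (near_param am E). Qed.

Lemma diff_in_near a m f h : dom a m ->
  (\forall m' \near m, f m' = h m') -> diff_in a f m -> diff_in a h m.
Proof.
by move=> am /(near_param am) E; exact: near_eq_differentiable.
Qed.

Lemma diff_inD a m f h : diff_in a f m -> diff_in a h m ->
  diff_in a (fun m => f m + h m) m.
Proof. by move=> df dh; exact: (differentiableD df dh). Qed.

Lemma diff_inN a m f : diff_in a f m -> diff_in a (fun m => - f m) m.
Proof. by move=> df; exact: (differentiableN df). Qed.

Lemma diff_inM a m f h : diff_in a f m -> diff_in a h m ->
  diff_in a (fun m => f m * h m) m.
Proof. by move=> df dh; exact: (differentiableM df dh). Qed.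

Lemma diff_inV a m f : dom a m -> f m != 0 -> diff_in a f m ->
  diff_in a (fun m => (f m)^-1) m.
Proof.
by move=> am f0 df; apply: (differentiableV df); rewrite /= coordK.
Qed.

Lemma diff_in_cst a m (c : R) : diff_in a (fun=> c) m.
Proof. exact: differentiable_cst. Qed.

Lemma pd_cst a m i (c : R) : pd a i (fun=> c) m = 0.
Proof. exact: derive_cst. Qed.

Lemma pdD a m i f h : diff_in a f m -> diff_in a h m ->
  pd a i (fun m => f m + h m) m = pd a i f m + pd a i h m.
Proof. by move=> /diff_derivable df /diff_derivable dh; exact: deriveD (df _) (dh _). Qed.

Lemma pdN a m i f : diff_in a f m -> pd a i (fun m => - f m) m = - pd a i f m.
Proof. by move=> /diff_derivable df; exact: deriveN (df _). Qed.

Lemma pdB a m i f h : diff_in a f m -> diff_in a h m ->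
  pd a i (fun m => f m - h m) m = pd a i f m - pd a i h m.
Proof. by move=> /diff_derivable df /diff_derivable dh; exact: deriveB (df _) (dh _). Qed.

Lemma pdM a m i f h : dom a m -> diff_in a f m -> diff_in a h m ->
  pd a i (fun m => f m * h m) m = pd a i f m * h m + f m * pd a i h m.
Proof.
move=> am /diff_derivable df /diff_derivable dh.
have := deriveM (df (e_ R i)) (dh (e_ R i)); rewrite /= coordK // => E.
by rewrite addrC [pd a i f m * _]mulrC; exact: E.
Qed.

Lemma pdV a m i f : dom a m -> f m != 0 -> diff_in a f m ->
  pd a i (fun m => (f m)^-1) m = - (f m) ^- 2 * pd a i f m.
Proof.
move=> am f0 /diff_derivable df.
have := @deriveV _ _ _ _ (e_ R i) _ (df (e_ R i)); rewrite /= coordK // => E.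
exact: E.
Qed.

Lemma diff_in_continuous a m f : dom a m -> diff_in a f m -> {for m, continuous f}.
Proof.
move=> am /differentiable_continuous cf; apply: (continuous_chart am cf).
by apply: filterS (near_dom am) => m' am' /=; rewrite coordK.
Qed.

Lemma continuousDm m f h : {for m, continuous f} -> {for m, continuous h} ->
  {for m, continuous (fun m => f m + h m)}.
Proof. by move=> cf ch; exact: cvgD. Qed.

Lemma continuousMm m f h : {for m, continuous f} -> {for m, continuous h} ->
  {for m, continuous (fun m => f m * h m)}.
Proof. by move=> cf ch; exact: cvgM. Qed.

Lemma continuousNm m f : {for m, continuous f} -> {for m, continuous (fun m => - f m)}.
Proof. by move=> cf; exact: cvgN. Qed.

Lemma continuousVm m f : f m != 0 -> {for m, continuous f} ->
  {for m, continuous (fun m => (f m)^-1)}.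
Proof. by move=> f0 cf; exact: cvgV. Qed.

Lemma continuous_cstm m (c : R) : {for m, continuous (fun _ : M => c)}.
Proof. exact: cvg_cst. Qed.

Lemma continuous_summ m (I : Type) (r : seq I) (F : I -> M -> R) :
  (forall i, {for m, continuous (F i)}) ->
  {for m, continuous (fun m => \sum_(i <- r) F i m)}.
Proof.
move=> cF; elim: r => [|i r IH].
  under [X in {for m, continuous X}]funext do rewrite big_nil; exact: continuous_cstm.
under [X in {for m, continuous X}]funext do rewrite big_cons; exact: continuousDm.
Qed.

Lemma C1at_continuous a m f : dom a m -> C1at a m f -> {for m, continuous f}.
Proof. by move=> am [/nbhs_singleton df _]; exact: diff_in_continuous df. Qed.

Lemma C1at_near a m f h : dom a m ->
  (\forall m' \near m, f m' = h m') -> C1at a m f -> C1at a m h.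
Proof.
move=> am E [df cf].
have E' := near_join E.
have am' := near_dom am; split.
  by near=> z; apply: (@diff_in_near _ _ f); [near: z|near: z; exact: E'|near: z].
move=> i; apply: continuous_near (cf i); near=> z; apply: pd_near; first by near: z.
by near: z; exact: E'.
Unshelve. all: by end_near. Qed.

Lemma C1at_cst a m (c : R) : C1at a m (fun=> c).
Proof.
split; first by apply: filterE => z; exact: diff_in_cst.
move=> i; rewrite (_ : pd a i _ = fun=> 0); first exact: continuous_cstm.
by apply/funext => z; exact: pd_cst.
Qed.

Lemma C1atD a m f h : C1at a m f -> C1at a m h -> C1at a m (fun m => f m + h m).
Proof.
move=> [df cf] [dh ch]; split; first by apply: filterS2 df dh => z; exact: diff_inD.
move=> i; apply: continuous_near (continuousDm (cf i) (ch i)).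
by apply: filterS2 df dh => z dfz dhz; rewrite pdD.
Qed.

Lemma C1atN a m f : C1at a m f -> C1at a m (fun m => - f m).
Proof.
move=> [df cf]; split; first by apply: filterS df => z; exact: diff_inN.
move=> i; apply: continuous_near (continuousNm (cf i)).
by apply: filterS df => z dfz; rewrite pdN.
Qed.

Lemma C1atM a m f h : dom a m -> C1at a m f -> C1at a m h ->
  C1at a m (fun m => f m * h m).
Proof.
move=> am Cf Ch; have fc := C1at_continuous am Cf; have hc := C1at_continuous am Ch.
case: Cf Ch => [df cf] [dh ch]; split.
  by apply: filterS2 df dh => z; exact: diff_inM.
move=> i; apply: continuous_near
  (continuousDm (continuousMm (cf i) hc) (continuousMm fc (ch i))).
by apply: filterS3 (near_dom am) df dh => z az dfz dhz; rewrite pdM.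
Qed.

Lemma near_neq0 m f : f m != 0 -> {for m, continuous f} ->
  \forall z \near m, f z != 0.
Proof.
move=> f0 cf; have O : nbhs (f m) [set y : R | y != 0].
  by apply: open_nbhs_nbhs; split; [exact: open_neq|exact: f0].
exact: (cf _ O).
Qed.

Lemma C1atV a m f : dom a m -> f m != 0 -> C1at a m f ->
  C1at a m (fun m => (f m)^-1).
Proof.
move=> am f0 Cf; have fc := C1at_continuous am Cf; case: Cf => df cf.
have n0 := near_neq0 f0 fc; split.
  by apply: filterS3 (near_dom am) n0 df => z; exact: diff_inV.
move=> i; have c2 : {for m, continuous (fun m => - (f m) ^- 2)}.
  apply: continuousNm; apply: continuousVm; first by rewrite expf_neq0.
  rewrite (_ : (fun m => _) = fun m => f m * f m); first exact: continuousMm.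
  by apply/funext => z; rewrite expr2.
apply: continuous_near (continuousMm c2 (cf i)).
by apply: filterS3 (near_dom am) n0 df => z az fz dfz; rewrite pdV.
Qed.

Lemma C1at_sum a m (I : Type) (r : seq I) (F : I -> M -> R) :
  (forall i, C1at a m (F i)) -> C1at a m (fun m => \sum_(i <- r) F i m).
Proof.
move=> CF; elim: r => [|i r IH].
  under [X in C1at a m X]funext do rewrite big_nil; exact: C1at_cst.
under [X in C1at a m X]funext do rewrite big_cons; exact: C1atD.
Qed.

Lemma diff_in_sum a m (I : Type) (r : seq I) (F : I -> M -> R) :
  (forall i, diff_in a (F i) m) -> diff_in a (fun m => \sum_(i <- r) F i m) m.
Proof.
move=> CF; elim: r => [|i r IH].
  under [X in diff_in a X m]funext do rewrite big_nil; exact: diff_in_cst.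
under [X in diff_in a X m]funext do rewrite big_cons; exact: diff_inD.
Qed.

Lemma pd_sum a m k (I : Type) (r : seq I) (F : I -> M -> R) :
  (forall i, diff_in a (F i) m) ->
  pd a k (fun m => \sum_(i <- r) F i m) m = \sum_(i <- r) pd a k (F i) m.
Proof.
move=> CF; elim: r => [|i r IH].
  rewrite big_nil -[RHS](pd_cst a m k 0); congr pd.
  by apply/funext => z; rewrite big_nil.
rewrite big_cons -IH -pdD //; last exact: diff_in_sum.
by congr pd; apply/funext => z; rewrite big_cons.
Qed.

Lemma C1at_diff a m f : C1at a m f -> diff_in a f m.
Proof. by case=> /nbhs_singleton. Qed.

End SurfaceCalculus.

Section ChainRule.
Variable R : realType.

Lemma chain_rule (V : normedModType R) (G0 G1 : V -> R) (F : R * R -> R) (x v : V) :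
  differentiable G0 x -> differentiable G1 x -> differentiable F (G0 x, G1 x) ->
  differentiable (fun y => F (G0 y, G1 y)) x /\
  'D_v (fun y => F (G0 y, G1 y)) x =
    'D_v G0 x * 'D_(e_ R 0) F (G0 x, G1 x) + 'D_v G1 x * 'D_(e_ R 1) F (G0 x, G1 x).
Proof.
move=> d0 d1 dF; pose G y := (G0 y, G1 y).
have dG : differentiable G x by exact: differentiable_pair.
have dFG : differentiable (F \o G) x by exact: differentiable_comp.
split; first exact: dFG.
rewrite [LHS](deriveE v dFG) diff_comp //= /G diff_pair // !deriveE //.
have L (l : {linear (R * R)%type -> R}) (s t : R) :
    l (s, t) = s * l (e_ R 0) + t * l (e_ R 1).
  by rewrite [(s, t)]plane_decomp linearD !linearZ.
exact: L.
Qed.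

Lemma Ck_ext n (U : set (R * R)) (F G : R * R -> R) : open U ->
  (forall x, U x -> F x = G x) -> Ck n U F -> Ck n U G.
Proof.
move=> oU; elim: n F G => [|n IH] F G E.
  move=> /= cF x Ux; have Un : \forall y \near x, U y by apply: open_nbhs_nbhs.
  rewrite /prop_for /continuous_at -E //; apply: cvg_trans (cF x Ux).
  by apply: near_eq_cvg; apply: filterS Un => y Uy; rewrite E.
move=> /= H i; have [D C] := H i; split.
  move=> x Ux; apply: near_eq_derivable (D x Ux).
  by apply: filterS (open_nbhs_nbhs (conj oU Ux)) => y; exact: E.
apply: IH C => x Ux; apply: near_eq_derive.
by apply: filterS (open_nbhs_nbhs (conj oU Ux)) => y; exact: E.
Qed.

Lemma Ck1_near (U : set (R * R)) (F : R * R -> R) (x : R * R) : open U -> U x ->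
  Ck 1 U F -> differentiable F x /\ forall i, {for x, continuous (fun y => 'D_(e_ R i) F y)}.
Proof.
move=> oU Ux H; split; last by move=> i; have [_ ] := H i; exact.
apply: C1_differentiable; last 2 first.
- by have [_ ] := H 0; exact.
- by have [_ ] := H 1; exact.
by apply: filterS (open_nbhs_nbhs (conj oU Ux)) => y Uy; split;
  [have [D _] := H 0|have [D _] := H 1]; exact: D.
Qed.

End ChainRule.

Section SmoothFunctions.
Variables (R : realType) (M : closed_oriented_surface R).
Implicit Types (a b : chart M) (m : M) (f h : M -> R) (W : set M).

Definition smooth_in a W f := smooth_on (coord a @` (W `&` dom a)) (f \o param a).

Lemma near_image a W m : open W -> W m -> dom a m ->
  \forall x \near coord a m, (coord a @` (W `&` dom a)) x.
Proof.
move=> oW Wm am.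
have Wn : \forall z \near m, W z by apply: open_nbhs_nbhs.
apply: filterS2 (near_coordK am) (near_param am (filterI Wn (near_dom am))).
by move=> x E [Wx ax]; exists (param a x).
Qed.

Lemma open_image a W : open W -> open (coord a @` (W `&` dom a)).
Proof.
move=> oW; rewrite openE => x [m [Wm am] <-].
exact: (near_image oW Wm am).
Qed.

Lemma smooth_C1at a W f m : open W -> W m -> dom a m -> smooth_in a W f -> C1at a m f.
Proof.
move=> oW Wm am sf; have oU := open_image (a := a) oW.
have H z : W z -> dom a z -> diff_in a f z /\ forall i, {for z, continuous (pd a i f)}.
  move=> Wz az; have Uz : (coord a @` (W `&` dom a)) (coord a z) by exists z.
  have [D C] := Ck1_near oU Uz (sf 1).
  split; first exact: D.
  by move=> i; apply: (continuous_chart az (C i)); exact: filterE.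
split; last by move=> i; have [] := H m Wm am.
have Wn : \forall z \near m, W z by apply: open_nbhs_nbhs.
by apply: filterS2 Wn (near_dom am) => z Wz az; have [] := H z Wz az.
Qed.

Lemma smooth_in_pd a W f i : open W -> smooth_in a W f -> smooth_in a W (pd a i f).
Proof.
move=> oW sf n; have [_ C] := sf n.+1 i.
apply: Ck_ext C; first exact: open_image.
by move=> x [m [Wm am] <-]; rewrite /pd /= coordK.
Qed.

Lemma pd_schwarz a W f m : open W -> W m -> dom a m -> smooth_in a W f ->
  pd a 1 (pd a 0 f) m = pd a 0 (pd a 1 f) m.
Proof.
move=> oW Wm am sf; have oU := open_image (a := a) oW.
have Un := near_image oW Wm am.
pose F := f \o param a.
have K i j : pd a j (pd a i f) m = 'D_(e_ R j) (fun y => 'D_(e_ R i) F y) (coord a m).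
  apply: near_eq_derive; apply: filterS Un => x [z [Wz az] <-].
  by rewrite /pd /= coordK.
rewrite !K; apply: schwarz.
- by apply: filterS Un => x Ux i; have [D _] := sf 1%N i; exact: D.
- apply: filterS Un => x Ux i j; have [_ C] := sf 2 i; have [D _] := C j; exact: D.
- by move=> i j; have [_ C] := sf 2 i; have [_ D] := C j; apply: D; exact: nbhs_singleton Un.
Qed.

Lemma smooth_in_trans a b k : smooth_in a (dom b) (fun z => crd k (coord b z)).
Proof.
have := transition_smooth a b k; rewrite setIC; exact.
Qed.

Lemma diff_in_trans a b m k : dom a m -> dom b m ->
  diff_in a (fun z => crd k (coord b z)) m.
Proof.
move=> am bm; apply: C1at_diff.
exact: smooth_C1at (dom_open b) bm am (smooth_in_trans a b k).
Qed.

(** Near [m], the function read in the chart [a] is the function read in the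
    chart [b] after the transition map. *)
Lemma chain_chart a b m f : dom a m -> dom b m -> diff_in b f m ->
  diff_in a f m /\ forall i, pd a i f m = \sum_(k < 2) jac b a m k i * pd b k f m.
Proof.
move=> am bm df.
pose G k x := crd k (coord b (param a x)).
have dG k : differentiable (G k) (coord a m) by exact: diff_in_trans.
have EG x : (G 0 x, G 1 x) = coord b (param a x) by rewrite /G /crd /=; case: (coord b _).
have dF : differentiable (f \o param b) (G 0 (coord a m), G 1 (coord a m)).
  by rewrite EG coordK.
have E : \forall x \near coord a m,
    (f \o param b) (G 0 x, G 1 x) = (f \o param a) x.
  apply: filterS (near_param am (near_dom bm)) => x bx.
  by rewrite EG /= coordK.
have C v := @chain_rule R _ (G 0) (G 1) (f \o param b) (coord a m) v (dG 0) (dG 1) dF.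
split; first exact: near_eq_differentiable E (C 0).1.
move=> i; rewrite [LHS](_ : _ = 'D_(e_ R i) (fun y => (f \o param b) (G 0 y, G 1 y)) (coord a m)).
  rewrite (C _).2 !big_ord_recl big_ord0 addr0 !mxE EG coordK //.
by apply: near_eq_derive; apply: filterS E => x ->.
Qed.

Lemma C1at_jac a b m k i : dom a m -> dom b m -> C1at a m (fun z => jac b a z k i).
Proof.
move=> am bm; have S := smooth_in_pd i (dom_open b) (smooth_in_trans a b k).
have := smooth_C1at (dom_open b) bm am S.
by apply: C1at_near => //; apply: filterE => z; rewrite mxE.
Qed.

Lemma C1at_chart a b m f : dom a m -> dom b m -> C1at b m f -> C1at a m f.
Proof.
move=> am bm [df cf]; split.
  by apply: filterS3 (near_dom am) (near_dom bm) df => z az bz /(chain_chart az bz)[].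
move=> i; have C : {for m, continuous (fun z => \sum_(k < 2) jac b a z k i * pd b k f z)}.
  apply: continuous_summ => k; apply: continuousMm => //.
  exact: C1at_continuous am (C1at_jac k i am bm).
apply: continuous_near C.
by apply: filterS3 (near_dom am) (near_dom bm) df => z az bz /(chain_chart az bz)[_ ->].
Qed.

End SmoothFunctions.

(** * Projectively equivalent connections *)

Section ProjectiveEquivalence.
Variables (R : realType) (M : closed_oriented_surface R).
Implicit Types (a b : chart M) (m : M) (N : comp12 M).

Lemma near_preimage (T U : topologicalType) (h : T -> U) (t : T) (P : U -> Prop) :
  {for t, continuous h} -> (\forall y \near h t, P y) -> \forall z \near t, P (h z).
Proof. by move=> ch Py; exact: (ch _ Py). Qed.

(** A curve running along a straight line, at any speed, keeps its direction:
    its acceleration contributes a multiple of the first derivative. *)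
Lemma comp_line_derive2 (F : R * R -> R) (x v : R * R) (s : R -> R) (tau : R) :
  s tau = 0 ->
  (\forall y \near x, differentiable F y) ->
  differentiable (fun y => 'D_v F y) x ->
  (\forall t \near tau, derivable s t 1) -> derivable (derive1 s) tau 1 ->
  let u := fun t => F (x + s t *: v) in
  derive1 u tau = derive1 s tau * 'D_v F x /\
  derive1 (derive1 u) tau = derive1 (derive1 s) tau * 'D_v F x
     + derive1 s tau ^+ 2 * 'D_v (fun y => 'D_v F y) x.
Proof.
move=> s0 dF dF2 ds ds2 u.
have cs : {for tau, continuous s}.
  by apply: differentiable_continuous; apply/derivable1_diffP; exact: nbhs_singleton ds.
have cl : {for tau, continuous (fun t => x + s t *: v)}.
  by apply: cvgD; [exact: cvg_cst|apply: cvgZl].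
have dFn : \forall t \near tau, differentiable F (x + s t *: v).
  by apply: (near_preimage (P := fun y => differentiable F y) cl); rewrite s0 scale0r addr0.
have D1 : \forall t \near tau, derive1 u t = derive1 s t * 'D_v F (x + s t *: v).
  apply: filterS2 ds dFn => t dst dFt; rewrite mulrC.
  rewrite !derive1E; have K := @line_derive _ _ F x v (s t) (diff_derivable dFt).
  have ds' := derivableP dst.
  exact: (@derive_val _ _ _ _ _ _ _ (is_derive1_comp K ds')).
split; first by rewrite (nbhs_singleton D1) s0 scale0r addr0.
rewrite derive1E (near_eq_derive _ D1).
have K : is_derive (s tau) 1 (fun r => 'D_v F (x + r *: v)) ('D_v (fun y => 'D_v F y) x).
  have := @line_derive R _ (fun y => 'D_v F y) x v (s tau).
  by rewrite s0 scale0r addr0; apply; exact: diff_derivable.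
have K2 := is_derive1_comp K (derivableP (nbhs_singleton ds)).
rewrite [LHS](deriveM ds2 (@ex_derive _ _ _ _ _ _ _ K2)).
rewrite (@derive_val _ _ _ _ _ _ _ K2) /= s0 scale0r addr0 -!derive1E.
rewrite /GRing.scale /=; ring.
Qed.

Lemma derive_along (F : R * R -> R) (x v : R * R) : differentiable F x ->
  'D_v F x = v.1 * 'D_(e_ R 0) F x + v.2 * 'D_(e_ R 1) F x.
Proof.
move=> dF; rewrite !deriveE //.
have L (l : {linear (R * R)%type -> R}) w : l w = w.1 * l (e_ R 0) + w.2 * l (e_ R 1).
  by rewrite {1}[w]plane_decomp linearD !linearZ.
exact: L.
Qed.

(** At a point of [Om] every direction is the velocity of a straight line, and
    the image of that line satisfies the geodesic equation up to a multiple of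
    its velocity. *)
Lemma acceleration_of_lines (Om : set (R * R)) (f : R * R -> M) N a (x v : R * R) :
  open Om -> (forall y, Om y -> {for y, continuous f}) ->
  (forall a k, smooth_on (Om `&` f @^-1` dom a) (fun y => crd k (coord a (f y)))) ->
  pulls_back_to_flat Om f N -> Om x -> dom a (f x) ->
  let X k y := crd k (coord a (f y)) in
  exists lam : R, forall i,
    'D_v (fun y => 'D_v (X i) y) x
     + \sum_(j < 2) \sum_(k < 2) N a (f x) i j k * 'D_v (X j) x * 'D_v (X k) x
    = lam * 'D_v (X i) x.
Proof.
move=> oOm cf sX [flat _] Omx afx X.
have oU : open (Om `&` f @^-1` dom a).
  rewrite openE => y [Omy ay]; apply: filterI; first exact: open_nbhs_nbhs.
  exact: (near_preimage (cf y Omy) (near_dom ay)).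
have Un : \forall y \near x, (Om `&` f @^-1` dom a) y by apply: open_nbhs_nbhs.
have dX k : \forall y \near x, differentiable (X k) y.
  by apply: filterS Un => y Uy; exact: (Ck1_near oU Uy (sX a k 1%N)).1.
have dX2 k : differentiable (fun y => 'D_v (X k) y) x.
  have D i : differentiable (fun y => 'D_(e_ R i) (X k) y) x.
    have [_ C] := sX a k 2 i.
    exact: (Ck1_near oU (nbhs_singleton Un) C).1.
  have E : \forall y \near x, v.1 * 'D_(e_ R 0) (X k) y + v.2 * 'D_(e_ R 1) (X k) y = 'D_v (X k) y.
    by apply: filterS (dX k) => y dy; rewrite -derive_along.
  apply: near_eq_differentiable E _; apply: differentiableD.
    by apply: differentiableM => //; exact: D.
  by apply: differentiableM => //; exact: D.
have cl : {for (0 : R), continuous (fun t : R => x + t *: v)}.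
  by apply: cvgD; [exact: cvg_cst|apply: cvgZl].
have : \forall t \near (0 : R), Om (x + t *: v).
  by apply: (near_preimage (P := Om) cl); rewrite scale0r addr0; apply: open_nbhs_nbhs; split => //; apply: (nbhs_singleton Un).1.
move=> /nbhs_normP[d /= d0 Hd].
pose I := [set` `]- d, d[%R] : set R.
have oI : open_interval I by split; [exact: interval_open|exact: interval_is_interval].
have IOm t : I t -> Om (x + t *: v).
  by rewrite /I /= in_itv /= => td; apply: Hd; rewrite /ball_ /= sub0r normrN ltr_norml.
have I0 : I 0 by rewrite /I /= in_itv /= d0 oppr_lt0 d0.
have str : straight I (fun t => x + t *: v) by split=> //; exists x, v.
have [I' [s [[oI' ds s'0 sI] [_ _ geo]]]] := flat I _ str IOm.
have [tau I'tau stau] : (s @` I') 0 by rewrite sI.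
have domt : dom a ((f \o (fun t => x + t *: v) \o s) tau) by rewrite /= stau scale0r addr0.
have I'n : \forall t \near tau, I' t by apply: open_nbhs_nbhs; split => //; case: oI'.
have dsn : \forall t \near tau, derivable s t 1.
  by apply: filterS I'n => t It; exact: (ds 0%N t It).
have C k := comp_line_derive2 stau (dX k) (dX2 k) dsn (ds 1%N tau I'tau).
have ns := s'0 tau I'tau.
exists (- (derive1 (derive1 s) tau / derive1 s tau ^+ 2)) => i.
have [_ _] := geo a tau I'tau domt i.
have -> : (f \o (fun t => x + t *: v) \o s) tau = f x by rewrite /= stau scale0r addr0.
rewrite (C i).2.
set S := \sum_(j < 2) _; set T := \sum_(j < 2) _.
have -> : S = derive1 s tau ^+ 2 * T.
  rewrite /S /T mulr_sumr; apply: eq_bigr => j _.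
  rewrite mulr_sumr; apply: eq_bigr => k _.
  have alg (n s1 A B A' B' : R) : A' = s1 * A -> B' = s1 * B ->
    n * A' * B' = s1 ^+ 2 * (n * A * B) by move=> -> ->; ring.
  exact: alg (C j).1 (C k).1.
move: ns; move: (derive1 s tau) (derive1 (derive1 s) tau) => s1 s2.
move: ('D_v _ _) ('D_v _ _) => A B ns E; apply: (mulfI (expf_neq0 2 ns)).
have -> : s1 ^+ 2 * (A + T) = (s2 * B + s1 ^+ 2 * A + s1 ^+ 2 * T) - s2 * B by ring.
by rewrite E; field.
Qed.

End ProjectiveEquivalence.

Section ProjectiveTraceFree.
Variables (R : realType) (M : closed_oriented_surface R).
Implicit Types (a b : chart M) (m : M) (N : comp12 M).

Lemma sum2 (V : nmodType) (F : 'I_2 -> V) : \sum_(i < 2) F i = F 0 + F 1.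
Proof. by rewrite big_ord_recl big_ord1; congr (_ + F _); exact: val_inj. Qed.

Lemma ord2P (P : 'I_2 -> Prop) : P 0 -> P 1 -> forall i, P i.
Proof.
move=> P0 P1 [[|[|//]] lti].
  by have <- : 0 = Ordinal lti by exact: val_inj.
by have <- : 1 = Ordinal lti by exact: val_inj.
Qed.

Lemma det2 (K : comNzRingType) (A : 'M[K]_2) : \det A = A 0 0 * A 1 1 - A 0 1 * A 1 0.
Proof.
rewrite (expand_det_row _ 0) sum2 /cofactor !det_mx11 !mxE /= expr0 expr1.
have -> : lift 0 0 = 1 :> 'I_2 by exact: val_inj.
have -> : lift 1 0 = 0 :> 'I_2 by exact: val_inj.
by rewrite mul1r mulN1r mulrN.
Qed.

(** That [B w w] is a multiple of [w] is the vanishing of a binary cubic form, the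
    determinant of [B w w] and [w].  Its four coefficients are zero because its
    values at four vectors, no two of which are proportional, are zero. *)
Lemma radial_quadratic (B : 'I_2 -> 'I_2 -> 'I_2 -> R) :
  (forall i j k, B i j k = B i k j) ->
  (forall w : 'I_2 -> R, exists lam, forall i,
     \sum_(j < 2) \sum_(k < 2) B i j k * w j * w k = lam * w i) ->
  forall i j k, B i j k = 3^-1 * ((i == j)%:R * (\sum_(l < 2) B l k l)
                                + (i == k)%:R * (\sum_(l < 2) B l j l)).
Proof.
move=> symB rad.
have eqs s t : (B 0 0 0 * s * s + 2 * B 0 0 1 * s * t + B 0 1 1 * t * t) * t =
               (B 1 0 0 * s * s + 2 * B 1 0 1 * s * t + B 1 1 1 * t * t) * s.
  have [lam H] := rad (fun i => if i == 0 then s else t).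
  have := H 0; have := H 1; rewrite !sum2 /= !(symB _ 1 0) => E1 E0.
  have -> : B 0 0 0 * s * s + 2 * B 0 0 1 * s * t + B 0 1 1 * t * t = lam * s by rewrite -E0; ring.
  have -> : B 1 0 0 * s * s + 2 * B 1 0 1 * s * t + B 1 1 1 * t * t = lam * t by rewrite -E1; ring.
  ring.
have E10 := eqs 1 0; have E01 := eqs 0 1; have E11 := eqs 1 1; have E1N := eqs 1 (- 1).
have s0 := symB 0 1 0; have s1 := symB 1 1 0.
do 3![apply: ord2P]; rewrite !sum2 /=; lra.
Qed.

(** Both connections satisfy [acceleration_of_lines] at a preimage of the point
    in [Om].  In the difference of the two equations the second derivatives of
    the quotient map cancel, and since the differential of that map is
    invertible, the difference tensor is radial in every direction. *)
Lemma projective_tracefree (p : set (comp12 M)) N N' a m :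
  projective_structure p -> properly_convex p -> p N -> p N' -> dom a m ->
  forall i j k,
    tracefree (fun a m i j k => N a m i j k - N' a m i j k) a m i j k = 0.
Proof.
move=> [N0 _ pE] [Om [Ga [f [[oOm _ _] _ [cf sf dets surj _] flat]]]] pN pN' am i j k.
have [x Omx fx] : (f @` Om) m by rewrite surj.
move: am; rewrite -fx => am {m fx}.
have tf (N1 : comp12 M) : p N1 -> torsionfree_connection N1 by rewrite pE => -[].
have [_ symN _] := tf _ pN; have [_ symN' _] := tf _ pN'.
pose X k y := crd k (coord a (f y)).
have oU : open (Om `&` f @^-1` dom a).
  rewrite openE => y [Omy ay]; apply: filterI; first exact: open_nbhs_nbhs.
  exact: (near_preimage (cf y Omy) (near_dom ay)).
have dX l : differentiable (X l) x := (Ck1_near oU (conj Omx am) (sf a l 1%N)).1.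
have := dets a x Omx am; rewrite det2 !mxE.
set d00 := 'D_(e_ R 0) _ _; set d11 := 'D_(e_ R 1) _ _; set d01 := 'D_(e_ R 1) _ _; set d10 := 'D_(e_ R 0) _ _ => det0.
pose B i j k := N a (f x) i j k - N' a (f x) i j k.
have H : forall i j k, B i j k = 3^-1 * ((i == j)%:R * (\sum_(l < 2) B l k l)
                                + (i == k)%:R * (\sum_(l < 2) B l j l)).
  apply: radial_quadratic => [i' j' k'|w]; first by rewrite /B symN // symN'.
  (* the preimage of [w] under the differential, by Cramer's rule *)
  pose v : R * R := ((w 0 * d11 - w 1 * d01) / (d00 * d11 - d01 * d10),
                     (w 1 * d00 - w 0 * d10) / (d00 * d11 - d01 * d10)).
  have Dw : forall i, 'D_v (X i) x = w i.
    apply: ord2P; rewrite derive_along // -/d00 -/d01 -/d10 -/d11 /v /=.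
      by rewrite -[X in X = _]/((w 0 * d11 - w 1 * d01) / (d00 * d11 - d01 * d10) * d00 +
                     (w 1 * d00 - w 0 * d10) / (d00 * d11 - d01 * d10) * d01); field.
    by rewrite -[X in X = _]/((w 0 * d11 - w 1 * d01) / (d00 * d11 - d01 * d10) * d10 +
                     (w 1 * d00 - w 0 * d10) / (d00 * d11 - d01 * d10) * d11); field.
  have [l1 H1] := acceleration_of_lines v oOm cf sf (flat _ pN) Omx am.
  have [l2 H2] := acceleration_of_lines v oOm cf sf (flat _ pN') Omx am.
  exists (l1 - l2) => q; have := H1 q; have := H2 q.
  have D2 l : 'D_v (fun y => crd l (coord a (f y))) x = w l by exact: Dw.
  rewrite !D2 mulrBl => <- <-.
  rewrite opprD addrACA subrr add0r -sumrB; apply: eq_bigr => j' _.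
  rewrite -sumrB; apply: eq_bigr => k' _.
  by rewrite !D2 /B !mulrBl.
rewrite /tracefree /sym_form /con -[N _ _ _ _ _ - _]/(B i j k) H.
by rewrite subrr.
Qed.

End ProjectiveTraceFree.

(** * Tensors in dimension two *)

Section PointwiseAlgebra.
Variable R : realType.
Implicit Types (g h P : 'M[R]_2).

Definition ten3 := 'I_2 -> 'I_2 -> 'I_2 -> R.
Implicit Types (F T A S : ten3).

Definition trace_free F : ten3 := fun i j k =>
  F i j k - 3^-1 * ((i == j)%:R * (\sum_(l < 2) F l k l) + (i == k)%:R * (\sum_(l < 2) F l j l)).

Definition contraction (gi g : 'M[R]_2) F : R :=
  \sum_(i < 2) \sum_(j < 2) \sum_(k < 2) \sum_(a < 2) \sum_(b < 2) \sum_(c < 2)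
    F i j k * gi j b * gi k c * g i a * F a b c.

Definition norm2 g F : R := contraction (invmx g) g F.

Definition raise g S : ten3 := fun i j k => \sum_(l < 2) invmx g i l * S l j k.

(** If [T] is the covariant derivative of [h], derivative index first, this is
    [t^-1] times the difference between the Levi-Civita connections of
    [g + t *: h] and [g], lowered with [g + t *: h]. *)
Definition christoffel_change T : ten3 := fun l j k => 2^-1 * (T j k l + T k j l - T l j k).

Definition pull3 P S : ten3 := fun i j k =>
  \sum_(p < 2) \sum_(q < 2) \sum_(r < 2) S p q r * P p i * P q j * P r k.

(** [F'] is the pullback of [F], with upper index first, under the linear map
    [P].  An equation between contractions avoids the inverse of [P]. *)
Definition pull12 P F F' := forall n j k,
  \sum_(i < 2) P n i * F' i j k = \sum_(l < 2) \sum_(q < 2) F n l q * P l j * P q k.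

Lemma invmx_sum (A : 'M[R]_2) (v : 'I_2 -> R) i : A \in unitmx ->
  \sum_(l < 2) invmx A i l * (\sum_(p < 2) A l p * v p) = v i.
Proof.
move=> uA; pose w : 'cV[R]_2 := \col_p v p.
have : (invmx A *m (A *m w)) i 0 = v i by rewrite mulKmx // mxE.
move=> <-; rewrite mxE; apply: eq_bigr => l _; rewrite mxE; congr (_ * _).
by apply: eq_bigr => p _; rewrite mxE.
Qed.

Lemma inv2 (A : 'M[R]_2) : \det A != 0 -> invmx A =
  \matrix_(i, j) ((\det A)^-1 * (if i == 0 then if j == 0 then A 1 1 else - A 0 1
                                else if j == 0 then - A 1 0 else A 0 0)).
Proof.
move=> d0; have uA : A \in unitmx by rewrite unitmxE unitfE.
set B := \matrix_(i, j) _.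
suff E : A *m B = 1%:M by rewrite -[LHS]mulmx1 -E mulKmx.
move: d0; rewrite /B det2 => d0; apply/matrixP; do 2![apply: ord2P]; rewrite !mxE sum2 !mxE /=; by field.
Qed.

Lemma invmxM (A B : 'M[R]_2) : A \in unitmx -> B \in unitmx ->
  invmx (A *m B) = invmx B *m invmx A.
Proof.
move=> uA uB; have uAB : A *m B \in unitmx by rewrite unitmx_mul uA.
apply: (can_inj (mulKmx uAB)); rewrite mulmxV // mulmxA.
by rewrite -[A *m B *m _]mulmxA mulmxV // mulmx1 mulmxV.
Qed.

(** The inverse of the pulled back metric is [P^-1 g^-1 P^-T], and [P^-T] cancels
    the factor of the first index of [pull3 P S]. *)
Lemma pull12_raise P g S : P \in unitmx -> g \in unitmx ->
  pull12 P (raise g S) (raise (P^T *m g *m P) (pull3 P S)).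
Proof.
move=> uP ug n j k.
pose s' : 'cV[R]_2 := \col_l pull3 P S l j k.
pose s : 'cV[R]_2 := \col_l \sum_(q < 2) \sum_(r < 2) S l q r * P q j * P r k.
have Es : s' = P^T *m s.
  apply/colP => l; rewrite !mxE; apply: eq_bigr => p _; rewrite !mxE mulr_sumr.
  apply: eq_bigr => q _; rewrite mulr_sumr; apply: eq_bigr => r _; ring.
transitivity ((P *m (invmx (P^T *m g *m P) *m s')) n 0).
  rewrite mxE; apply: eq_bigr => i _; rewrite mxE; congr (_ * _).
  by apply: eq_bigr => l _; rewrite [s' _ _]mxE.
have uPT : P^T \in unitmx by rewrite unitmx_tr.
have -> : P *m (invmx (P^T *m g *m P) *m s') = invmx g *m s.
  rewrite Es !invmxM ?unitmx_mul ?uPT ?ug //.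
  by rewrite -!mulmxA mulKVmx // mulKmx.
rewrite mxE exchange_big /=.
under eq_bigr do rewrite mxE mulr_sumr.
rewrite exchange_big [RHS]exchange_big; apply: eq_bigr => q _.
rewrite [RHS](_ : _ = \sum_(r < 2) \sum_(l < 2) invmx g n l * S l q r * P q j * P r k); last first.
  by apply: eq_bigr => r _; rewrite /raise !mulr_suml.
rewrite [RHS]exchange_big; apply: eq_bigr => l _; rewrite mulr_sumr.
by apply: eq_bigr => r _; ring.
Qed.

(** The factors [P] and [P^-1] of the contracted pair of indices cancel. *)
Lemma pull12_trace P F F' : P \in unitmx -> pull12 P F F' -> forall k,
  \sum_(l < 2) F' l k l = \sum_(q < 2) P q k * \sum_(l < 2) F l q l.
Proof.
move=> uP H k.
have E i j l := invmx_sum (fun i => F' i j l) i uP.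
have Q (n l : 'I_2) : \sum_(i < 2) P n i * invmx P i l = (n == l)%:R.
  by have := mulmxV uP => /matrixP /(_ n l); rewrite !mxE.
transitivity (\sum_(l < 2) \sum_(n < 2) invmx P l n * \sum_(p < 2) \sum_(q < 2) F n p q * P p k * P q l).
  by apply: eq_bigr => l _; rewrite -E; apply: eq_bigr => n _; rewrite H.
have Q00 := Q 0 0; have Q01 := Q 0 1; have Q10 := Q 1 0; have Q11 := Q 1 1.
rewrite !sum2 /= in Q00 Q01 Q10 Q11 *.
transitivity (
  (F 0 0 0 * P 0 k + F 0 1 0 * P 1 k) * (P 0 0 * invmx P 0 0 + P 0 1 * invmx P 1 0) +
  (F 0 0 1 * P 0 k + F 0 1 1 * P 1 k) * (P 1 0 * invmx P 0 0 + P 1 1 * invmx P 1 0) +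
  (F 1 0 0 * P 0 k + F 1 1 0 * P 1 k) * (P 0 0 * invmx P 0 1 + P 0 1 * invmx P 1 1) +
  (F 1 0 1 * P 0 k + F 1 1 1 * P 1 k) * (P 1 0 * invmx P 0 1 + P 1 1 * invmx P 1 1)).
  by ring.
by rewrite Q00 Q01 Q10 Q11; ring.
Qed.

Lemma pull12_trace_free P F F' : P \in unitmx -> pull12 P F F' ->
  pull12 P (trace_free F) (trace_free F').
Proof.
move=> uP H n j k; rewrite /trace_free.
pose cF q := \sum_(l < 2) F l q l.
have trF' l : \sum_(i < 2) F' i l i = \sum_(q < 2) P q l * cF q by exact: pull12_trace.
under eq_bigr do rewrite !trF'.
under eq_bigr do rewrite mulrBr.
rewrite sumrB H.
rewrite [RHS](_ : _ = \sum_(l < 2) \sum_(q < 2) (F n l q * P l j * P q k -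
    3^-1 * ((n == l)%:R * cF q + (n == q)%:R * cF l) * P l j * P q k)); last first.
  by apply: eq_bigr => l _; apply: eq_bigr => q _; rewrite !mulrBl.
under [RHS]eq_bigr do rewrite sumrB.
rewrite [RHS]sumrB; congr (_ - _).
rewrite (_ : cF = fun q => if q == 0 then cF 0 else cF 1); last first.
  by apply/funext; apply: ord2P.
move: (cF 0) (cF 1) => c0 c1; rewrite !sum2.
by move: n j k; do 3![apply: ord2P] => /=; ring.
Qed.

(** The lower indices are put into matrices, so that their pullback becomes
    multiplication by [P] and its transpose. *)
Lemma norm2_tr g F : norm2 g F =
  \sum_(i < 2) \sum_(a < 2) g i a *
    \tr ((\matrix_(j, k) F i j k) *m invmx g *m (\matrix_(j, k) F a j k)^T *m (invmx g)^T).
Proof.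
rewrite /norm2 /contraction !sum2 /mxtrace !sum2 !mxE !sum2 !mxE !sum2 !mxE !sum2 !mxE.
ring.
Qed.

Lemma congruence_sum P g (b : 'I_2 -> 'I_2 -> R) :
  \sum_(i < 2) \sum_(a < 2) (P^T *m g *m P) i a * b i a =
  \sum_(n < 2) \sum_(s < 2) g n s * \sum_(i < 2) \sum_(a < 2) P n i * P s a * b i a.
Proof. rewrite !sum2 !mxE !sum2 !mxE !sum2 !mxE; ring. Qed.

(** For the lower indices this is invariance of the trace under cyclic
    permutations; for the upper index it is [congruence_sum]. *)
Lemma norm2_pull P g F F' : P \in unitmx -> g \in unitmx -> pull12 P F F' ->
  norm2 (P^T *m g *m P) F' = norm2 g F.
Proof.
move=> uP ug H; rewrite !norm2_tr.
have uPT : P^T \in unitmx by rewrite unitmx_tr.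
set gi' := invmx (P^T *m g *m P).
have gE : invmx g = P *m gi' *m P^T.
  rewrite /gi' !invmxM ?unitmx_mul ?uPT ?ug // !mulmxA mulmxV // mul1mx.
  by rewrite -mulmxA mulVmx // mulmx1.
pose m F i : 'M[R]_2 := \matrix_(j, k) F i j k.
have Hm n : \sum_(i < 2) P n i *: m F' i = P^T *m m F n *m P.
  apply/matrixP => j k; rewrite summxE !mxE.
  under eq_bigr do rewrite !mxE.
  rewrite H exchange_big; apply: eq_bigr => q _; rewrite !mxE mulr_suml.
  by apply: eq_bigr => l _; rewrite !mxE; ring.
pose B X Y : R := \tr (X *m gi' *m Y^T *m gi'^T).
have BD X X' Y c : B (c *: X + X') Y = c * B X Y + B X' Y.
  by rewrite /B !mulmxDl -!scalemxAl linearD linearZ.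
have BD' X Y Y' c : B X (c *: Y + Y') = c * B X Y + B X Y'.
  have -> : B X (c *: Y + Y') = \tr (X *m gi' *m (c *: Y^T + Y'^T) *m gi'^T).
    by rewrite /B; congr (\tr (_ *m _ *m _)); rewrite linearP.
  by rewrite mulmxDr -scalemxAr mulmxDl -scalemxAl linearP.
have B0 X : B 0 X = 0 by rewrite /B !mul0mx linear0.
have B0' X : B X 0 = 0 by rewrite /B trmx0 mulmx0 mul0mx linear0.
have BE n s : B (P^T *m m F n *m P) (P^T *m m F s *m P) =
    \tr (m F n *m invmx g *m (m F s)^T *m (invmx g)^T).
  rewrite /B gE !trmx_mul !trmxK -!mulmxA mxtrace_mulC -!mulmxA //.
transitivity (\sum_(i < 2) \sum_(a < 2) (P^T *m g *m P) i a * B (m F' i) (m F' a)) => //.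
rewrite (congruence_sum P g (fun i a => B (m F' i) (m F' a))).
apply: eq_bigr => n _; apply: eq_bigr => s _; congr (_ * _).
have -> : \tr (m F n *m invmx g *m (m F s)^T *m (invmx g)^T) =
    B (P n 0 *: m F' 0 + (P n 1 *: m F' 1 + 0)) (P s 0 *: m F' 0 + (P s 1 *: m F' 1 + 0)).
  have Hm2 q : P q 0 *: m F' 0 + P q 1 *: m F' 1 = P^T *m m F q *m P by rewrite -Hm sum2.
  by rewrite !addr0 !Hm2 BE.
rewrite !BD !BD' !B0 !B0' !sum2.
move: (B (m F' 0) (m F' 0)) (B (m F' 0) (m F' 1)) (B (m F' 1) (m F' 0)) (B (m F' 1) (m F' 1)).
by clear => *; ring.
Qed.

End PointwiseAlgebra.

Section ConnectionAlgebra.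
Variable R : realType.
Implicit Types (g h P : 'M[R]_2) (F T A S : ten3 R).

Lemma invmx_sumK (A : 'M[R]_2) (v : 'I_2 -> R) i : A \in unitmx ->
  \sum_(l < 2) A i l * (\sum_(p < 2) invmx A l p * v p) = v i.
Proof. by move=> uA; rewrite -{1}(invmxK A) invmx_sum // unitmx_inv. Qed.

Definition christoffel g (dg : ten3 R) : ten3 R := fun i j k =>
  2^-1 * \sum_(l < 2) invmx g i l * (dg j k l + dg k j l - dg l j k).

(** The covariant derivative of a symmetric bilinear form, derivative index first. *)
Definition nabla (G : ten3 R) h (dh : ten3 R) : ten3 R := fun j k l =>
  dh j k l - (\sum_(p < 2) G p j k * h p l) - \sum_(p < 2) G p j l * h k p.

(** Lowering an index with the new metric makes the two Levi-Civita connections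
    differ by first derivatives of the perturbation, and those combine into
    covariant derivatives because the connection is symmetric. *)
Lemma christoffel_shift g h (dg dh : ten3 R) t :
  g \in unitmx -> g + t *: h \in unitmx -> h^T = h ->
  (forall i j k, dg i j k = dg i k j) ->
  forall i j k,
  christoffel (g + t *: h) (fun i j k => dg i j k + t * dh i j k) i j k =
  christoffel g dg i j k + t * raise (g + t *: h)
     (christoffel_change (nabla (christoffel g dg) h dh)) i j k.
Proof.
move=> ug ugt symh symdg i j k.
set G := christoffel g dg.
have hs p q : h p q = h q p by rewrite -{1}symh mxE.
have Gs p q r : G p q r = G p r q.
  rewrite /G /christoffel; congr (_ * _); apply: eq_bigr => l _; congr (_ * _).
  by rewrite (symdg l q r) [dg q r l + _]addrC.
have low l : \sum_(p < 2) g l p * G p j k = 2^-1 * (dg j k l + dg k j l - dg l j k).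
  rewrite -(invmx_sumK (fun l => dg j k l + dg k j l - dg l j k) l ug) mulr_sumr.
  by apply: eq_bigr => p _; rewrite /G /christoffel mulrCA.
rewrite -[G i j k](invmx_sum (fun i => G i j k) i ugt) /raise /christoffel.
rewrite !mulr_sumr -big_split /=; apply: eq_bigr => l _.
have -> : \sum_(p < 2) (g + t *: h) l p * G p j k =
    2^-1 * (dg j k l + dg k j l - dg l j k) + t * \sum_(p < 2) h l p * G p j k.
  rewrite -low mulr_sumr -big_split /=; apply: eq_bigr => p _.
  by rewrite !mxE; ring.
rewrite /christoffel_change /nabla !sum2 !(Gs _ l) !(Gs _ k j) !(hs l) !(hs _ k).
by field.
Qed.

(** The second derivatives [dP] of the coordinate change occur in the derivative
    of the pulled back form and in the inhomogeneous part of the connection;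
    they cancel. *)
Lemma nabla_pull P (dP : ten3 R) hb (dhb : ten3 R) (Ga Gb : ten3 R) :
  (forall n j k, \sum_(i < 2) P n i * Ga i j k =
     dP j n k + \sum_(l < 2) \sum_(q < 2) Gb n l q * P l j * P q k) ->
  forall j k l,
  nabla Ga (P^T *m hb *m P) (fun j k l => \sum_(q < 2) \sum_(r < 2)
     (dP j q k * hb q r * P r l + P q k * (\sum_(p < 2) P p j * dhb p q r) * P r l
      + P q k * hb q r * dP j r l)) j k l =
  pull3 P (nabla Gb hb dhb) j k l.
Proof.
move=> H j k l.
have D n j' k' : dP j' n k' = P n 0 * Ga 0 j' k' + P n 1 * Ga 1 j' k' -
    \sum_(l < 2) \sum_(q < 2) Gb n l q * P l j' * P q k'.
  have := H n j' k'; rewrite sum2 => ->.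
  by rewrite addrK.
rewrite /nabla /pull3 !sum2 !D !mxE !sum2 !mxE !sum2 !mxE.
ring.
Qed.

End ConnectionAlgebra.

Section BlaschkeTensors.
Variables (R : realType) (M : closed_oriented_surface R).
Implicit Types (a b : chart M) (m : M) (g h : cov2 M) (C : comp3C M).

Lemma jacE b a m k i : jac b a m k i = pd a i (fun z => crd k (coord b z)) m.
Proof. by rewrite mxE. Qed.

Lemma det_jac a b m : dom a m -> dom b m -> 0 < \det (jac b a m).
Proof.
move=> am bm; have := transition_oriented am bm.
by congr (0 < \det _); apply/matrixP => k i; rewrite !mxE.
Qed.

Lemma jac_unit a b m : dom a m -> dom b m -> jac b a m \in unitmx.
Proof. by move=> am bm; rewrite unitmxE unitfE gt_eqF // det_jac. Qed.

Lemma sym2_C1 h a m i j : sym2_field h -> dom a m -> C1at a m (fun z => h a z i j).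
Proof.
move=> [sh _ _] am; apply: (smooth_C1at (dom_open a) am am).
exact: sh.
Qed.

Lemma sym2_sym h a m : sym2_field h -> dom a m -> (h a m)^T = h a m.
Proof. by case=> _ + _; exact. Qed.

Definition dh_ (h : cov2 M) a m : ten3 R := fun j k l => pd a j (fun z => h a z k l) m.

Lemma levi_civitaE g a m : levi_civita g a m = christoffel (g a m) (dh_ g a m).
Proof. by []. Qed.

Lemma dh_sym h a m i j k : sym2_field h -> dom a m -> dh_ h a m i j k = dh_ h a m i k j.
Proof.
move=> sh am; apply: pd_near => //; apply: filterS (near_dom am) => z az.
by rewrite -[in LHS](sym2_sym sh az) mxE.
Qed.

Lemma riem_positive g a m : riemannian g -> dom a m ->
  [/\ g a m 1 0 = g a m 0 1, 0 < g a m 0 0 & 0 < \det (g a m)].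
Proof.
move=> [sg pos] am; have gs : g a m 1 0 = g a m 0 1 by rewrite -[in LHS](sym2_sym sg am) mxE.
have innerE (x y : R) : inner (g a m) (\col_i (if i == 0 then x else y)) (\col_i (if i == 0 then x else y))
   = g a m 0 0 * x * x + 2 * g a m 0 1 * x * y + g a m 1 1 * y * y.
  rewrite /inner !mxE !sum2 !mxE !sum2 !mxE /= gs; ring.
have nz (x y : R) : (x != 0) || (y != 0) -> (\col_(i < 2) (if i == 0 then x else y)) != 0.
  apply: contraTneq => /colP E; have := E 0; have := E 1; rewrite !mxE /= => -> ->.
  by rewrite eqxx.
have g00 : 0 < g a m 0 0.
  have := pos a m am _ (nz 1 0 _); rewrite innerE oner_eq0 => /(_ isT).
  by rewrite !mulr1 !mulr0 !addr0.
(* the squared length of this vector is [g 0 0] times the determinant *)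
split => //; have := pos a m am _ (nz (- g a m 0 1) (g a m 0 0) _).
rewrite innerE (gt_eqF g00) orbT => /(_ isT) => H.
rewrite det2 gs -(pmulr_rgt0 _ g00).
by move: H; congr (0 < _); ring.
Qed.

Lemma riem_det g a m : riemannian g -> dom a m -> 0 < \det (g a m).
Proof. by move=> rg am; have [] := riem_positive rg am. Qed.

Lemma det_unit (A : 'M[R]_2) : \det A != 0 -> A \in unitmx.
Proof. by rewrite unitmxE unitfE. Qed.

Lemma riem_unit g a m : riemannian g -> dom a m -> g a m \in unitmx.
Proof. by move=> rg am; rewrite det_unit // gt_eqF // riem_det. Qed.

Definition nab g h a m : ten3 R := nabla (levi_civita g a m) (h a m) (dh_ h a m).

Lemma levi_civita_shift g h t a m : riemannian g -> sym2_field h -> dom a m ->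
  g a m + t *: h a m \in unitmx -> forall i j k,
  levi_civita (metric_shift g h t) a m i j k =
  levi_civita g a m i j k
   + t * raise (g a m + t *: h a m) (christoffel_change (nab g h a m)) i j k.
Proof.
move=> rg sh am ut i j k; have [sg _] := rg.
rewrite -christoffel_shift //; last 3 first.
- exact: riem_unit.
- exact: sym2_sym.
- by move=> *; exact: dh_sym.
have E p q r : dh_ (metric_shift g h t) a m p q r = dh_ g a m p q r + t * dh_ h a m p q r.
  have dg := C1at_diff (sym2_C1 q r sg am); have dh := C1at_diff (sym2_C1 q r sh am).
  have dt : diff_in a (fun=> t) m by exact: diff_in_cst.
  have := pdD p dg (diff_inM dt dh); rewrite (pdM p am dt dh) pd_cst mul0r add0r => <-.
  by rewrite /dh_; congr pd; apply/funext => z; rewrite /metric_shift !mxE.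
rewrite levi_civitaE /christoffel; congr (_ * _); apply: eq_bigr => l _.
by rewrite !E.
Qed.

Definition connection_law (N : comp12 M) := forall a b m, dom a m -> dom b m ->
  forall n j k, \sum_(i < 2) jac b a m n i * N a m i j k
    = pd a j (fun z => jac b a z n k) m
      + \sum_(l < 2) \sum_(q < 2) N b m n l q * jac b a m l j * jac b a m q k.

Lemma nab_law g h a b m : connection_law (levi_civita g) -> sym2_field h ->
  dom a m -> dom b m -> forall j k l,
  nab g h a m j k l = pull3 (jac b a m) (nab g h b m) j k l.
Proof.
move=> LC sh am bm j k l; have [_ _ lawh] := sh.
rewrite /nab -(nabla_pull (dP := fun j n k => pd a j (fun z => jac b a z n k) m) _ _ (LC a b m am bm)).
rewrite /nabla (lawh a b) //; congr (_ - _ - _).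
have Cb q r := sym2_C1 q r sh bm.
have dJ q r : diff_in a (fun z => jac b a z q r) m by exact/C1at_diff/C1at_jac.
have dH q r : diff_in a (fun z => h b z q r) m by exact: (chain_chart am bm (C1at_diff (Cb q r))).1.
have pH p q r : pd a p (fun z => h b z q r) m = \sum_(s < 2) jac b a m s p * dh_ h b m s q r.
  exact: (chain_chart am bm (C1at_diff (Cb q r))).2.
transitivity (pd a j (fun z => \sum_(q < 2) \sum_(r < 2) jac b a z q k * h b z q r * jac b a z r l) m).
  apply: pd_near => //; apply: filterS2 (near_dom am) (near_dom bm) => z az bz.
  rewrite (lawh a b) // mxE exchange_big; apply: eq_bigr => r _; rewrite mxE mulr_suml.
  by apply: eq_bigr => q _; rewrite !mxE.
have d1 q r : diff_in a (fun z => jac b a z q k * h b z q r * jac b a z r l) m.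
  by apply: diff_inM => //; exact: diff_inM.
rewrite pd_sum; last by move=> q; exact: diff_in_sum.
apply: eq_bigr => q _; rewrite pd_sum //; apply: eq_bigr => r _.
rewrite (pdM j am (diff_inM (dJ q k) (dH q r)) (dJ r l)) (pdM j am (dJ q k) (dH q r)) pH.
by rewrite mulrDl.
Qed.

End BlaschkeTensors.

(** * Holomorphic cubic differentials *)

Section ComplexCalculus.
Variables (R : realType) (M : closed_oriented_surface R).
Implicit Types (a b : chart M) (m : M) (f h : M -> R[i]) (r : M -> R).

Local Notation Re := complex.Re.
Local Notation Im := complex.Im.
Definition toC (x : R) : R[i] := Complex x 0.

Lemma ReM (x y : R[i]) : Re (x * y) = Re x * Re y - Im x * Im y.
Proof. by case: x y => [x1 x2] [y1 y2]. Qed.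
Lemma ImM (x y : R[i]) : Im (x * y) = Re x * Im y + Im x * Re y.
Proof. by case: x y => [x1 x2] [y1 y2]. Qed.
Lemma ReD (x y : R[i]) : Re (x + y) = Re x + Re y.
Proof. by case: x y => [x1 x2] [y1 y2]. Qed.
Lemma ImD (x y : R[i]) : Im (x + y) = Im x + Im y.
Proof. by case: x y => [x1 x2] [y1 y2]. Qed.
Lemma ReN (x : R[i]) : Re (- x) = - Re x. Proof. by case: x. Qed.
Lemma ImN (x : R[i]) : Im (- x) = - Im x. Proof. by case: x. Qed.
Lemma complex_ext (x y : R[i]) : Re x = Re y -> Im x = Im y -> x = y.
Proof. by case: x y => [x1 x2] [y1 y2] /= -> ->. Qed.
Lemma toCM (x y : R) : toC (x * y) = toC x * toC y.
Proof. by apply: complex_ext; rewrite ?ReM ?ImM /= ?mulr0 ?mul0r ?subr0 ?addr0. Qed.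
Lemma toCD (x y : R) : toC (x + y) = toC x + toC y.
Proof. by apply: complex_ext; rewrite ?ReD ?ImD /= ?addr0. Qed.
Lemma toCN (x : R) : toC (- x) = - toC x.
Proof. by apply: complex_ext; rewrite ?ReN ?ImN /= ?oppr0. Qed.

Lemma Re_comb2 (s t : R) (x y : R[i]) : Re (toC s * x + toC t * y) = s * Re x + t * Re y.
Proof. by rewrite ReD !ReM /= !mul0r !subr0. Qed.
Lemma Im_comb2 (s t : R) (x y : R[i]) : Im (toC s * x + toC t * y) = s * Im x + t * Im y.
Proof. by rewrite ImD !ImM /= !mul0r !addr0. Qed.

Lemma Re_toCM (s : R) (x : R[i]) : Re (toC s * x) = s * Re x.
Proof. by rewrite ReM /= mul0r subr0. Qed.
Lemma Im_toCM (s : R) (x : R[i]) : Im (toC s * x) = s * Im x.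
Proof. by rewrite ImM /= mul0r addr0. Qed.

Lemma pd_ext a m i (r1 r2 : M -> R) : (forall z, r1 z = r2 z) -> pd a i r1 m = pd a i r2 m.
Proof. by move=> E; congr (pd a i _ m); exact/funext. Qed.

Definition C1atC a m f := C1at a m (fun z => Re (f z)) /\ C1at a m (fun z => Im (f z)).

Lemma C1atC_D a m f h : C1atC a m f -> C1atC a m h -> C1atC a m (fun z => f z + h z).
Proof.
move=> [f1 f2] [h1 h2]; split.
  rewrite (_ : (fun z => _) = fun z => Re (f z) + Re (h z)); first exact: C1atD.
  by apply/funext => z; rewrite ReD.
rewrite (_ : (fun z => _) = fun z => Im (f z) + Im (h z)); first exact: C1atD.
by apply/funext => z; rewrite ImD.
Qed.

Lemma C1atC_M a m f h : dom a m -> C1atC a m f -> C1atC a m h -> C1atC a m (fun z => f z * h z).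
Proof.
move=> am [f1 f2] [h1 h2]; split.
  rewrite (_ : (fun z => _) = fun z => Re (f z) * Re (h z) + - (Im (f z) * Im (h z))).
    by apply: C1atD; [exact: C1atM|apply: C1atN; exact: C1atM].
  by apply/funext => z; rewrite ReM.
rewrite (_ : (fun z => _) = fun z => Re (f z) * Im (h z) + Im (f z) * Re (h z)).
  by apply: C1atD; exact: C1atM.
by apply/funext => z; rewrite ImM.
Qed.

Lemma C1atC_real a m r : C1at a m r -> C1atC a m (fun z => toC (r z)).
Proof. by move=> Cr; split; [exact: Cr|exact: C1at_cst]. Qed.

Lemma C1atC_sum a m (I : Type) (s : seq I) (F : I -> M -> R[i]) :
  (forall i, C1atC a m (F i)) -> C1atC a m (fun z => \sum_(i <- s) F i z).
Proof.
move=> CF; elim: s => [|i s IH].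
  rewrite (_ : (fun z => _) = fun z => toC 0); first by apply: C1atC_real; exact: C1at_cst.
  by apply/funext => z; rewrite big_nil.
rewrite (_ : (fun z => _) = fun z => F i z + \sum_(j <- s) F j z); first exact: C1atC_D.
by apply/funext => z; rewrite big_cons.
Qed.

Lemma pdCD a m i f h : C1atC a m f -> C1atC a m h ->
  pdC a i (fun z => f z + h z) m = pdC a i f m + pdC a i h m.
Proof.
move=> [/C1at_diff f1 /C1at_diff f2] [/C1at_diff h1 /C1at_diff h2].
apply: complex_ext; rewrite (ReD, ImD) -[RHS]pdD //; apply: pd_ext => z.
  exact: ReD.
exact: ImD.
Qed.

Lemma pdC_near a m i f h : dom a m ->
  (\forall z \near m, f z = h z) -> pdC a i f m = pdC a i h m.
Proof. by move=> am E; congr Complex; apply: pd_near => //; apply: filterS E => z ->. Qed.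

Lemma pdC_cst a m i (c : R[i]) : pdC a i (fun=> c) m = 0.
Proof. by apply: complex_ext => /=; rewrite pd_cst. Qed.

Lemma pdCM a m i f h : dom a m -> C1atC a m f -> C1atC a m h ->
  pdC a i (fun z => f z * h z) m = pdC a i f m * h m + f m * pdC a i h m.
Proof.
move=> am [/C1at_diff f1 /C1at_diff f2] [/C1at_diff h1 /C1at_diff h2].
have d1 := diff_inM f1 h1; have d2 := diff_inM f2 h2.
have d3 := diff_inM f1 h2; have d4 := diff_inM f2 h1.
apply: complex_ext; rewrite ?ReD ?ImD ?ReM ?ImM /=.
  transitivity (pd a i (fun z => Re (f z) * Re (h z) - Im (f z) * Im (h z)) m).
    by apply: pd_ext => z; exact: ReM.
  by rewrite pdB // !pdM //; ring.
transitivity (pd a i (fun z => Re (f z) * Im (h z) + Im (f z) * Re (h z)) m).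
  by apply: pd_ext => z; exact: ImM.
by rewrite pdD // !pdM //; ring.
Qed.

Lemma pdC_real a m i r : pdC a i (fun z => toC (r z)) m = toC (pd a i r m).
Proof. by apply: complex_ext => //=; rewrite pd_cst. Qed.

Lemma pdC_sum2 a m k (F : 'I_2 -> M -> R[i]) :
  (forall i, C1atC a m (F i)) ->
  pdC a k (fun z => \sum_(i < 2) F i z) m = \sum_(i < 2) pdC a k (F i) m.
Proof.
move=> CF; rewrite sum2 -pdCD //.
by apply: complex_ext; apply: pd_ext => z; rewrite sum2.
Qed.

Lemma chain_chartC a b m f : dom a m -> dom b m -> C1atC b m f ->
  forall i, pdC a i f m = \sum_(k < 2) toC (jac b a m k i) * pdC b k f m.
Proof.
move=> am bm [/C1at_diff f1 /C1at_diff f2] i; rewrite sum2.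
apply: complex_ext.
  by rewrite Re_comb2; have := (chain_chart am bm f1).2 i; rewrite sum2.
by rewrite Im_comb2; have := (chain_chart am bm f2).2 i; rewrite sum2.
Qed.

Lemma smooth_C1atC a W f m : open W -> W m -> dom a m ->
  smooth_fun W (fun z => Re (f z)) -> smooth_fun W (fun z => Im (f z)) -> C1atC a m f.
Proof.
move=> oW Wm am s1 s2; split; first exact: smooth_C1at oW Wm am (s1 a).
exact: smooth_C1at oW Wm am (s2 a).
Qed.

Lemma smooth_C1atC_pd a W f m i : open W -> W m -> dom a m ->
  smooth_fun W (fun z => Re (f z)) -> smooth_fun W (fun z => Im (f z)) ->
  C1atC a m (pdC a i f).
Proof.
move=> oW Wm am s1 s2; split.
  exact: (smooth_C1at oW Wm am (smooth_in_pd i oW (s1 a))).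
exact: (smooth_C1at oW Wm am (smooth_in_pd i oW (s2 a))).
Qed.

Lemma pdC_schwarz a W f m : open W -> W m -> dom a m ->
  smooth_fun W (fun z => Re (f z)) -> smooth_fun W (fun z => Im (f z)) ->
  pdC a 1 (pdC a 0 f) m = pdC a 0 (pdC a 1 f) m.
Proof.
move=> oW Wm am s1 s2; apply: complex_ext.
  exact: (@pd_schwarz _ _ a W (fun z => Re (f z)) m oW Wm am (s1 a)).
exact: (@pd_schwarz _ _ a W (fun z => Im (f z)) m oW Wm am (s2 a)).
Qed.

End ComplexCalculus.

Section FluxAlgebra.
Variable R : realType.
Local Notation Re := complex.Re.
Local Notation Im := complex.Im.
Local Notation "'ii'" := (Complex 0 1 : R[i]).
Implicit Types (g h : 'M[R]_2) (T S : ten3 R).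

Definition raise3 g S : ten3 R := fun j k l =>
  \sum_(p < 2) \sum_(q < 2) \sum_(r < 2)
    invmx g j p * invmx g k q * invmx g l r * S p q r.

(** The Cauchy-Riemann equations [u J = i u] of a covector, solved for [u] in
    terms of its gradient [Z]: rotation by a right angle exchanges the two up to
    the area density. *)
Lemma rot_raise g (u : 'I_2 -> R[i]) : 0 < \det g -> g 1 0 = g 0 1 ->
  (forall j, \sum_(i < 2) toC (rot g i j) * u i = ii * u j) ->
  let Z k := \sum_(p < 2) toC (invmx g k p) * u p in
  u 1 = ii * toC (Num.sqrt (\det g)) * Z 0 /\
  u 0 = - (ii * toC (Num.sqrt (\det g)) * Z 1).
Proof.
move=> d0 gs H Z; set s := Num.sqrt _.
have s0 : s != 0 by rewrite gt_eqF // sqrtr_gt0.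
have ss : s * s = \det g by rewrite -expr2 sqr_sqrtr // ltW.
have rotE (x : R) : toC (s * (s^-1 * x)) = toC x by rewrite mulVKf.
have H0 : - toC (g 0 1) * u 0 + toC (g 0 0) * u 1 = toC s * (ii * u 0).
  have := H 0; rewrite sum2 !mxE /= -/s => <-.
  by rewrite mulrDr !mulrA -!toCM !rotE toCN.
have H1 : - toC (g 1 1) * u 0 + toC (g 0 1) * u 1 = toC s * (ii * u 1).
  have := H 1; rewrite sum2 !mxE /= -/s => <-.
  by rewrite mulrDr !mulrA -!toCM !rotE toCN.
have i2 : ii * ii = - 1 by apply: complex_ext => /=; ring.
have dn : \det g != 0 by rewrite gt_eqF.
have sdet : toC s * toC s * toC ((\det g)^-1) = 1.
  by rewrite -!toCM ss mulfV.
rewrite /Z !sum2 inv2 // !mxE /= gs !toCM !toCN; split.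
  transitivity (- ii * (toC s * toC ((\det g)^-1)) * (- toC (g 1 1) * u 0 + toC (g 0 1) * u 1)); last by ring.
  rewrite H1; transitivity (- (ii * ii) * (toC s * toC s * toC ((\det g)^-1)) * u 1); last by ring.
  by rewrite i2 sdet; ring.
transitivity (- ii * (toC s * toC ((\det g)^-1)) * (- toC (g 0 1) * u 0 + toC (g 0 0) * u 1)); last by ring.
rewrite H0; transitivity (- (ii * ii) * (toC s * toC s * toC ((\det g)^-1)) * u 0); last by ring.
by rewrite i2 sdet; ring.
Qed.

(** The gradient [Z] of a holomorphic coordinate is isotropic, and this makes it
    a geodesic field: the sum of [Z j] times the covariant derivative of [Z]
    in direction [j] vanishes. *)
Lemma isotropic_geodesic g (dg G : ten3 R) (u Z : 'I_2 -> R[i]) (du dZ : 'I_2 -> 'I_2 -> R[i]) :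
  g \in unitmx -> g 1 0 = g 0 1 ->
  (forall i j k, dg i j k = dg i k j) ->
  (forall l j k, \sum_(p < 2) g l p * G p j k = 2^-1 * (dg j k l + dg k j l - dg l j k)) ->
  (forall j k, du j k = du k j) ->
  (forall k, u k = \sum_(p < 2) toC (g k p) * Z p) ->
  (forall j k, du j k = \sum_(p < 2) (toC (dg j k p) * Z p + toC (g k p) * dZ j p)) ->
  (forall k, \sum_(p < 2) (du k p * Z p + u p * dZ k p) = 0) ->
  forall p, \sum_(j < 2) Z j * dZ j p =
    - \sum_(j < 2) \sum_(l < 2) toC (G p j l) * Z j * Z l.
Proof.
move=> ug gs dgs low dus uE duE iso.
pose V p := \sum_(j < 2) Z j * dZ j p + \sum_(j < 2) \sum_(l < 2) toC (G p j l) * Z j * Z l.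
have gV k : \sum_(p < 2) toC (g k p) * V p = 0.
  have lowC j l : toC (g k 0) * toC (G 0 j l) + toC (g k 1) * toC (G 1 j l) =
      toC (2^-1) * (toC (dg j l k) + toC (dg l j k) - toC (dg k j l)).
    have := low k j l; rewrite sum2 => E.
    transitivity (toC (g k 0 * G 0 j l + g k 1 * G 1 j l)).
      by rewrite toCD !toCM.
    by rewrite E toCM !toCD toCN.
  have h2 : toC (2^-1 : R) + toC (2^-1 : R) = 1 by rewrite -toCD; congr Complex; field.
  have J := iso k; have A0 := duE k 0; have A1 := duE k 1.
  have B0 := duE 0 k; have B1 := duE 1 k.
  have U0 := uE 0; have U1 := uE 1.
  rewrite !sum2 in J A0 A1 B0 B1 U0 U1.
  rewrite -(dus k 0) in B0; rewrite -(dus k 1) in B1.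
  have E : toC (2^-1) * (du k 0 * Z 0 + u 0 * dZ k 0 + (du k 1 * Z 1 + u 1 * dZ k 1)) = 0.
    by rewrite J mulr0.
  have E2 : du k 0 * Z 0 + du k 1 * Z 1 =
     toC (2^-1) * (toC (dg k 0 0) * Z 0 * Z 0 + toC (dg k 0 1) * Z 0 * Z 1 +
                 toC (dg k 1 0) * Z 0 * Z 1 + toC (dg k 1 1) * Z 1 * Z 1).
    have A : u 0 * dZ k 0 + u 1 * dZ k 1 = (du k 0 * Z 0 + du k 1 * Z 1)
       - (toC (dg k 0 0) * Z 0 * Z 0 + toC (dg k 0 1) * Z 0 * Z 1 +
          toC (dg k 1 0) * Z 0 * Z 1 + toC (dg k 1 1) * Z 1 * Z 1).
      by rewrite A0 A1 U0 U1 gs; ring.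
    have -> : du k 0 * Z 0 + du k 1 * Z 1 = (toC (2^-1) + toC (2^-1)) * (du k 0 * Z 0 + du k 1 * Z 1).
      by rewrite h2 mul1r.
    apply/eqP; rewrite -subr_eq0; apply/eqP; rewrite -[RHS]E.
    have -> : du k 0 * Z 0 + u 0 * dZ k 0 + (du k 1 * Z 1 + u 1 * dZ k 1) =
      du k 0 * Z 0 + du k 1 * Z 1 + (u 0 * dZ k 0 + u 1 * dZ k 1) by ring.
    by rewrite A; ring.
  have lhs : \sum_(p < 2) toC (g k p) * V p =
     Z 0 * (toC (g k 0) * dZ 0 0 + toC (g k 1) * dZ 0 1) +
     Z 1 * (toC (g k 0) * dZ 1 0 + toC (g k 1) * dZ 1 1) +
     (toC (g k 0) * toC (G 0 0 0) + toC (g k 1) * toC (G 1 0 0)) * Z 0 * Z 0 +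
     (toC (g k 0) * toC (G 0 0 1) + toC (g k 1) * toC (G 1 0 1)) * Z 0 * Z 1 +
     (toC (g k 0) * toC (G 0 1 0) + toC (g k 1) * toC (G 1 1 0)) * Z 0 * Z 1 +
     (toC (g k 0) * toC (G 0 1 1) + toC (g k 1) * toC (G 1 1 1)) * Z 1 * Z 1.
    by rewrite /V !sum2; ring.
  have d0 : toC (g k 0) * dZ 0 0 + toC (g k 1) * dZ 0 1 =
      du k 0 - (toC (dg 0 k 0) * Z 0 + toC (dg 0 k 1) * Z 1) by rewrite B0; ring.
  have d1 : toC (g k 0) * dZ 1 0 + toC (g k 1) * dZ 1 1 =
      du k 1 - (toC (dg 1 k 0) * Z 0 + toC (dg 1 k 1) * Z 1) by rewrite B1; ring.
  rewrite lhs d0 d1 !lowC.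
  rewrite (dgs 0 0 k) (dgs 0 1 k) (dgs 1 0 k) (dgs 1 1 k) (dgs k 1 0).
  rewrite (dgs k 1 0) in E2.
  transitivity ((du k 0 * Z 0 + du k 1 * Z 1)
    - (1 - (toC (2^-1) + toC (2^-1))) * (toC (dg 0 k 0) * Z 0 * Z 0 + toC (dg 1 k 1) * Z 1 * Z 1)
    - (1 - (toC (2^-1) + toC (2^-1))) * (toC (dg 0 k 1) * Z 0 * Z 1 + toC (dg 1 k 0) * Z 0 * Z 1)
    - toC (2^-1) * (toC (dg k 0 0) * Z 0 * Z 0 + toC (dg k 0 1) * Z 0 * Z 1 +
                 toC (dg k 0 1) * Z 0 * Z 1 + toC (dg k 1 1) * Z 1 * Z 1)).
    by ring.
  by rewrite E2 h2; ring.
have d0 : toC (\det g) != 0.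
  apply/eqP => E; move: ug; rewrite unitmxE unitfE.
  have -> : \det g = 0 by exact: (congr1 (@complex.Re R) E).
  by rewrite eqxx.
have V0 p : V p = 0.
  apply: (mulfI d0); rewrite mulr0; have := gV 0; have := gV 1; rewrite !sum2 => E1 E0.
  rewrite det2 toCD toCN !toCM; move: p; apply: ord2P.
    transitivity (toC (g 1 1) * (toC (g 0 0) * V 0 + toC (g 0 1) * V 1) -
      toC (g 0 1) * (toC (g 1 0) * V 0 + toC (g 1 1) * V 1)); first by ring.
    by rewrite E0 E1; ring.
  transitivity (toC (g 0 0) * (toC (g 1 0) * V 0 + toC (g 1 1) * V 1) -
      toC (g 1 0) * (toC (g 0 0) * V 0 + toC (g 0 1) * V 1)); first by ring.
  by rewrite E0 E1; ring.
by move=> p; apply/eqP; rewrite -addr_eq0; apply/eqP; exact: V0.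
Qed.

(** The exterior derivative of [c h(Z, Z) u] at a point, with the derivatives at
    this point as independent quantities.  The derivative of [c] drops out
    because it is proportional to [u], and that of [u] because it is symmetric.
    By [rot_raise] the derivative of [h(Z, Z)] is taken along [Z] only, and there
    the geodesic equation replaces derivatives of [Z] by Christoffel symbols. *)
Lemma flux_algebra (s : R) (c : R[i]) h (dh G : ten3 R) (u Z dc : 'I_2 -> R[i]) (du dZ : 'I_2 -> 'I_2 -> R[i]) :
  h 1 0 = h 0 1 -> (forall i j k, G i j k = G i k j) ->
  u 1 = ii * toC s * Z 0 -> u 0 = - (ii * toC s * Z 1) ->
  dc 0 * u 1 = dc 1 * u 0 -> (forall j k, du j k = du k j) ->
  (forall p, \sum_(j < 2) Z j * dZ j p =
    - \sum_(j < 2) \sum_(l < 2) toC (G p j l) * Z j * Z l) ->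
  let H := \sum_(p < 2) \sum_(q < 2) toC (h p q) * Z p * Z q in
  let dH j := \sum_(p < 2) \sum_(q < 2) (toC (dh j p q) * Z p * Z q +
     toC (h p q) * dZ j p * Z q + toC (h p q) * Z p * dZ j q) in
  ((dc 0 * H + c * dH 0) * u 1 + c * H * du 0 1) -
  ((dc 1 * H + c * dH 1) * u 0 + c * H * du 1 0) =
  ii * toC s * c * \sum_(j < 2) \sum_(k < 2) \sum_(l < 2)
     toC (nabla G h dh j k l) * Z j * Z k * Z l.
Proof.
move=> hs Gs u1 u0 cr dus geo H dH.
have E : (dc 0 * H + c * dH 0) * u 1 + c * H * du 0 1 - ((dc 1 * H + c * dH 1) * u 0 + c * H * du 1 0)
  = (dc 0 * u 1 - dc 1 * u 0) * H + c * (dH 0 * u 1 - dH 1 * u 0) by rewrite (dus 1 0); ring.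
rewrite E cr subrr mul0r add0r u1 u0.
have -> : c * (dH 0 * (ii * toC s * Z 0) - dH 1 * - (ii * toC s * Z 1)) =
  ii * toC s * c * (Z 0 * dH 0 + Z 1 * dH 1) by ring.
congr (_ * _).
have geo0 := geo 0; have geo1 := geo 1; rewrite !sum2 in geo0 geo1.
transitivity (\sum_(j < 2) \sum_(k < 2) \sum_(l < 2) toC (dh j k l) * Z j * Z k * Z l
  + 2 * ((toC (h 0 0) * Z 0 + toC (h 0 1) * Z 1) * (Z 0 * dZ 0 0 + Z 1 * dZ 1 0) +
         (toC (h 0 1) * Z 0 + toC (h 1 1) * Z 1) * (Z 0 * dZ 0 1 + Z 1 * dZ 1 1))).
  by rewrite /dH !sum2 hs; ring.
rewrite geo0 geo1 /nabla !sum2 !toCD !toCN !toCD !toCM hs !(Gs _ 1 0); ring.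
Qed.

End FluxAlgebra.

Lemma ord2_sym (T : Type) (f : 'I_2 -> 'I_2 -> T) : f 0 1 = f 1 0 ->
  forall j k, f j k = f k j.
Proof. by move=> E; do 2![apply: ord2P]. Qed.

Lemma Re_contraction (R : realType) (c : R[i]) (t : ten3 R) (Z : 'I_2 -> R[i]) :
  complex.Re (c * \sum_(j < 2) \sum_(k < 2) \sum_(l < 2) toC (t j k l) * Z j * Z k * Z l) =
  \sum_(j < 2) \sum_(k < 2) \sum_(l < 2) t j k l * complex.Re (c * (Z j * Z k * Z l)).
Proof.
have RT (x : R) (y z w : R[i]) : complex.Re (c * (toC x * y * z * w)) = x * complex.Re (c * (y * z * w)).
  by rewrite -!mulrA mulrCA Re_toCM.
by rewrite !sum2 !mulrDr !ReD !RT.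
Qed.

(** Two solutions [u], [v] of the Cauchy-Riemann equations at a point are
    proportional: the wedge product of two forms of type (1,0) vanishes. *)
Lemma parallel_gradients (R : realType) (k A B B' D u0 u1 v0 v1 : R[i]) :
  v1 = k * (A * v0 + B * v1) -> v0 = - (k * (B' * v0 + D * v1)) ->
  u1 = k * (A * u0 + B * u1) -> u0 = - (k * (B' * u0 + D * u1)) -> B = B' ->
  v0 * u1 = v1 * u0.
Proof.
move=> V1 V0 U1 U0 BB.
have E1 : v0 * u1 - v1 * u0 = k * B * (v0 * u1 - v1 * u0).
  by rewrite {1}U1 {1}V1; ring.
have E2 : v0 * u1 - v1 * u0 = - (k * B * (v0 * u1 - v1 * u0)).
  by rewrite {1}U0 {1}V0 BB; ring.
have E3 : (v0 * u1 - v1 * u0) *+ 2 = 0 by rewrite mulr2n {1}E1 {2}E2 subrr.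
by apply/eqP; rewrite -subr_eq0; move/eqP: E3; rewrite mulrn_eq0.
Qed.

Section CubicDifferentials.
Variables (R : realType) (M : closed_oriented_surface R).
Variables (g : cov2 M) (C : comp3C M).
Hypotheses (riem : riemannian g) (hol : holomorphic_cubic_differential g C).
Implicit Types (a b : chart M) (m : M) (h : cov2 M).
Local Notation Re := complex.Re.
Local Notation Im := complex.Im.
Local Notation "'ii'" := (Complex 0 1 : R[i]).

Definition re_cubic (D : comp3C M) a m : ten3 R := fun i j k => Re (D a m i j k).
Definition im_cubic (D : comp3C M) a m : ten3 R := fun i j k => Im (D a m i j k).

Lemma metric_sym10 a m : dom a m -> g a m 1 0 = g a m 0 1.
Proof. by move=> am; rewrite -[in LHS](sym2_sym riem.1 am) mxE. Qed.

Lemma C1at_inv a m i j : dom a m -> C1at a m (fun z => invmx (g a z) i j).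
Proof.
move=> am.
have Cg k l : C1at a m (fun z => g a z k l) by exact: sym2_C1 riem.1 am.
have Cd : C1at a m (fun z => g a z 0 0 * g a z 1 1 + - (g a z 0 1 * g a z 1 0)).
  by apply: C1atD; [exact: C1atM|apply: C1atN; exact: C1atM].
have d0 : g a m 0 0 * g a m 1 1 + - (g a m 0 1 * g a m 1 0) != 0.
  by rewrite -det2 gt_eqF // riem_det.
have Cv := C1atV am d0 Cd.
have E k l (F : M -> R) : C1at a m F ->
    (forall z, dom a z -> invmx (g a z) k l =
      (g a z 0 0 * g a z 1 1 + - (g a z 0 1 * g a z 1 0))^-1 * F z) ->
    C1at a m (fun z => invmx (g a z) k l).
  move=> CF EF; apply: (C1at_near am _ (C1atM am Cv CF)).
  by apply: filterS (near_dom am) => z az; rewrite EF.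
have iE z : dom a z -> invmx (g a z) =
  \matrix_(i, j) ((\det (g a z))^-1 * (if i == 0 then if j == 0 then g a z 1 1 else - g a z 0 1
                                else if j == 0 then - g a z 1 0 else g a z 0 0)).
  by move=> az; rewrite inv2 // gt_eqF // riem_det.
move: i j; do 2![apply: ord2P].
- by apply: (E _ _ _ (Cg 1 1)) => z az; rewrite iE // mxE det2.
- by apply: (E _ _ _ (C1atN (Cg 0 1))) => z az; rewrite iE // mxE det2.
- by apply: (E _ _ _ (C1atN (Cg 1 0))) => z az; rewrite iE // mxE det2.
- by apply: (E _ _ _ (Cg 0 0)) => z az; rewrite iE // mxE det2.
Qed.

Lemma cubic_local m0 : exists (W : set M) (z c : M -> R[i]),
  [/\ open W, W m0, holomorphic_on g W z /\ holomorphic_on g W c,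
      forall a m, W m -> dom a m -> exists i, pdC a i z m != 0
    & forall a m, W m -> dom a m -> forall i j k,
        C a m i j k = c m * pdC a i z m * pdC a j z m * pdC a k z m].
Proof.
have [W [z [c [[oW Wm0] [hz _ nz] hc CE]]]] := hol m0.
by exists W, z, c; split.
Qed.

Lemma cubic_law a b m : dom a m -> dom b m -> forall i j k,
  C a m i j k = \sum_(p < 2) \sum_(q < 2) \sum_(r < 2)
     toC (jac b a m p i * jac b a m q j * jac b a m r k) * C b m p q r.
Proof.
move=> am bm i j k; have [W [z [c [oW Wm [[s1 s2 _] _] _ CE]]]] := cubic_local m.
have Cz : C1atC b m z by exact: smooth_C1atC oW Wm bm s1 s2.
rewrite !sum2 !CE // !(chain_chartC am bm Cz) !sum2 !toCM.
move: (c m) (pdC b 0 z m) (pdC b 1 z m) => x y0 y1.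
move: (toC (jac b a m 0 i)) (toC (jac b a m 1 i)) (toC (jac b a m 0 j))
  (toC (jac b a m 1 j)) (toC (jac b a m 0 k)) (toC (jac b a m 1 k)).
by move=> *; ring.
Qed.

Lemma re_cubic_pull a b m : dom a m -> dom b m ->
  re_cubic C a m = pull3 (jac b a m) (re_cubic C b m).
Proof.
move=> am bm; apply/funext => i; apply/funext => j; apply/funext => k.
rewrite /re_cubic /pull3 (cubic_law am bm) !sum2 !ReD !Re_toCM.
by move: (Re _) (Re _) (Re _) (Re _) (Re _) (Re _) (Re _) (Re _) => *; ring.
Qed.

Lemma im_cubic_pull a b m : dom a m -> dom b m ->
  im_cubic C a m = pull3 (jac b a m) (im_cubic C b m).
Proof.
move=> am bm; apply/funext => i; apply/funext => j; apply/funext => k.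
rewrite /im_cubic /pull3 (cubic_law am bm) !sum2 !ImD !Im_toCM.
by move: (Im _) (Im _) (Im _) (Im _) (Im _) (Im _) (Im _) (Im _) => *; ring.
Qed.

Lemma cubic_C1 a m i j k : dom a m -> C1atC a m (fun z => C a z i j k).
Proof.
move=> am; have [W [z [c [oW Wm [[s1 s2 _] [s3 s4 _]] _ CE]]]] := cubic_local m.
have Cc : C1atC a m c by exact: smooth_C1atC oW Wm am s3 s4.
have Cz l : C1atC a m (pdC a l z) by exact: smooth_C1atC_pd oW Wm am s1 s2.
have [P1 P2] := C1atC_M am (C1atC_M am (C1atC_M am Cc (Cz i)) (Cz j)) (Cz k).
have Wn : \forall z \near m, W z by apply: open_nbhs_nbhs.
split; [apply: (C1at_near am _ P1)|apply: (C1at_near am _ P2)];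
  by apply: filterS2 Wn (near_dom am) => y Wy ay; rewrite CE.
Qed.

Lemma cubic_sym a m : dom a m -> forall i j k,
  re_cubic C a m i j k = re_cubic C a m j i k /\ re_cubic C a m i j k = re_cubic C a m i k j.
Proof.
move=> am i j k; have [W [z [c [oW Wm _ _ CE]]]] := cubic_local m.
have CE' := CE a m Wm am.
have S1 : C a m i j k = C a m j i k.
  have alg (x y w t : R[i]) : x * y * w * t = x * w * y * t by rewrite (mulrAC x).
  exact: etrans (CE' i j k) (etrans (alg _ _ _ _) (esym (CE' j i k))).
have S2 : C a m i j k = C a m i k j.
  exact: etrans (CE' i j k) (etrans (mulrAC _ _ _) (esym (CE' i k j))).
by split; [exact: (congr1 (@complex.Re R) S1)|exact: (congr1 (@complex.Re R) S2)].
Qed.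

(** The gradient of a holomorphic coordinate is isotropic. *)
Lemma cubic_tracefree a m : dom a m -> forall i,
  \sum_(k < 2) \sum_(l < 2) invmx (g a m) k l * re_cubic C a m l i k = 0.
Proof.
move=> am i; have [W [z [c [oW Wm [[_ _ rz] _] _ CE]]]] := cubic_local m.
have [u1 u0] := rot_raise (riem_det riem am) (metric_sym10 am) (rz a m Wm am).
set Z := fun k => \sum_(p < 2) toC (invmx (g a m) k p) * pdC a p z m in u1 u0.
transitivity (Re (c m * pdC a i z m * (pdC a 0 z m * Z 0 + pdC a 1 z m * Z 1))).
  have -> : c m * pdC a i z m * (pdC a 0 z m * Z 0 + pdC a 1 z m * Z 1) =
      toC (invmx (g a m) 0 0) * C a m 0 i 0 + toC (invmx (g a m) 0 1) * C a m 1 i 0 +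
      (toC (invmx (g a m) 1 0) * C a m 0 i 1 + toC (invmx (g a m) 1 1) * C a m 1 i 1).
    rewrite /Z !sum2 (CE a m Wm am 0 i 0) (CE a m Wm am 1 i 0) (CE a m Wm am 0 i 1) (CE a m Wm am 1 i 1).
    move: (c m) (pdC a i z m) (pdC a 0 z m) (pdC a 1 z m) => x y y0 y1.
    move: (toC (invmx (g a m) 0 0)) (toC (invmx (g a m) 0 1)) (toC (invmx (g a m) 1 0)) (toC (invmx (g a m) 1 1)).
    by move=> *; ring.
  by rewrite ReD !Re_comb2 !sum2.
rewrite u1 u0; have -> : - (ii * toC (Num.sqrt (\det (g a m))) * Z 1) * Z 0 +
    ii * toC (Num.sqrt (\det (g a m))) * Z 0 * Z 1 = 0 by ring.
by rewrite mulr0.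
Qed.

(** The imaginary part of [C], two of whose indices are contracted with [h].  Its
    exterior derivative is minus the first variation of the energy density. *)
Definition flux_form h a m j := \sum_(k < 2) \sum_(l < 2)
  im_cubic C a m j k l * (invmx (g a m) *m h a m *m invmx (g a m)) k l.

Definition flux_density h a m := \sum_(j < 2) \sum_(k < 2) \sum_(l < 2)
  nab g h a m j k l * raise3 (g a m) (re_cubic C a m) j k l.

(** With [C = c dz^3], the flux form is the imaginary part of
    [c h(Z, Z) dz], where [Z] is the gradient of [z].  Holomorphy of [c] kills
    the term with the derivative of [c], and the remaining derivatives assemble
    into the covariant derivative of [h] because [Z] is a geodesic field. *)
Lemma flux_form_exterior h a m : sym2_field h -> dom a m ->
  pd a 0 (fun z => flux_form h a z 1) m - pd a 1 (fun z => flux_form h a z 0) m =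
  Num.sqrt (\det (g a m)) * flux_density h a m.
Proof.
move=> sh am.
have [W [z [c [oW Wm [[s1 s2 rz] [s3 s4 rc]] nz CE]]]] := cubic_local m.
have Wn : \forall z \near m, W z by apply: open_nbhs_nbhs.
pose u l := pdC a l z.
pose Z k (y : M) := \sum_(p < 2) toC (invmx (g a y) k p) * u p y.
have Cc : C1atC a m c by exact: smooth_C1atC oW Wm am s3 s4.
have Cu l : C1atC a m (u l) by exact: smooth_C1atC_pd oW Wm am s1 s2.
have Cgi i j : C1atC a m (fun y => toC (invmx (g a y) i j)).
  by apply: C1atC_real; exact: C1at_inv.
have Cg i j : C1atC a m (fun y => toC (g a y i j)).
  by apply: C1atC_real; exact: sym2_C1 riem.1 am.
have Ch i j : C1atC a m (fun y => toC (h a y i j)).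
  by apply: C1atC_real; exact: sym2_C1 sh am.
have CZ k : C1atC a m (Z k).
  exact: (C1atC_sum _ (fun p => C1atC_M am (Cgi k p) (Cu p))).
have Zrot y : W y -> dom a y ->
  u 1 y = ii * toC (Num.sqrt (\det (g a y))) * Z 0 y /\
  u 0 y = - (ii * toC (Num.sqrt (\det (g a y))) * Z 1 y).
  move=> Wy ay.
  exact: (rot_raise (riem_det riem ay) (metric_sym10 ay) (rz a y Wy ay)).
have uE y k : dom a y -> u k y = \sum_(p < 2) toC (g a y k p) * Z p y.
  move=> ay; have ug := riem_unit riem ay.
  have I k' l : g a y k' 0 * invmx (g a y) 0 l + g a y k' 1 * invmx (g a y) 1 l = (k' == l)%:R.
    by have := mulmxV ug => /matrixP /(_ k' l); rewrite !mxE sum2.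
  rewrite /Z !sum2.
  transitivity (toC (g a y k 0 * invmx (g a y) 0 0 + g a y k 1 * invmx (g a y) 1 0) * u 0 y +
                toC (g a y k 0 * invmx (g a y) 0 1 + g a y k 1 * invmx (g a y) 1 1) * u 1 y).
    have t1 : toC 1 = 1 :> R[i] by apply: complex_ext.
    have t0 : toC 0 = 0 :> R[i] by apply: complex_ext.
    by rewrite !I; move: k; apply: ord2P => /=; rewrite t1 t0 mul1r mul0r ?addr0 ?add0r.
  by rewrite !toCD !toCM; ring.
have uZ0 y : W y -> dom a y -> \sum_(p < 2) u p y * Z p y = 0.
  by move=> Wy ay; have [E1 E0] := Zrot y Wy ay; rewrite sum2 E1 E0; ring.
have giS p q y : dom a y -> invmx (g a y) p q = invmx (g a y) q p.
  by move=> ay; rewrite -[in LHS](sym2_sym riem.1 ay) -trmx_inv mxE.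
pose du j k := pdC a j (u k) m.
pose dZ j p := pdC a j (Z p) m.
have dus j k : du j k = du k j.
  have S : du 1 0 = du 0 1 := pdC_schwarz oW Wm am s1 s2.
  exact: (ord2_sym (esym S)).
have duE j k : du j k = \sum_(p < 2) (toC (dh_ g a m j k p) * Z p m + toC (g a m k p) * dZ j p).
  transitivity (pdC a j (fun y => \sum_(p < 2) toC (g a y k p) * Z p y) m).
    by apply: pdC_near => //; apply: filterS (near_dom am) => y; exact: uE.
  rewrite (pdC_sum2 j (fun p => C1atC_M am (Cg k p) (CZ p))).
  apply: eq_bigr => p _; rewrite (pdCM j am (Cg k p) (CZ p)); congr (_ * _ + _).
  exact: pdC_real.
(* derivative of [uZ0], the isotropy of the gradient *)
have iso k : \sum_(p < 2) (du k p * Z p m + u p m * dZ k p) = 0.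
  transitivity (pdC a k (fun y => \sum_(p < 2) u p y * Z p y) m).
    rewrite (pdC_sum2 k (fun p => C1atC_M am (Cu p) (CZ p))).
    by apply: eq_bigr => p _; rewrite (pdCM k am (Cu p) (CZ p)).
  rewrite -[RHS](pdC_cst a m k 0); apply: pdC_near => //.
  by apply: filterS2 Wn (near_dom am) => y Wy ay; rewrite uZ0.
have low l j k : \sum_(p < 2) g a m l p * levi_civita g a m p j k =
    2^-1 * (dh_ g a m j k l + dh_ g a m k j l - dh_ g a m l j k).
  rewrite -(invmx_sumK (fun l => dh_ g a m j k l + dh_ g a m k j l - dh_ g a m l j k) l (riem_unit riem am)).
  by rewrite mulr_sumr; apply: eq_bigr => p _; rewrite levi_civitaE /christoffel mulrCA.
have geo := isotropic_geodesic (riem_unit riem am) (metric_sym10 am)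
  (fun i j k => dh_sym i j k riem.1 am) low dus (fun k => uE m k am) duE iso.
have [u1 u0] := Zrot m Wm am.
(* [c] is holomorphic, so its differential is proportional to [u] *)
have cr : pdC a 0 c m * u 1 m = pdC a 1 c m * u 0 m.
  have [c1 c0] := rot_raise (riem_det riem am) (metric_sym10 am) (rc a m Wm am).
  rewrite !sum2 in c1 c0; move: u1 u0; rewrite /Z !sum2 /u => u1 u0.
  exact: parallel_gradients c1 c0 u1 u0 (congr1 (@toC R) (giS 0 1 m am)).
have hs : h a m 1 0 = h a m 0 1 by rewrite -[in LHS](sym2_sym sh am) mxE.
have Gs i j k : levi_civita g a m i j k = levi_civita g a m i k j.
  rewrite levi_civitaE /christoffel; congr (_ * _); apply: eq_bigr => l _; congr (_ * _).
  by rewrite (dh_sym l j k riem.1 am) [dh_ g a m j k l + _]addrC.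
pose Hm := \sum_(p < 2) \sum_(q < 2) toC (h a m p q) * Z p m * Z q m.
pose dHm j := \sum_(p < 2) \sum_(q < 2) (toC (dh_ h a m j p q) * Z p m * Z q m +
     toC (h a m p q) * dZ j p * Z q m + toC (h a m p q) * Z p m * dZ j q).
pose T := \sum_(j < 2) \sum_(k < 2) \sum_(l < 2) toC (nab g h a m j k l) * Z j m * Z k m * Z l m.
have E : ((pdC a 0 c m * Hm + c m * dHm 0) * u 1 m + c m * Hm * du 0 1) -
         ((pdC a 1 c m * Hm + c m * dHm 1) * u 0 m + c m * Hm * du 1 0) =
         ii * toC (Num.sqrt (\det (g a m))) * c m * T.
  exact: (@flux_algebra R _ (c m) _ (dh_ h a m) _ (fun k => u k m) (fun k => Z k m)
    (fun j => pdC a j c m) du dZ hs Gs u1 u0 cr dus geo).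
pose H y := \sum_(p < 2) \sum_(q < 2) toC (h a y p q) * Z p y * Z q y.
have CH2 p : C1atC a m (fun y => \sum_(q < 2) toC (h a y p q) * Z p y * Z q y).
  exact: (C1atC_sum _ (fun q => C1atC_M am (C1atC_M am (Ch p q) (CZ p)) (CZ q))).
have CH : C1atC a m H by exact: C1atC_sum.
have dH j : pdC a j H m = dHm j.
  rewrite (pdC_sum2 j CH2); apply: eq_bigr => p _.
  rewrite (pdC_sum2 j (fun q => C1atC_M am (C1atC_M am (Ch p q) (CZ p)) (CZ q))).
  apply: eq_bigr => q _.
  rewrite (pdCM j am (C1atC_M am (Ch p q) (CZ p)) (CZ q)) (pdCM j am (Ch p q) (CZ p)) pdC_real.
  by rewrite mulrDl.
have dTheta j k : pdC a j (fun y => c y * H y * u k y) m =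
    (pdC a j c m * Hm + c m * dHm j) * u k m + c m * Hm * du j k.
  by rewrite (pdCM j am (C1atC_M am Cc CH) (Cu k)) (pdCM j am Cc CH) dH.
rewrite -!dTheta in E.
have Eim j k : pd a j (fun y => flux_form h a y k) m = Im (pdC a j (fun y => c y * H y * u k y) m).
  apply: pd_near => //; apply: filterS2 Wn (near_dom am) => y Wy ay.
  rewrite /flux_form.
  transitivity (Im (\sum_(k' < 2) \sum_(l < 2)
    toC ((invmx (g a y) *m h a y *m invmx (g a y)) k' l) * C a y k k' l)).
    by rewrite !sum2 ImD !Im_comb2 /im_cubic; ring.
  congr Im; rewrite /H /Z !sum2 !CE // -/(u _ y) !mxE !sum2 !mxE !sum2 !(giS 1 0 y ay) !toCD !toCM.
  rewrite !toCD !toCM /u.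
  move: (c y) (pdC a k z y) (pdC a 0 z y) (pdC a 1 z y) => x x0 y0 y1.
  move: (toC (invmx (g a y) 0 0)) (toC (invmx (g a y) 0 1)) (toC (invmx (g a y) 1 1)).
  move: (toC (h a y 0 0)) (toC (h a y 0 1)) (toC (h a y 1 0)) (toC (h a y 1 1)).
  by move=> *; ring.
have ImI (w : R[i]) : Im (ii * w) = Re w by rewrite ImM /= mul0r mul1r add0r.
rewrite !Eim -ImN -ImD E -!mulrA ImI Re_toCM.
congr (_ * _); rewrite /flux_density.
have Rr j k l : Re (c m * (Z j m * Z k m * Z l m)) = raise3 (g a m) (re_cubic C a m) j k l.
  have -> : c m * (Z j m * Z k m * Z l m) = \sum_(p < 2) \sum_(q < 2) \sum_(r < 2)
     toC (invmx (g a m) j p * invmx (g a m) k q * invmx (g a m) l r) * C a m p q r.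
    rewrite /Z !sum2 !CE // !toCM /u.
    move: (c m) (pdC a 0 z m) (pdC a 1 z m) => x y0 y1.
    move: (toC (invmx (g a m) j 0)) (toC (invmx (g a m) k 0)) (toC (invmx (g a m) l 0)).
    move: (toC (invmx (g a m) j 1)) (toC (invmx (g a m) k 1)) (toC (invmx (g a m) l 1)).
    by move=> *; ring.
  by rewrite /raise3 !sum2 !ReD !Re_toCM /re_cubic.
rewrite (Re_contraction (c m) (nab g h a m) (fun j => Z j m)).
by apply: eq_bigr => j _; apply: eq_bigr => k _; apply: eq_bigr => l _; rewrite Rr.
Qed.

End CubicDifferentials.

(** * Area measures *)

Section MeasureTransport.
Local Open Scope ereal_scope.
Context d d' (X : measurableType d) (Y : measurableType d') (R : realType).
Variables (mu : {measure set X -> \bar R}) (la : {measure set Y -> \bar R}).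
Variables (A : set X) (D : set Y) (p : Y -> X) (w : Y -> R).
Hypotheses (mA : measurable A) (mD : measurable D) (mp : measurable_fun D p).
Hypotheses (pD : forall y, D y -> A (p y)) (mw : measurable_fun D w).
Hypotheses (w0 : forall y, D y -> (0 <= w y)%R).
Hypothesis muE : forall B, measurable B -> B `<=` A ->
  mu B = \int[la]_(y in D `&` p @^-1` B) (w y)%:E.

Import HBNNSimple.

(** A measure that is the image by [p] of a density [w] integrates functions
    accordingly: this is the definition for indicators, and both sides are
    additive and continuous along increasing sequences. *)
Lemma ge0_integral_transport (f : X -> \bar R) :
  (forall x, A x -> 0 <= f x) -> measurable_fun A f ->
  \int[mu]_(x in A) f x = \int[la]_(y in D) (f (p y) * (w y)%:E).
Proof.
move=> f0 mf; pose h := nnsfun_approx mA mf.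
have mhp n : measurable_fun D (fun y => h n (p y)).
  by apply: (measurable_comp measurableT) mp => //; exact: measurable_funP.
have mwE : measurable_fun D (EFin \o w) by exact/measurable_EFinP.
have -> : \int[mu]_(x in A) f x = lim (\int[mu]_(x in A) (EFin \o h n) x @[n --> \oo]).
  have fE x : A x -> f x = lim ((EFin \o h n) x @[n --> \oo]).
    by move=> Ex; apply/esym/cvg_lim => //; exact: cvg_nnsfun_approx.
  under eq_integral => x /[!inE] /fE -> //.
  apply: monotone_convergence => //.
  - move=> n; apply/measurable_EFinP.
    by apply: (measurable_funS measurableT) => //; exact/measurable_funP.
  - by move=> n x Ex //=; rewrite lee_fin.
  - by move=> x Ex a b ab; rewrite lee_fin; exact/lefP/nd_nnsfun_approx.
have -> : \int[la]_(y in D) (f (p y) * (w y)%:E) =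
    lim (\int[la]_(y in D) ((h n (p y))%:E * (w y)%:E) @[n --> \oo]).
  have fg y : D y -> f (p y) * (w y)%:E = lim ((h n (p y))%:E * (w y)%:E @[n --> \oo]).
    move=> Dy; apply/esym/cvg_lim => //; apply: cvgeZr => //.
    by apply: cvg_nnsfun_approx => //; exact: pD.
  under eq_integral => y /[!inE] /fg -> //.
  apply: monotone_convergence => //.
  - by move=> n; apply: emeasurable_funM => //; exact/measurable_EFinP.
  - by move=> n y Dy /=; rewrite mule_ge0 ?lee_fin ?w0.
  - move=> y Dy a b ab/=; rewrite lee_wpmul2r ?lee_fin ?w0//.
    exact/lefP/nd_nnsfun_approx.
suff suf n : \int[la]_(y in D) ((h n (p y))%:E * (w y)%:E) =
    \int[mu]_(x in A) (EFin \o h n) x.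
  by under [in RHS]eq_fun do rewrite suf.
transitivity (\int[mu]_(x in A)
   (\sum_(r \in range (h n)) (r * \1_(h n @^-1` [set r]) x)%:E)); last first.
  by apply: eq_integral => t tE; rewrite /= fimfunE -fsumEFin.
have mset r : measurable (h n @^-1` [set r]) by [].
have mind1 (S : set X) r : measurable_fun S (\1_(h n @^-1` [set r]) : X -> R).
  exact: (measurable_indic (mset r)).
have mind r : measurable_fun A (fun x => (r * \1_(h n @^-1` [set r]) x)%:E).
  by apply: (measurable_comp measurableT) => //; exact: measurable_funM.
have mindp r : measurable_fun D (fun y => (\1_(h n @^-1` [set r]) (p y))%:E : \bar R).
  have m1 : measurable_fun setT (fun x : X => (\1_(h n @^-1` [set r]) x)%:E : \bar R).
    by apply: (measurable_comp measurableT) => //; exact: mind1.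
  exact: (measurableT_comp m1 mp).
rewrite ge0_integral_fsum//; last by move=> m y Ey; exact: nnfun_muleindic_ge0.
transitivity (\int[la]_(y in D) (\sum_(r \in range (h n))
    ((r * \1_(h n @^-1` [set r]) (p y))%:E * (w y)%:E))).
  apply: eq_integral => y; rewrite inE => Dy.
  rewrite -ge0_mule_fsuml => [|r]; last exact: nnfun_muleindic_ge0.
  by rewrite fsumEFin // -(fimfunE _ (p y)).
rewrite ge0_integral_fsum//; last 2 first.
  - move=> r; apply: emeasurable_funM => //.
    under eq_fun do rewrite EFinM; apply: emeasurable_funM => //.
  - by move=> m y Ey; rewrite mule_ge0 ?lee_fin ?w0 // -lee_fin nnfun_muleindic_ge0.
apply: eq_fsbigr => r rhn.
under [RHS]eq_integral do rewrite EFinM.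
rewrite [RHS]integralZl_indic_nnsfun // integral_indic //.
under eq_integral do rewrite EFinM -muleA.
rewrite ge0_integralZl//; last 3 first.
- exact: emeasurable_funM.
- by move=> t Dt; rewrite mule_ge0 ?lee_fin ?w0.
- by move: rhn; rewrite inE => -[t _ <-]; rewrite lee_fin.
congr (_ * _); rewrite muE; last 2 first.
- exact: measurableI.
- by move=> x [].
rewrite [RHS](_ : _ = \int[la]_(y in D `&` p @^-1` (h n @^-1` [set r])) (w y)%:E); last first.
  congr (integral _ _ _); apply/seteqP; split => y /=; first by move=> [Dy [hy _]].
  by move=> [Dy hy]; split => //; split => //; exact: pD.
rewrite integral_mkcondr; apply: eq_integral => y _.
rewrite epatch_indic muleC; congr (_ * _).
Qed.

(** Without integrability the same formula holds for the positive and negative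
    parts, hence for their difference. *)
Lemma integral_transport (f : X -> R) : measurable_fun A f ->
  \int[mu]_(x in A) (f x)%:E = \int[la]_(y in D) (f (p y) * w y)%:E.
Proof.
move=> mf; have mfE : measurable_fun A (EFin \o f) by exact/measurable_EFinP.
have K (x b : R) : (0 <= b)%R -> maxe x%:E 0 * b%:E = maxe (x * b)%:E 0.
  move=> b0; have [x0|/ltW x0] := leP 0%R x.
    by rewrite !max_l ?lee_fin ?mulr_ge0 // EFinM.
  by rewrite !max_r ?lee_fin ?mulr_le0_ge0 // mul0e.
rewrite integralE [RHS]integralE; congr (_ - _).
  rewrite ge0_integral_transport //; last exact: measurable_funepos.
  by apply: eq_integral => y; rewrite inE => Dy; rewrite !funeposE K // w0.
rewrite ge0_integral_transport //; last exact: measurable_funeneg.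
apply: eq_integral => y; rewrite inE => Dy; rewrite !funenegE -!EFinN K ?w0 //.
by rewrite mulNr.
Qed.

End MeasureTransport.

Section PlaneBorel.
Variable R : realType.
Local Notation plane := (measurableTypeR R * measurableTypeR R)%type.

(** An open set of the plane is a countable union of rational squares. *)
Lemma open_measurable_plane (U : set (R * R)) : open U -> measurable (U : set plane).
Proof.
move=> oU.
pose box (q : rat * rat * rat) : set plane :=
  `]ratr q.1.1 - ratr q.2, ratr q.1.1 + ratr q.2[%classic `*`
  `]ratr q.1.2 - ratr q.2, ratr q.1.2 + ratr q.2[%classic.
pose F q := if `[< box q `<=` U >] then box q else set0.
have -> : (U : set plane) = \bigcup_q F q.
  apply/seteqP; split => [x Ux|x [q _]]; last first.
    by rewrite /F; case: ifPn => // /asboolP; exact.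
  have [r r0 H] := (near_ballP x U).1 (open_nbhs_nbhs (conj oU Ux)).
  have r4 : 0 < r / 4 by rewrite divr_gt0.
  have r24 : r / 4 < r / 2 by lra.
  have rat_near (y : R) : exists q : rat, `|y - ratr q| < r / 4.
    have [|q] := @rat_in_itvoo R (y - r / 4) (y + r / 4); first by lra.
    by rewrite in_itv /= => /andP[q1 q2]; exists q; rewrite ltr_norml; apply/andP; split; lra.
  have [q1 E1] := rat_near x.1; have [q2 E2] := rat_near x.2.
  have [q3] := @rat_in_itvoo R _ _ r24; rewrite in_itv /= => /andP[q31 q32].
  exists (q1, q2, q3) => //; rewrite /F; case: ifPn => [_|/asboolP []].
    move: E1 E2; rewrite !ltr_norml => /andP[a1 a2] /andP[b1 b2].
    by split => /=; rewrite in_itv /=; apply/andP; split; lra.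
  move=> y [/=]; rewrite !in_itv /= => /andP[c1 c2] /andP[d1 d2].
  move: E1 E2; rewrite !ltr_norml => /andP[a1 a2] /andP[b1 b2].
  have := H (y.1 - x.1) (y.2 - x.2); rewrite plane_step.
  rewrite ![x.1 + _]addrC ![x.2 + _]addrC !subrK -surjective_pairing; apply.
    by rewrite ltr_norml; apply/andP; split; lra.
  by rewrite ltr_norml; apply/andP; split; lra.
apply: countable_bigcupT_measurable; first exact: countableP.
move=> q; rewrite /F; case: ifPn => // _.
by apply: measurableX; exact: measurable_itv.
Qed.

Lemma measurable_fun_open d (T : measurableType d) (D : set T) (f : T -> R) :
  (forall V : set R, open V -> measurable (D `&` f @^-1` V)) -> measurable_fun D f.
Proof.
move=> H; apply: (measurability _ (RGenOpens.measurableE R)).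
move=> _ [_ [x [y ->]] <-]; apply: H; exact: interval_open.
Qed.

Lemma continuous_measurable_plane (U : set (R * R)) (f : R * R -> R) : open U ->
  (forall x, U x -> {for x, continuous f}) -> measurable_fun (U : set plane) (f : plane -> R).
Proof.
move=> oU cf; apply: measurable_fun_open => V oV; apply: open_measurable_plane.
rewrite openE => x [Ux Vx]; apply: filterI; first exact: open_nbhs_nbhs.
exact: (near_preimage (P := V) (cf x Ux) (open_nbhs_nbhs (conj oV Vx))).
Qed.

End PlaneBorel.

Section SurfaceBorel.
Variables (R : realType) (M : closed_oriented_surface R).
Local Notation plane := (measurableTypeR R * measurableTypeR R)%type.
Local Notation borel := (g_sigma_algebraType (@open M)).
Local Notation la2 := ((@lebesgue_measure R) \x (@lebesgue_measure R))%E.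
Implicit Types (a b : chart M) (m : M) (g h : cov2 M).

Lemma open_measurable_surface (W : set M) : open W -> measurable (W : set borel).
Proof. by move=> oW; exact: (@sub_sigma_algebra _ setT (@open M) W oW). Qed.

Lemma continuous_measurable_surface (W : set M) (f : M -> R) : open W ->
  (forall m, W m -> {for m, continuous f}) -> measurable_fun (W : set borel) (f : borel -> R).
Proof.
move=> oW cf; apply: measurable_fun_open => V oV; apply: open_measurable_surface.
rewrite openE => x [Wx Vx]; apply: filterI; first exact: open_nbhs_nbhs.
exact: (near_preimage (P := V) (cf x Wx) (open_nbhs_nbhs (conj oV Vx))).
Qed.

Lemma measurable_dom a : measurable (dom a : set borel).
Proof. exact: (open_measurable_surface (dom_open a)). Qed.

Lemma coord_dom_measurable a : measurable (coord a @` dom a : set plane).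
Proof. exact: (open_measurable_plane (@coord_dom_open _ _ a)). Qed.

Lemma measurable_param a :
  measurable_fun (coord a @` dom a : set plane) (param a : plane -> borel).
Proof.
have H := @measurability _ _ _ borel (coord a @` dom a : set plane) (param a) (@open M).
apply: H => // _ [W oW <-]; apply: open_measurable_plane.
have -> : coord a @` dom a `&` param a @^-1` W = coord a @` (W `&` dom a).
  apply/seteqP; split => x.
    by move=> [[m am <-]]; rewrite /= coordK // => Wm; exists m.
  by move=> [m [Wm am] <-]; split; [exists m|rewrite /= coordK].
exact: open_image.
Qed.

Lemma image_preimage a (A B : set M) : B `<=` A -> A `<=` dom a ->
  coord a @` A `&` param a @^-1` B = coord a @` B.
Proof.
move=> BA Aa; apply/seteqP; split => x.
  by move=> [[m Am <-]]; have am := Aa m Am; rewrite /= coordK // => Bm; exists m.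
move=> [m Bm <-]; split; first by exists m => //; exact: BA.
by rewrite /= coordK //; exact/Aa/BA.
Qed.

Lemma image_measurable a (A : set borel) : measurable A -> A `<=` dom a ->
  measurable (coord a @` A : set plane).
Proof.
move=> mA Aa; rewrite -(image_preimage Aa (@subset_refl _ (dom a))).
exact: (measurable_param (coord_dom_measurable a) mA).
Qed.

Definition vol_density g a (x : R * R) : R := Num.sqrt (\det (g a (param a x))).

Definition continuous_metric g :=
  forall a m i j, dom a m -> {for m, continuous (fun z => g a z i j)}.

Lemma det_continuous g a m : continuous_metric g -> dom a m ->
  {for m, continuous (fun z => \det (g a z))}.
Proof.
move=> cg am.
rewrite (_ : (fun z => _) = fun z => g a z 0 0 * g a z 1 1 + - (g a z 0 1 * g a z 1 0)).
  by apply: continuousDm; [apply: continuousMm|apply: continuousNm; apply: continuousMm]; exact: cg.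
by apply/funext => z; rewrite det2.
Qed.

Lemma sqrt_continuous_at (T : topologicalType) (f : T -> R) (t : T) :
  {for t, continuous f} -> {for t, continuous (fun z => Num.sqrt (f z))}.
Proof. by move=> cf; apply: (continuous_comp cf); exact: sqrt_continuous. Qed.

Lemma vol_density_continuous g a x : continuous_metric g -> (coord a @` dom a) x ->
  {for x, continuous (vol_density g a)}.
Proof.
move=> cg [m am <-].
have cp := param_continuous am; apply: sqrt_continuous_at.
have cd : {for param a (coord a m), continuous (fun z => \det (g a z))}.
  by rewrite coordK //; exact: det_continuous.
exact: (continuous_comp cp cd).
Qed.

Lemma measurable_vol_density g a : continuous_metric g ->
  measurable_fun (coord a @` dom a : set plane) (vol_density g a : plane -> R).
Proof.
move=> cg; apply: continuous_measurable_plane; first exact: coord_dom_open.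
by move=> x; exact: vol_density_continuous.
Qed.

Variable mu : {measure set borel -> \bar R}.

(** By [integral_transport] the defining property of the area measure passes
    from sets to functions. *)
Lemma integral_chart g a (A : set borel) (f : M -> R) : continuous_metric g ->
  is_volume g mu -> measurable A -> A `<=` dom a -> measurable_fun A (f : borel -> R) ->
  (\int[mu]_(m in A) (f m)%:E =
   \int[la2]_(x in coord a @` A) (f (param a x) * vol_density g a x)%:E)%E.
Proof.
move=> cg vol mA Aa mf.
have sub : coord a @` A `<=` coord a @` dom a by apply: image_subset.
apply: integral_transport => //.
- exact: image_measurable.
- exact: (measurable_funS (coord_dom_measurable a) sub (@measurable_param a)).
- by move=> _ [m Am <-]; rewrite coordK //; exact: Aa.
- exact: (measurable_funS (coord_dom_measurable a) sub (measurable_vol_density cg)).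
- by move=> x _; rewrite sqrtr_ge0.
- move=> B mB BA; rewrite (vol a) //; last exact: subset_trans BA Aa.
  by rewrite image_preimage.
Qed.

Lemma finite_atlas : exists s : seq (chart M), forall m, exists2 a, a \in s & dom a m.
Proof.
have := @carrier_compact _ M; rewrite compact_cover => /(_ _ setT dom).
case=> [a _|m _|D' _ cov]; first exact: dom_open.
  by have [a am] := dom_cover m; exists a.
exists (finmap.enum_fset D') => m; have [a /= aD am] := cov m I.
by exists a.
Qed.

(** A finite atlas cuts every set into pieces, each inside a chart. *)
Lemma measure_eq_charts (nu : {measure set borel -> \bar R}) :
  (forall a (A : set borel), measurable A -> A `<=` dom a -> mu A = nu A) ->
  forall A : set borel, measurable A -> mu A = nu A.
Proof.
move=> E A mA; have [s cov] := finite_atlas.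
have {cov} : A `<=` [set m | exists2 a, a \in s & dom a m] by move=> m _; exact: cov.
elim: s A mA => [|a s IH] A mA sA.
  have -> : A = set0 by apply/seteqP; split => // m /sA [].
  by rewrite !measure0.
have EA : A = (A `&` dom a) `|` (A `\` dom a).
  by rewrite -setIUr setUv setIT.
have m1 : measurable (A `&` dom a) by apply: measurableI => //; exact: measurable_dom.
have m2 : measurable (A `\` dom a) by apply: measurableD => //; exact: measurable_dom.
have dis : (A `&` dom a) `&` (A `\` dom a) = set0.
  by apply/seteqP; split => // m [[_ am] [_]].
rewrite EA !measureU //; congr (_ + _)%E; first by apply: (E a) => // m [].
by apply: IH => // m [/sA [b]]; rewrite inE => /orP[/eqP ->|bs] //; exists b.
Qed.

End SurfaceBorel.

Lemma density_measure_exists d (T : measurableType d) (R : realType)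
    (mu : {measure set T -> \bar R}) (rho : T -> R) :
  measurable_fun setT rho -> (forall x, 0 <= rho x) ->
  exists nu : {measure set T -> \bar R},
    forall A, measurable A -> nu A = (\int[mu]_(x in A) (rho x)%:E)%E.
Proof.
move=> mrho rho0.
pose nu (A : set T) := (\int[mu]_(x in A) (rho x)%:E)%E.
have r0 x : (0 <= (rho x)%:E)%E by rewrite lee_fin.
have nu0 : nu set0 = 0%E by exact: integral_set0.
have nu_ge0 A : (0 <= nu A)%E by exact: integral_ge0.
have nu_sigma : semi_sigma_additive nu.
  move=> F mF tF mUF; rewrite /nu ge0_integral_bigcup //; last first.
    by apply/measurable_EFinP; exact: measurable_funTS.
  by apply: is_cvg_ereal_nneg_natsum => n _; exact: integral_ge0.
pose B := isMeasure.Build d T R nu nu0 nu_ge0 nu_sigma.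
pose nuM : {measure set T -> \bar R} := HB.pack nu B.
by exists nuM.
Qed.

Section VolumeChange.
Variables (R : realType) (M : closed_oriented_surface R).
Local Notation plane := (measurableTypeR R * measurableTypeR R)%type.
Local Notation borel := (g_sigma_algebraType (@open M)).
Local Notation la2 := ((@lebesgue_measure R) \x (@lebesgue_measure R))%E.
Implicit Types (a b : chart M) (m : M) (g h : cov2 M).

Lemma measurable_fun_surface (f : M -> R) :
  (forall m, {for m, continuous f}) -> measurable_fun setT (f : borel -> R).
Proof. by move=> cf; apply: continuous_measurable_surface => //; exact: openT. Qed.

Lemma is_volume_density g g' (mu : {measure set borel -> \bar R}) (rho : M -> R) :
  continuous_metric g -> is_volume g mu ->
  (forall m, {for m, continuous rho}) -> (forall m, 0 <= rho m) ->
  (forall a m, dom a m -> Num.sqrt (\det (g' a m)) = rho m * Num.sqrt (\det (g a m))) ->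
  exists2 nu : {measure set borel -> \bar R}, is_volume g' nu &
    forall A : set borel, measurable A -> nu A = (\int[mu]_(x in A) (rho x)%:E)%E.
Proof.
move=> cg vol crho rho0 ratio.
have mrho := measurable_fun_surface crho.
have [nu nuE] := density_measure_exists mu mrho rho0.
exists nu => // a A mA Aa; rewrite nuE //.
rewrite (integral_chart cg vol mA Aa); last exact: measurable_funTS.
apply: eq_integral => x; rewrite inE => -[m Am <-].
by rewrite /vol_density coordK ?ratio //; exact: Aa.
Qed.

Lemma is_volume_unique g (mu nu : {measure set borel -> \bar R}) :
  is_volume g mu -> is_volume g nu -> forall A : set borel, measurable A -> mu A = nu A.
Proof.
move=> vmu vnu; apply: measure_eq_charts => a A mA Aa.
by rewrite (vmu a) // (vnu a).
Qed.

Lemma volumeP g : (exists mu, is_volume g mu) -> is_volume g (volume g).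
Proof. by rewrite /volume => E; case: pselect => // ex; case: (cid ex). Qed.

(** The area measure of [g'] is the one of [g] with density [rho], so that one
    of them exists if the other does.  If neither exists, both integrals are
    taken with respect to the zero measure. *)
Lemma integral_volume_change g g' (rho : M -> R) (f : M -> R) :
  continuous_metric g -> continuous_metric g' ->
  (forall m, {for m, continuous rho}) -> (forall m, 0 < rho m) ->
  (forall a m, dom a m -> Num.sqrt (\det (g' a m)) = rho m * Num.sqrt (\det (g a m))) ->
  (forall m, {for m, continuous f}) ->
  (\int[volume g']_m (f m)%:E = \int[volume g]_m (f m * rho m)%:E)%E.
Proof.
move=> cg cg' crho rho0 ratio cf.
have [E|nE] := pselect (exists mu, is_volume g mu); last first.
  have nE' : ~ exists mu, is_volume g' mu.
    move=> [mu vol]; apply: nE.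
    have [|||nu vnu _] := @is_volume_density g' g mu (fun m => (rho m)^-1) cg' vol.
    - by move=> m; apply: continuousVm => //; rewrite gt_eqF.
    - by move=> m; rewrite invr_ge0 ltW.
    - by move=> a m am; rewrite (ratio a) // mulKf // gt_eqF.
    by exists nu.
  rewrite /volume; case: pselect => [//|_]; case: pselect => [//|_].
  by rewrite !integral_measure_zero.
have vol := volumeP E.
have [nu vnu nuE] := is_volume_density cg vol crho (fun m => ltW (rho0 m)) ratio.
have vol' : is_volume g' (volume g') by apply: volumeP; exists nu.
have mf := measurable_fun_surface cf.
have mrho := measurable_fun_surface crho.
apply: (@integral_transport _ _ borel borel R (volume g') (volume g) setT setT id rho) => //.
- by move=> m _; exact: ltW.
move=> B mB _; rewrite (is_volume_unique vol' vnu mB) nuE //.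
by rewrite setTI preimage_id.
Qed.

(** The density is bounded near each point, and the surface is compact. *)
Lemma volume_finite g (mu : {measure set borel -> \bar R}) :
  continuous_metric g -> is_volume g mu -> (mu setT < +oo)%E.
Proof.
move=> cg vol.
have loc m : exists W : set M, [/\ open W, W m & (mu W < +oo)%E].
  have [a am] := dom_cover m.
  have Ua : (coord a @` dom a) (coord a m) by exists m.
  have cw := vol_density_continuous cg Ua.
  have K1 : vol_density g a (coord a m) < vol_density g a (coord a m) + 1 by rewrite ltrDl.
  have := cw; move/cvgr_lt => /(_ _ K1) Kn.
  have [r r0 H] := (near_ballP _ _).1 Kn.
  set K := vol_density g a (coord a m) + 1 in H.
  pose x := coord a m.
  pose box : set plane := `]x.1 - r, x.1 + r[%classic `*` `]x.2 - r, x.2 + r[%classic.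
  have boxP y : box y -> vol_density g a y < K.
    move=> [/=]; rewrite !in_itv /= => /andP[c1 c2] /andP[d1 d2].
    have := H (y.1 - x.1) (y.2 - x.2); rewrite plane_step -/x.
    rewrite ![x.1 + _]addrC ![x.2 + _]addrC !subrK -surjective_pairing; apply.
      by rewrite ltr_norml; apply/andP; split; lra.
    by rewrite ltr_norml; apply/andP; split; lra.
  have obox : \forall y \near x, box y.
    apply/near_ballP; exists r => // s t; rewrite !ltr_norml => /andP[s1 s2] /andP[t1 t2].
    rewrite plane_step; split => /=; rewrite in_itv /=; apply/andP; split; lra.
  have mbox : measurable box by apply: measurableX; exact: measurable_itv.
  have [V [oV Vm VW]] : exists V : set M, [/\ open V, V m & V `<=` dom a `&` coord a @^-1` box].
    have Wn : nbhs m (dom a `&` coord a @^-1` box).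
      by apply: filterI; [exact: near_dom|exact: near_coord].
    exists (dom a `&` coord a @^-1` box)°; split.
    - exact: open_interior.
    - exact: Wn.
    - exact: interior_subset.
  exists V; split => //.
  have Va : V `<=` dom a by move=> z /VW [].
  have mV := open_measurable_surface oV.
  rewrite (vol a) //.
  have mI := image_measurable mV Va.
  have sI : coord a @` V `<=` box by move=> _ [z /VW [_ bz] <-].
  have K0 : 0 <= K by rewrite addr_ge0 // sqrtr_ge0.
  apply: (@le_lt_trans _ _ (\int[la2]_(y in coord a @` V) (cst K%:E) y)%E).
    apply: ge0_le_integral => //.
    - apply/measurable_EFinP; apply: measurable_funS (@measurable_vol_density _ M g a cg).
        exact: coord_dom_measurable.
      exact: image_subset.
    - by move=> y Iy; rewrite lee_fin; apply/ltW/boxP/sI.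
  rewrite integral_cst // lte_mul_pinfty ?lee_fin //.
  apply: (@le_lt_trans _ _ (la2 box)).
    by apply: le_measure => //; rewrite inE.
  pose I1 : set R := `]x.1 - r, x.1 + r[%classic.
  pose I2 : set R := `]x.2 - r, x.2 + r[%classic.
  have -> : la2 box = (lebesgue_measure I1 * lebesgue_measure I2)%E.
    by apply: product_measure1E; exact: measurable_itv.
  have rr (y : R) : y - r < y + r by lra.
  by rewrite /I1 /I2 !lebesgue_measure_itv /= !lte_fin !rr -!EFinB -EFinM ltry.
have := @carrier_compact _ M; rewrite compact_cover.
pose W m := projT1 (cid (loc m)).
have WP m : [/\ open (W m), W m m & (mu (W m) < +oo)%E] by rewrite /W; case: (cid (loc m)).
move=> /(_ _ setT W) [m _|m _|D' _ cov]; first by have [] := WP m.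
  by exists m => //; have [] := WP m.
have mW m : measurable (W m : set borel) by apply: open_measurable_surface; have [] := WP m.
have fin (s : seq M) : (mu (\big[setU/set0]_(i <- s) (W i : set borel)) < +oo)%E.
  elim: s => [|m s IH]; first by rewrite big_nil measure0 ltry.
  have mU : measurable (\big[setU/set0]_(i <- s) (W i : set borel)) by exact: bigsetU_measurable.
  rewrite big_cons.
  apply: (@le_lt_trans _ _ (mu (W m) + mu (\big[setU/set0]_(i <- s) (W i : set borel)))%E).
    exact: measureU2.
  by rewrite lte_add_pinfty //; have [] := WP m.
pose s := finmap.enum_fset D'.
have {cov} : (setT : set borel) `<=` \bigcup_(m in [set` s]) W m by move=> m _; exact: cov.
rewrite bigcup_seq => cov; apply: (le_lt_trans _ (fin s)).
by apply: le_measure; rewrite ?inE //; exact: bigsetU_measurable.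
Qed.

End VolumeChange.

(** * Stokes' theorem *)

Section PlaneDivergence.
Variable R : realType.
Local Notation plane := (measurableTypeR R * measurableTypeR R)%type.
Local Notation la := (@lebesgue_measure R).
Local Notation la2 := (la \x la)%E.

(** The fundamental theorem of calculus on an interval that contains the support
    in its interior. *)
Lemma integral_derivative_support (u u' : R -> R) (B : R) : 0 < B ->
  (forall t : R, is_derive t 1 u (u' t)) -> (forall t, {for t, continuous u'}) ->
  (forall t, B <= `|t| -> u t = 0) -> (\int[la]_t (u' t)%:E = 0)%E.
Proof.
move=> B0 du cu' supp.
pose C := B + 1.
have u'0 t : B < `|t| -> u' t = 0.
  move=> Bt; have N : \forall s \near t, u s = 0.
    have : \forall s \near t, B < `|s|.
      have cn : {for t, continuous (fun s : R => `|s|)} by exact: norm_continuous.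
      exact: (near_preimage (P := fun r => B < r) cn (lt_nbhsr Bt)).
    by apply: filterS => s Bs; apply: supp; exact: ltW.
  have := @near_eq_derive _ _ _ u (cst 0) t 1 N.
  by rewrite derive_cst (@derive_val _ _ _ _ _ _ _ (du t)).
have cu t : {for t, continuous u}.
  by apply: differentiable_continuous; apply/derivable1_diffP; exact: (@ex_derive _ _ _ _ _ _ _ (du t)).
have CC : - C < C by rewrite /C; lra.
pose I : set R := `[(- C), C]%classic.
transitivity (\int[la]_(t in I) (u' t)%:E)%E.
  rewrite [RHS]integral_mkcond; apply: eq_integral => t _; rewrite patchE.
  case: ifPn => // /negP tC; rewrite u'0 //; apply: contra_notT tC.
  rewrite -leNgt inE /I /= in_itv /= => tB.
  have : `|t| <= C by rewrite /C; lra.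
  by rewrite ler_norml.
have cw : {within `[(- C), C], continuous u'}.
  by apply: continuous_subspaceT => t; exact: cu'.
have LR : derivable_oo_LRcontinuous u (- C) C.
  split.
  - by move=> t _; exact: (@ex_derive _ _ _ _ _ _ _ (du t)).
  - by apply: cvg_at_right_filter; exact: cu.
  - by apply: cvg_at_left_filter; exact: cu.
have der : {in `](- C), C[, u^`()%classic =1 u'}.
  by move=> t _; rewrite derive1E (@derive_val _ _ _ _ _ _ _ (du t)).
rewrite (continuous_FTC2 CC cw LR der) !supp ?subee //.
  by rewrite normrN ger0_norm /C; lra.
by rewrite ger0_norm /C; lra.
Qed.

Lemma vertical_line (s r : R) : (s, 0) + r *: e_ R 1 = (s, r).
Proof.
by apply: injective_projections; rewrite /= ?[_ *: 0%R]mulr0 ?[_ *: 1%R]mulr1 ?addr0 ?add0r.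
Qed.

Lemma horizontal_line (s r : R) : (0, s) + r *: e_ R 0 = (r, s).
Proof.
by apply: injective_projections; rewrite /= ?[_ *: 0%R]mulr0 ?[_ *: 1%R]mulr1 ?addr0 ?add0r.
Qed.

Lemma continuous_lines (F : R * R -> R) : (forall x, {for x, continuous F}) ->
  forall s t : R, {for t, continuous (fun r => F (s, r))} /\ {for t, continuous (fun r => F (r, s))}.
Proof.
move=> cF s t; split.
  under [X in {for t, continuous X}]eq_fun do rewrite -vertical_line.
  have c : {for t, continuous (fun r : R => (s, 0) + r *: e_ R 1)}.
    by apply: cvgD; [exact: cvg_cst|apply: cvgZl].
  exact: (continuous_comp c (cF _)).
under [X in {for t, continuous X}]eq_fun do rewrite -horizontal_line.
have c : {for t, continuous (fun r : R => (0, s) + r *: e_ R 0)}.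
  by apply: cvgD; [exact: cvg_cst|apply: cvgZl].
exact: (continuous_comp c (cF _)).
Qed.

Variables (u : R * R -> R) (B : R).
Hypotheses (B0 : 0 < B) (supp : forall x, (B <= `|x.1|) || (B <= `|x.2|) -> u x = 0).
Hypothesis du : forall i x, derivable u x (e_ R i).
Hypothesis cdu : forall i x, {for x, continuous (fun y => 'D_(e_ R i) u y)}.

Lemma partial_support i x : (B < `|x.1|) || (B < `|x.2|) -> 'D_(e_ R i) u x = 0.
Proof.
move=> Bx; have N : \forall y \near x, u y = 0.
  have c1 : {for x, continuous (fun y : R * R => `|y.1|)}.
    by apply: (continuous_comp (f := fst)); [exact: cvg_fst|exact: norm_continuous].
  have c2 : {for x, continuous (fun y : R * R => `|y.2|)}.
    by apply: (continuous_comp (f := snd)); [exact: cvg_snd|exact: norm_continuous].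
  case/orP: Bx => Bx.
    have := near_preimage (P := fun r => B < r) c1 (lt_nbhsr Bx).
    by apply: filterS => y By; apply: supp; rewrite ltW.
  have := near_preimage (P := fun r => B < r) c2 (lt_nbhsr Bx).
  by apply: filterS => y By; apply: supp; rewrite (ltW By) orbT.
by rewrite (near_eq_derive _ N) derive_cst.
Qed.

Lemma partial_integrable i : la2.-integrable setT (fun x : plane => ('D_(e_ R i) u x)%:E).
Proof.
pose F (x : plane) := 'D_(e_ R i) u x.
have mF : measurable_fun setT F.
  by apply: continuous_measurable_plane; [exact: openT|move=> x _; exact: cdu].
pose C := B + 1.
pose I : set R := `[(- C), C]%classic.
have mI : measurable I by exact: measurable_itv.
have mbox : measurable (I `*` I : set plane) by exact: measurableX.
have cbox : compact (I `*` I : set (R * R)) by apply: compact_setX; exact: segment_compact.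
have ib : la2.-integrable (I `*` I : set plane) (EFin \o F).
  apply: measurable_bounded_integrable => //.
  - rewrite [X in (X < _)%E](_ : _ = (la I * la I)%E); last exact: product_measure1E.
    have CC : - C < C.
      have : 0 < C by rewrite /C addr_gt0.
      by move=> C0; rewrite (lt_trans _ C0) // oppr_lt0.
    by rewrite /I lebesgue_measure_itv /= lte_fin CC -EFinB -EFinM ltry.
  - exact: measurable_funTS.
  - have cF : {within (I `*` I : set (R * R)), continuous (fun y => 'D_(e_ R i) u y)}.
      by apply: continuous_subspaceT => x; exact: cdu.
    have [K [_ HK]] := compact_bounded (continuous_compact cF cbox).
    exists K; split; rewrite ?num_real // => k Kk x Ix.
    by apply: HK => //; exists x.
have := ib; rewrite (integrable_mkcond _ mbox); congr (integrable _ _ _).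
apply/funext => x; rewrite patchE; case: ifPn => // /negP nx.
rewrite [RHS](_ : _ = 0%:E) //; congr EFin; apply: partial_support.
apply: contra_notT nx; rewrite negb_or -!leNgt => /andP[x1 x2].
have BC : B <= C by rewrite /C; lra.
rewrite inE; split => /=; rewrite /I /= in_itv /= -ler_norml.
  exact: le_trans x1 BC.
exact: le_trans x2 BC.
Qed.

(** The divergence theorem in the plane for compactly supported functions:
    Fubini reduces it to the fundamental theorem of calculus on lines. *)
Lemma integral_partial i : (\int[la2]_(x in setT) ('D_(e_ R i) u x)%:E = 0)%E.
Proof.
have int := partial_integrable i.
have lineP (s t : R) : is_derive t 1 (fun r => u (s, r)) ('D_(e_ R 1) u (s, t)).
  have := @line_derive R _ u (s, 0) (e_ R 1) t; rewrite vertical_line => /(_ (@du 1 _)).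
  by under eq_fun do rewrite vertical_line.
have lineP' (s t : R) : is_derive t 1 (fun r => u (r, s)) ('D_(e_ R 0) u (t, s)).
  have := @line_derive R _ u (0, s) (e_ R 0) t; rewrite horizontal_line => /(_ (@du 0 _)).
  by under eq_fun do rewrite horizontal_line.
rewrite -integral12_prod_meas1 //.
move: i int; apply: ord2P => int.
  rewrite /fubini_F (Fubini int); apply: integral0_eq => y _ /=.
  apply: (@integral_derivative_support (fun r => u (r, y)) _ B) => //.
    by move=> t; have [_] := continuous_lines (@cdu 0) y t.
  by move=> t Bt; apply: supp; rewrite Bt.
rewrite /fubini_F; apply: integral0_eq => x _ /=.
apply: (@integral_derivative_support (fun r => u (x, r)) _ B) => //.
  by move=> t; have [] := continuous_lines (@cdu 1) x t.
by move=> t Bt; apply: supp; rewrite Bt orbT.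
Qed.

End PlaneDivergence.

Lemma near_eq_continuous (T U : topologicalType) (f h : T -> U) (t : T) :
  (\forall s \near t, f s = h s) -> {for t, continuous f} -> {for t, continuous h}.
Proof.
move=> E; rewrite /prop_for /continuous_at -(nbhs_singleton E).
by apply: cvg_trans; apply: near_eq_cvg.
Qed.

Section OneForms.
Variables (R : realType) (M : closed_oriented_surface R).
Implicit Types (a b : chart M) (m : M) (g : cov2 M).
Local Notation plane := (measurableTypeR R * measurableTypeR R)%type.
Local Notation borel := (g_sigma_algebraType (@open M)).
Local Notation la2 := ((@lebesgue_measure R) \x (@lebesgue_measure R))%E.

Definition one_form (om : chart M -> M -> 'I_2 -> R) :=
  (forall a m j, dom a m -> C1at a m (fun z => om a z j)) /\
  (forall a b m, dom a m -> dom b m -> forall j,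
     om a m j = \sum_(p < 2) jac b a m p j * om b m p).

Definition ext (om : chart M -> M -> 'I_2 -> R) a m :=
  pd a 0 (fun z => om a z 1) m - pd a 1 (fun z => om a z 0) m.

Lemma jac_schwarz a b m p : dom a m -> dom b m ->
  pd a 0 (fun z => jac b a z p 1) m = pd a 1 (fun z => jac b a z p 0) m.
Proof.
move=> am bm; have S := pd_schwarz (dom_open b) bm am (smooth_in_trans a b p).
transitivity (pd a 0 (pd a 1 (fun z => crd p (coord b z))) m).
  by apply: pd_ext => z; rewrite jacE.
by rewrite -S; apply: pd_ext => z; rewrite jacE.
Qed.

(** The second derivatives of the transition map are symmetric and cancel. *)
Lemma ext_law om a b m : one_form om -> dom a m -> dom b m ->
  ext om a m = \det (jac b a m) * ext om b m.
Proof.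
move=> [Com law] am bm.
have dJ p j : diff_in a (fun z => jac b a z p j) m by exact: C1at_diff (C1at_jac _ _ am bm).
have cob p := chain_chart am bm (C1at_diff (Com b m p bm)).
have E i j : pd a i (fun z => om a z j) m = \sum_(p < 2)
    (pd a i (fun z => jac b a z p j) m * om b m p +
     jac b a m p j * \sum_(l < 2) jac b a m l i * pd b l (fun z => om b z p) m).
  transitivity (pd a i (fun z => \sum_(p < 2) jac b a z p j * om b z p) m).
    apply: pd_near => //; apply: filterS2 (near_dom am) (near_dom bm) => z az bz.
    exact: law.
  have dp p : diff_in a (fun z => jac b a z p j * om b z p) m.
    exact: diff_inM (dJ p j) (cob p).1.
  rewrite (pd_sum _ _ dp); apply: eq_bigr => p _.
  by rewrite (pdM i am (dJ p j) (cob p).1) (cob p).2.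
rewrite /ext !E !sum2 !(jac_schwarz _ am bm) det2.
move: (pd a 1 _ m) (pd a 1 _ m) => x y; ring.
Qed.

Lemma det_metric_law g a b m : g a m = (jac b a m)^T *m g b m *m jac b a m ->
  dom a m -> dom b m ->
  Num.sqrt (\det (g a m)) = \det (jac b a m) * Num.sqrt (\det (g b m)).
Proof.
move=> law am bm; rewrite law !det_mulmx det_tr.
have alg (x y : R) : x * y * x = x ^+ 2 * y by ring.
rewrite alg sqrtrM ?sqr_ge0 //.
by rewrite sqrtr_sqr ger0_norm // ltW // det_jac.
Qed.

Lemma chart_atP m : dom (chart_at m) m.
Proof. by rewrite /chart_at; case: (cid _). Qed.

(** The exterior derivative divided by the area form; being a scalar it does not
    depend on the chart. *)
Definition curl g om m := ext om (chart_at m) m / Num.sqrt (\det (g (chart_at m) m)).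

Lemma curlE g om a m : riemannian g -> one_form om -> dom a m ->
  curl g om m = ext om a m / Num.sqrt (\det (g a m)).
Proof.
move=> rg fo am; have bm := chart_atP m; rewrite /curl; have [[_ _ law] _] := rg.
rewrite (ext_law fo am bm) (det_metric_law (law _ _ _ am bm) am bm).
have d0 : \det (jac (chart_at m) a m) != 0 by rewrite gt_eqF // det_jac.
by rewrite invfM mulrACA mulfV // mul1r.
Qed.

Lemma riem_continuous g : riemannian g -> continuous_metric g.
Proof. by move=> [sg _] a m i j am; exact: C1at_continuous (sym2_C1 i j sg am). Qed.

Lemma sqrt_det_gt0 g a m : riemannian g -> dom a m -> 0 < Num.sqrt (\det (g a m)).
Proof. by move=> rg am; rewrite sqrtr_gt0 riem_det. Qed.

Lemma curl_continuous g om m : riemannian g -> one_form om -> {for m, continuous (curl g om)}.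
Proof.
move=> rg fo; have am := chart_atP m; set a := chart_at m in am.
have [Com _] := fo.
have C : {for m, continuous (fun z => (pd a 0 (fun z => om a z 1) z - pd a 1 (fun z => om a z 0) z)
    * (Num.sqrt (\det (g a z)))^-1)}.
  apply: continuousMm.
    by apply: continuousDm; [have [_] := Com a m 1 am|apply: continuousNm; have [_] := Com a m 0 am].
  apply: continuousVm; first by rewrite gt_eqF // sqrt_det_gt0.
  by apply: sqrt_continuous_at; apply: det_continuous => //; exact: riem_continuous.
apply: continuous_near C.
by apply: filterS (near_dom am) => z az; rewrite (curlE rg fo az).
Qed.

Lemma pd_zero_near a m i (f : M -> R) : dom a m -> (\forall z \near m, f z = 0) -> pd a i f m = 0.
Proof. by move=> am E; rewrite -[RHS](pd_cst a m i 0); exact: pd_near. Qed.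

Section Supported.
Variables (g : cov2 M) (mu : {measure set borel -> \bar R}).
Hypotheses (rg : riemannian g) (vol : is_volume g mu).

(** In coordinates, extended by zero, [om] becomes a pair of compactly supported
    functions on the plane, and [integral_partial] applies to each. *)
Lemma stokes_chart om a (K : set M) : one_form om -> compact K -> K `<=` dom a ->
  (forall b m j, dom b m -> ~ K m -> om b m j = 0) ->
  (\int[mu]_m (curl g om m)%:E = 0)%E.
Proof.
move=> fo cK Ka supp; have [Com _] := fo.
have clK : closed K by apply: compact_closed => //; exact: carrier_hausdorff.
have off m : ~ K m -> \forall z \near m, ~ K z.
  by move=> nK; apply: open_nbhs_nbhs; split => //; exact: closed_openC.
have curl0 m : ~ K m -> curl g om m = 0.
  move=> nK; have bm := chart_atP m; rewrite /curl /ext.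
  have Z j : \forall z \near m, om (chart_at m) z j = 0.
    by apply: filterS2 (off m nK) (near_dom bm) => z nz bz; exact: supp.
  by rewrite !pd_zero_near // subrr mul0r.
have oU := @coord_dom_open _ _ a.
pose U := coord a @` dom a.
(* [om] in coordinates, extended by zero *)
pose u j (x : R * R) := if `[< U x >] then om a (param a x) j else 0.
have uE j m : dom a m -> \forall x \near coord a m, (fun x => om a (param a x) j) x = u j x.
  move=> am; have Ux : U (coord a m) by exists m.
  apply: filterS (open_nbhs_nbhs (conj oU Ux)) => x Vx.
  by rewrite /u; case: asboolP.
have cKU : compact (coord a @` K).
  apply: continuous_compact => //; apply: continuous_in_subspaceT => m; rewrite inE => Km.
  by apply: coord_continuous; exact: Ka.
have clKU : closed (coord a @` K) by apply: compact_closed => //; exact: norm_hausdorff.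
have u0 j x : ~ (coord a @` K) x -> u j x = 0.
  move=> nx; rewrite /u; case: asboolP => // -[m am E].
  by apply: supp; rewrite -E coordK // => Km; apply: nx; exists m.
have u0n j x : ~ (coord a @` K) x -> \forall y \near x, cst 0 y = u j y.
  move=> nx; have : \forall y \near x, ~ (coord a @` K) y.
    by apply: open_nbhs_nbhs; split => //; exact: closed_openC.
  by apply: filterS => y ny; rewrite u0.
have Deriv j x : (forall i, derivable (u j) x (e_ R i)) /\
    forall i, {for x, continuous (fun y => 'D_(e_ R i) (u j) y)}.
  have [[m Km <-]|nx] := pselect ((coord a @` K) x).
    have am := Ka m Km; have [df cf] := Com a m j am.
    split=> i.
      apply: near_eq_derivable (uE j m am) _; apply: diff_derivable.
      exact: nbhs_singleton df.
    have cp : {for coord a m, continuous (fun x => pd a i (fun z => om a z j) (param a x))}.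
      have cpm : {for param a (coord a m), continuous (pd a i (fun z => om a z j))}.
        by rewrite coordK //; exact: cf.
      exact: (continuous_comp (param_continuous am) cpm).
    have E : \forall x \near coord a m, pd a i (fun z => om a z j) (param a x) = 'D_(e_ R i) (u j) x.
      apply: filterS2 (near_coordK am) (near_join (uE j m am)) => y Ey Eu.
      by rewrite /pd Ey; exact: near_eq_derive Eu.
    exact: near_eq_continuous E cp.
  split=> i; first by apply: near_eq_derivable (u0n j x nx) _; exact: derivable_cst.
  have E : \forall y \near x, cst 0 y = 'D_(e_ R i) (u j) y.
    apply: filterS (near_join (u0n j x nx)) => y Ey.
    by rewrite -(near_eq_derive _ Ey) derive_cst.
  by apply: near_eq_continuous E _; exact: cvg_cst.
have [B B0 HB] : exists2 B : R, 0 < B & forall x, (coord a @` K) x -> `|x| < B.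
  have [B0 [_ HB]] := compact_bounded cKU.
  exists (`|B0| + 2) => [|x Kx]; first by rewrite ltr_wpDl.
  apply: le_lt_trans (HB (`|B0| + 1) _ x Kx) _.
    by rewrite (le_lt_trans (ler_norm _)) // ltrDl.
  by rewrite ltrD2l ltr1n.
have suppB j x : (B <= `|x.1|) || (B <= `|x.2|) -> u j x = 0.
  move=> Bx; apply: u0 => /HB; rewrite plane_normP => /andP[x1 x2].
  by move: Bx; rewrite !leNgt x1 x2.
have int0 j i := integral_partial B0 (suppB j) (fun i x => (Deriv j x).1 i) (fun i x => (Deriv j x).2 i) i.
have intg j i := partial_integrable B0 (suppB j) (fun i x => (Deriv j x).2 i) i.
transitivity (\int[mu]_(m in dom a) (curl g om m)%:E)%E.
  rewrite [RHS]integral_mkcond; apply: eq_integral => m _; rewrite patchE.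
  case: ifPn => // /negP nm; rewrite curl0 // => Km; apply: nm.
  by rewrite inE; exact: Ka.
rewrite (integral_chart (riem_continuous rg) vol (measurable_dom a) (@subset_refl _ _)); last first.
  apply: measurable_funTS; apply: measurable_fun_surface => m; exact: curl_continuous.
transitivity (\int[la2]_(x in setT) ('D_(e_ R 0) (u 1) x - 'D_(e_ R 1) (u 0) x)%:E)%E.
  rewrite [LHS]integral_mkcond; apply: eq_integral => x _; rewrite patchE.
  case: ifPn => [|/negP nx].
    rewrite inE => -[m am <-]; congr EFin; rewrite /vol_density coordK // (curlE rg fo am).
    rewrite divfK ?gt_eqF ?sqrt_det_gt0 // /ext /pd.
    by rewrite (near_eq_derive _ (uE 1 m am)) (near_eq_derive _ (uE 0 m am)).
  have nK : ~ (coord a @` K) x.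
    by move=> [m Km E]; apply: nx; rewrite inE; exists m => //; exact: Ka.
  by rewrite -(near_eq_derive _ (u0n 1 x nK)) -(near_eq_derive _ (u0n 0 x nK)) !derive_cst subrr.
under eq_integral do rewrite EFinB.
by rewrite integralB //= int0 int0 sube0.
Qed.

End Supported.

End OneForms.

Section SquaredPositivePart.
Variable R : realType.

Definition pos_part (t : R) : R := Num.max 0 t.
(** Its derivative is continuous, and one derivative is all that bumps need here. *)
Definition sq_pos (t : R) : R := pos_part t ^+ 2.

Lemma pos_partP (t : R) : (0 <= t /\ pos_part t = t) \/ (t <= 0 /\ pos_part t = 0).
Proof.
rewrite /pos_part; have [t0|/ltW t0] := leP 0 t; [left|right]; split => //.
Qed.

Lemma sq_pos_taylor (t h : R) : `|sq_pos (h + t) - (sq_pos t + 2 * pos_part t * h)| <= h ^+ 2.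
Proof.
rewrite /sq_pos ler_norml.
by have [[t0 ->]|[t0 ->]] := pos_partP t; have [[s0 ->]|[s0 ->]] := pos_partP (h + t);
  apply/andP; split; nra.
Qed.

Lemma sq_pos_derive (t : R) : differentiable sq_pos t /\ 'D_1 sq_pos t = 2 * pos_part t.
Proof.
pose L (h : R) : R := (2 * pos_part t) * h.
have linL : linear L by move=> a x y; rewrite /L /GRing.scale /=; ring.
pose HL := GRing.isLinear.Build _ _ _ _ _ linL.
pose LL : {linear R -> R} := HB.pack L HL.
have cL : continuous LL by move=> h; apply: cvgM; [exact: cvg_cst|exact: cvg_id].
have A e : 0 < e -> \forall h \near (0 : R), `|sq_pos (h + t) - (sq_pos t + LL h)| <= e * `|h|.
  move=> e0; apply/nbhs_normP; exists e => //= h; rewrite /ball_ /= sub0r normrN => he.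
  apply: le_trans (sq_pos_taylor t h) _.
  have S (x y : R) : `|x| < y -> x ^+ 2 <= y * `|x|.
    by move=> xy; rewrite -real_normK ?num_real // expr2 ler_wpM2r // ltW.
  exact: S.
have d := differentiable_approx cL A; split => //.
have E := diff_unique cL (f := sq_pos) (x := t).
rewrite deriveE // E; first by rewrite /= /L mulr1.
by apply/eqaddoP => e e0; exact: A.
Qed.

Lemma pos_part_continuous (t : R) : {for t, continuous pos_part}.
Proof.
have -> : pos_part = fun s => (`|s| + s) / 2.
  apply/funext => s; have [[s0 ->]|[s0 ->]] := pos_partP s.
    by rewrite ger0_norm //; lra.
  by rewrite ler0_norm //; lra.
by apply: cvgM; [apply: cvgD; [exact: norm_continuous|exact: cvg_id]|exact: cvg_cst].
Qed.

End SquaredPositivePart.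

Section PartitionOfUnity.
Variables (R : realType) (M : closed_oriented_surface R).
Implicit Types (a b : chart M) (m : M) (g : cov2 M).
Local Notation borel := (g_sigma_algebraType (@open M)).

Lemma C1at_sq_pos a m (f : M -> R) : dom a m -> C1at a m f ->
  C1at a m (fun z => sq_pos (f z)).
Proof.
move=> am Cf; have cf := C1at_continuous am Cf; have [df cdf] := Cf.
have D z : dom a z -> diff_in a f z -> diff_in a (fun z => sq_pos (f z)) z /\
    forall i, pd a i (fun z => sq_pos (f z)) z = 2 * pos_part (f z) * pd a i f z.
  move=> az dz; have [d1 d2] := sq_pos_derive ((f \o param a) (coord a z)).
  have dc : differentiable (@sq_pos R \o (f \o param a)) (coord a z).
    exact: differentiable_comp.
  split=> // i; rewrite /pd (deriveE _ dc) diff_comp //.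
  have fz : (f \o param a) (coord a z) = f z by rewrite /= coordK.
  have L (l : {linear R -> R}) (s : R) : l s = l 1 * s.
    by rewrite -{1}[s]mulr1 -[s * 1]/(s *: (1 : R)) linearZ /= mulrC.
  transitivity ('d (@sq_pos R) ((f \o param a) (coord a z)) 1 *
     'd (f \o param a) (coord a z) (e_ R i)); first exact: L.
  by rewrite -(deriveE _ d1) -(deriveE _ dz) d2 fz.
split; first by apply: filterS2 (near_dom am) df => z az dz; exact: (D z az dz).1.
move=> i.
have C : {for m, continuous (fun z => 2 * pos_part (f z) * pd a i f z)}.
  apply: continuousMm; last exact: cdf.
  apply: continuousMm; first exact: continuous_cstm.
  exact: (continuous_comp cf (@pos_part_continuous _ _)).
apply: continuous_near C; apply: filterS2 (near_dom am) df => z az dz.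
by rewrite (D z az dz).2.
Qed.

Definition C1M (f : M -> R) := forall a m, dom a m -> C1at a m f.

(** A bump around a point: in a chart it is the squared positive part of
    [r^2 - |x|^2], which is continuously differentiable; the image of a closed
    square is compact, hence closed, so that extension by zero is harmless. *)
Lemma bump m0 : exists (psi : M -> R) (a : chart M) (K : set M),
  [/\ C1M psi, forall m, 0 <= psi m, 0 < psi m0, compact K /\ K `<=` dom a
    & forall m, ~ K m -> psi m = 0].
Proof.
have [a am] := dom_cover m0; pose x0 := coord a m0.
have Ux : (coord a @` dom a) x0 by exists m0.
have [r' r'0 H] := (near_ballP _ _).1 (open_nbhs_nbhs (conj (@coord_dom_open _ _ a) Ux)).
pose r := r' / 2; have r0 : 0 < r by rewrite /r divr_gt0.
pose rho (z : M) : R := r ^+ 2 + - ((crd 0 (coord a z) + - x0.1) * (crd 0 (coord a z) + - x0.1)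
    + (crd 1 (coord a z) + - x0.2) * (crd 1 (coord a z) + - x0.2)).
pose psi z := if `[< dom a z >] then sq_pos (rho z) else 0.
pose box : set (R * R) := `[x0.1 - r, x0.1 + r]%classic `*` `[x0.2 - r, x0.2 + r]%classic.
pose K := param a @` box.
have boxU : box `<=` coord a @` dom a.
  move=> y [/=]; rewrite !in_itv /= => /andP[c1 c2] /andP[d1 d2].
  have := H (y.1 - x0.1) (y.2 - x0.2); rewrite plane_step.
  rewrite ![x0.1 + _]addrC ![x0.2 + _]addrC !subrK -surjective_pairing; apply.
    by rewrite ltr_norml /r in c1 c2 *; apply/andP; split; lra.
  by rewrite ltr_norml /r in d1 d2 *; apply/andP; split; lra.
have cK : compact K.
  apply: continuous_compact; last by apply: compact_setX; exact: segment_compact.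
  apply: continuous_in_subspaceT => x; rewrite inE => /boxU [z az <-].
  exact: param_continuous.
have Ka : K `<=` dom a by move=> _ [x /boxU [z az <-] <-]; rewrite coordK.
have psiK z : ~ K z -> psi z = 0.
  move=> nK; rewrite /psi; case: asboolP => // az.
  rewrite /sq_pos; have [[rz _]|[_ ->]] := pos_partP (rho z); last by rewrite expr0n.
  exfalso; apply: nK; exists (coord a z); last by rewrite coordK.
  have sq (x c : R) : (x + - c) * (x + - c) <= r ^+ 2 -> c - r <= x <= c + r.
    move=> Q; have : `|x - c| <= r by rewrite -(ler_pXn2r (n := 2)) ?nnegrE ?(ltW r0) // real_normK ?num_real // expr2.
    by rewrite ler_norml => /andP[q1 q2]; apply/andP; split; lra.
  have p1 : 0 <= (crd 0 (coord a z) + - x0.1) * (crd 0 (coord a z) + - x0.1) by rewrite -expr2 sqr_ge0.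
  have p2 : 0 <= (crd 1 (coord a z) + - x0.2) * (crd 1 (coord a z) + - x0.2) by rewrite -expr2 sqr_ge0.
  rewrite /rho in rz.
  by split; rewrite /= in_itv /=; [apply: (sq (crd 0 (coord a z)))|apply: (sq (crd 1 (coord a z)))]; lra.
have Crho z : dom a z -> C1at a z rho.
  move=> az.
  have Ck k (c : R) : C1at a z (fun y => crd k (coord a y) + - c).
    apply: C1atD; last exact: C1at_cst.
    exact: (smooth_C1at (dom_open a) az az (smooth_in_trans a a k)).
  apply: C1atD; first exact: C1at_cst.
  by apply: C1atN; apply: C1atD; apply: C1atM => //; exact: Ck.
exists psi, a, K; split.
- move=> b z bz; have [az|naz] := pselect (dom a z).
    apply: (C1at_chart bz az); apply: (C1at_near az _ (C1at_sq_pos az (Crho z az))).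
    by apply: filterS (near_dom az) => y ay; rewrite /psi; case: asboolP.
  have nK : ~ K z by move=> /Ka.
  have clK : closed K by apply: compact_closed => //; exact: carrier_hausdorff.
  apply: (C1at_near bz _ (C1at_cst b z 0)).
  have : \forall y \near z, ~ K y by apply: open_nbhs_nbhs; split => //; exact: closed_openC.
  by apply: filterS => y nKy; rewrite psiK.
- by move=> z; rewrite /psi; case: asboolP => // _; rewrite /sq_pos sqr_ge0.
- rewrite /psi; case: asboolP => // _.
  have -> : rho m0 = r ^+ 2 by rewrite /rho /x0 /crd /= !subrr !mul0r addr0 subr0.
  have [[_ E]|[E _]] := pos_partP (r ^+ 2).
    by rewrite /sq_pos E !exprn_gt0.
  by have := exprn_gt0 2 r0; rewrite ltNge E.
- by [].
- exact: psiK.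
Qed.

(** Finitely many bumps have a positive sum, by which they are divided. *)
Lemma partition_of_unity : exists (n : nat) (phi : 'I_n -> M -> R)
    (a : 'I_n -> chart M) (K : 'I_n -> set M),
  [/\ forall i, C1M (phi i), forall i, compact (K i) /\ K i `<=` dom (a i),
      forall i m, ~ K i m -> phi i m = 0 & forall m, \sum_(i < n) phi i m = 1].
Proof.
pose psi m := projT1 (cid (bump m)).
have psiP m := projT2 (cid (bump m)).
pose a m := projT1 (cid (psiP m)); have aP m := projT2 (cid (psiP m)).
pose K m := projT1 (cid (aP m)); have KP m := projT2 (cid (aP m)).
have {}KP m : [/\ C1M (psi m), forall z, 0 <= psi m z, 0 < psi m m,
   compact (K m) /\ K m `<=` dom (a m) & forall z, ~ K m z -> psi m z = 0] by exact: KP.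
have cpsi m z : {for z, continuous (psi m)}.
  by have [b bz] := dom_cover z; have [C _ _ _ _] := KP m; exact: C1at_continuous bz (C b z bz).
have cpt := @carrier_compact _ M; rewrite compact_cover in cpt.
have := cpt; move=> /(_ _ setT (fun m => psi m @^-1` [set t | 0 < t])) [m _|m _|D _ cov].
- rewrite openE => z /= pz.
  exact: (near_preimage (P := fun t : R => 0 < t) (cpsi m z) (lt_nbhsr pz)).
- by exists m => //; have [_ _ ? _ _] := KP m.
pose s := finmap.enum_fset D.
pose n := size s; pose pt (i : 'I_n) := tnth (in_tuple s) i.
pose Psi z := \sum_(i < n) psi (pt i) z.
have Psi0 z : 0 < Psi z.
  have [m /= mD mz] := cov z I.
  have ms : m \in in_tuple s by exact: mD.
  have /tnthP[i Ei] := ms.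
  rewrite /Psi (bigD1 i) //= ltr_pwDl //; first by rewrite /pt -Ei.
  by apply: sumr_ge0 => j _; have [_ + _ _ _] := KP (pt j).
have Cpsi m : C1M (psi m) by case: (KP m).
have CPsi : C1M Psi.
  by move=> b z bz; apply: C1at_sum => i; exact: (Cpsi (pt i) b z bz).
exists n, (fun i z => psi (pt i) z * (Psi z)^-1), (fun i => a (pt i)), (fun i => K (pt i)); split.
- move=> i b z bz; apply: C1atM => //; first exact: (Cpsi (pt i) b z bz).
  by apply: C1atV => //; [rewrite gt_eqF|exact: CPsi].
- by move=> i; have [_ _ _ cK _] := KP (pt i); exact: cK.
- by move=> i z nK; have [_ _ _ _ E] := KP (pt i); rewrite E // mul0r.
- move=> z; rewrite -mulr_suml; apply: mulfV; apply: lt0r_neq0; exact: Psi0.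
Qed.

Lemma continuous_integrable (mu : {measure set borel -> \bar R}) (f : M -> R) :
  (mu setT < +oo)%E -> (forall m, {for m, continuous f}) ->
  mu.-integrable setT (EFin \o f).
Proof.
move=> fin cf; apply: measurable_bounded_integrable => //.
  exact: measurable_fun_surface.
have cF : {within (setT : set M), continuous f}.
  by apply: continuous_subspaceT => x; exact: cf.
have [B [_ HB]] := compact_bounded (continuous_compact cF (@carrier_compact _ M)).
exists B; split; rewrite ?num_real // => k Bk x _.
by apply: HB => //; exists x.
Qed.

(** The partition of unity decomposes [om] into forms supported in charts, to
    which [stokes_chart] applies. *)
Theorem stokes g (mu : {measure set borel -> \bar R}) om :
  riemannian g -> is_volume g mu -> one_form om ->
  (\int[mu]_m (curl g om m)%:E = 0)%E.
Proof.
move=> rg vol fo; have fin := volume_finite (riem_continuous rg) vol.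
have [n [phi [a [K [Cphi cK supp one]]]]] := partition_of_unity.
pose omi i b z j := phi i z * om b z j.
have [Com law] := fo.
have foi i : one_form (omi i).
  split; first by move=> b z j bz; apply: C1atM => //; [exact: Cphi|exact: Com].
  move=> b c z bz cz j; rewrite /omi (law b c) // mulr_sumr.
  by apply: eq_bigr => p _; rewrite mulrCA.
have E m : curl g om m = \sum_(i < n) curl g (omi i) m.
  have am := chart_atP m; rewrite /curl -mulr_suml; congr (_ * _).
  have X k j : pd (chart_at m) k (fun z => om (chart_at m) z j) m =
      \sum_(i < n) pd (chart_at m) k (fun z => omi i (chart_at m) z j) m.
    rewrite -pd_sum; last by move=> i; exact: C1at_diff ((foi i).1 _ _ j am).
    by apply: pd_ext => z; rewrite /omi -mulr_suml one mul1r.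
  by rewrite /ext !X -sumrB.
under eq_integral do rewrite E -sumEFin.
rewrite integral_sum //; last first.
  move=> i; apply: continuous_integrable => // m; exact: curl_continuous.
apply: big1 => i _; have [cKi Ki] := cK i.
apply: (stokes_chart rg vol (foi i) cKi Ki) => b m j bm nK.
by rewrite /omi supp // mul0r.
Qed.

End PartitionOfUnity.

(** * The flux of the cubic differential *)

Section BlaschkeFlux.
Variables (R : realType) (M : closed_oriented_surface R) (g : cov2 M) (C : comp3C M).
Hypotheses (riem : riemannian g) (hol : holomorphic_cubic_differential g C).
Implicit Types (a b : chart M) (m : M) (h : cov2 M).
Local Notation borel := (g_sigma_algebraType (@open M)).

Lemma alpha_raise a m : alpha g C a m = raise (g a m) (re_cubic C a m).
Proof. by []. Qed.

Lemma alpha_law a b m : dom a m -> dom b m ->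
  pull12 (jac b a m) (alpha g C b m) (alpha g C a m).
Proof.
move=> am bm; have [[_ _ law] _] := riem.
rewrite !alpha_raise (law a b) // (re_cubic_pull hol am bm).
apply: pull12_raise; [exact: jac_unit|exact: riem_unit].
Qed.

(** The Christoffel symbols inherit the inhomogeneous law from the connection
    [levi_civita g + alpha g C], since [alpha g C] is a tensor. *)
Lemma levi_civita_law :
  torsionfree_connection (fun a m i j k => levi_civita g a m i j k + alpha g C a m i j k) ->
  connection_law (levi_civita g).
Proof.
move=> [_ _ law] a b m am bm n j k.
have := law a b m am bm n j k; have := alpha_law am bm n j k.
rewrite !sum2 => A L.
have {L} L := L.
apply: (addIr (jac b a m n 0 * alpha g C a m 0 j k + jac b a m n 1 * alpha g C a m 1 j k)).
rewrite {2}A; move: L; rewrite !mulrDr !mulrDl => L.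
transitivity (jac b a m n 0 * levi_civita g a m 0 j k + jac b a m n 0 * alpha g C a m 0 j k +
  (jac b a m n 1 * levi_civita g a m 1 j k + jac b a m n 1 * alpha g C a m 1 j k)).
  by rewrite addrACA.
rewrite L; move: (pd _ _ _ _) => d; ring.
Qed.

Lemma flux_one_form h : sym2_field h -> one_form (flux_form g C h).
Proof.
move=> sh; split=> [a m j am|a b m am bm j].
  apply: C1at_sum => k; apply: C1at_sum => l; apply: C1atM => //.
    by have [_] := cubic_C1 hol j k l am.
  have E : (fun z => (invmx (g a z) *m h a z *m invmx (g a z)) k l) =
    fun z => \sum_(q < 2) (\sum_(p < 2) invmx (g a z) k p * h a z p q) * invmx (g a z) q l.
    by apply/funext => z; rewrite mxE; apply: eq_bigr => q _; rewrite mxE.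
  rewrite E; apply: C1at_sum => q; apply: C1atM => //; last exact: C1at_inv.
  by apply: C1at_sum => p; apply: C1atM => //; [exact: C1at_inv|exact: sym2_C1].
have [[_ _ lawg] _] := riem; have [_ _ lawh] := sh.
have uJ := jac_unit am bm; have ug := riem_unit riem bm.
have uJT : (jac b a m)^T \in unitmx by rewrite unitmx_tr.
have Hb : invmx (g b m) *m h b m *m invmx (g b m) =
    jac b a m *m (invmx (g a m) *m h a m *m invmx (g a m)) *m (jac b a m)^T.
  rewrite (lawg a b) // (lawh a b) // !invmxM ?unitmx_mul ?uJT ?ug //.
  by rewrite !mulmxA mulmxV // mul1mx mulmxKV // mulmxK // mulmxKV.
rewrite /flux_form Hb (im_cubic_pull hol am bm) /pull3.
set J := jac b a m; set H := _ *m h a m *m _; set T := im_cubic C b m.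
move: J H T => J H T; clear; rewrite !sum2 !mxE ?sum2 ?mxE ?sum2 ?mxE; ring.
Qed.

End BlaschkeFlux.

(** * The first variation of the energy density *)

Section ParametrisedDerivative.
Variables (R : realType) (X : topologicalType).
Implicit Types (x : X) (p : X * R) (u v : X * R -> R).

(** Differentiability in the parameter, at parameters close to 0, with a
    derivative that is jointly continuous: this is what makes first order
    expansions uniform on compact sets. *)
Definition C1par x u := exists u' : X * R -> R, \forall p \near (x, 0 : R),
  [/\ is_derive p.2 (1 : R) (fun t => u (p.1, t)) (u' p), {for p, continuous u}
    & {for p, continuous u'}].

Lemma C1par_continuous x u : C1par x u -> {for (x, 0 : R), continuous u}.
Proof. by move=> [u' H]; have [] := nbhs_singleton H. Qed.

Lemma C1par_const x (f : X -> R) : (\forall y \near x, {for y, continuous f}) ->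
  C1par x (fun p => f p.1).
Proof.
move=> cf; exists (fun=> 0).
have N : \forall p \near (x, 0 : R), {for p.1, continuous f}.
  have c1 : {for (x, 0 : R), continuous (@fst X R)} by exact: cvg_fst.
  exact: (near_preimage (P := fun y => {for y, continuous f}) c1).
apply: filterS N => p cfp; split; first exact: (is_derive_cst (f p.1) p.2 (1 : R)).
  by apply: (continuous_comp _ cfp); exact: cvg_fst.
exact: cvg_cst.
Qed.

Lemma C1par_cst x (c : R) : C1par x (fun=> c).
Proof. by apply: (@C1par_const x (fun=> c)); apply: nearW => y; exact: cvg_cst. Qed.

Lemma C1par_time x : C1par x (fun p => p.2).
Proof.
exists (fun=> 1); have T : \forall p \near (x, 0 : R), True by exact: filterT.
apply: filterS T => p _; split; first exact: is_derive_id.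
  exact: cvg_snd.
exact: cvg_cst.
Qed.

Lemma C1parD x u v : C1par x u -> C1par x v -> C1par x (fun p => u p + v p).
Proof.
move=> [u' Hu] [v' Hv]; exists (fun p => u' p + v' p).
apply: filterS2 Hu Hv => p [du cu cu'] [dv cv cv']; split; first exact: is_deriveD.
  exact: cvgD.
exact: cvgD.
Qed.

Lemma C1parM x u v : C1par x u -> C1par x v -> C1par x (fun p => u p * v p).
Proof.
move=> [u' Hu] [v' Hv]; exists (fun p => u p * v' p + v p * u' p).
apply: filterS2 Hu Hv => -[y t] [du cu cu'] [dv cv cv']; split.
- exact: (is_deriveM du dv).
- exact: cvgM.
- by apply: cvgD; exact: cvgM.
Qed.

Lemma C1parN x u : C1par x u -> C1par x (fun p => - u p).
Proof.
move=> Hu; have -> : (fun p => - u p) = fun p => (-1) * u p by apply/funext => p; rewrite mulN1r.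
by apply: C1parM => //; exact: C1par_cst.
Qed.

Lemma C1parV x u : u (x, 0) != 0 -> C1par x u -> C1par x (fun p => (u p)^-1).
Proof.
move=> u0 Hu; have cu0 := C1par_continuous Hu.
have N : \forall p \near (x, 0 : R), u p != 0.
  apply: (near_preimage (P := fun y : R => y != 0) cu0).
  by apply: open_nbhs_nbhs; split; [exact: open_neq|exact: u0].
have [u' {}Hu] := Hu; exists (fun p => - ((u p)^-1 * (u p)^-1) * u' p).
apply: filterS2 N Hu => -[y t] up [du cu cu']; split.
- have -> : - ((u (y, t))^-1 * (u (y, t))^-1) * u' (y, t) =
      - (u (y, t)) ^- 2 *: u' (y, t) by rewrite -expr2 exprVn.
  exact: (is_deriveV up du).
- exact: cvgV.
- by apply: cvgM => //; apply: cvgN; apply: cvgM; exact: cvgV.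
Qed.

Lemma C1par_sqrt x u : 0 < u (x, 0) -> C1par x u -> C1par x (fun p => Num.sqrt (u p)).
Proof.
move=> u0 Hu; have cu0 := C1par_continuous Hu.
have N : \forall p \near (x, 0 : R), 0 < u p.
  exact: (near_preimage (P := fun y : R => 0 < y) cu0 (lt_nbhsr u0)).
have [u' {}Hu] := Hu; exists (fun p => u' p * (2 * Num.sqrt (u p))^-1).
apply: filterS2 N Hu => -[y t] up [du cu cu'].
have cs : {for (y, t), continuous (fun p => Num.sqrt (u p))} by exact: sqrt_continuous_at.
split => //.
- rewrite mulrC; exact: (is_derive1_comp (is_derive1_sqrt up) du).
- apply: cvgM => //; apply: cvgV; last by apply: cvgM => //; exact: cvg_cst.
  by rewrite mulf_neq0 // ?pnatr_eq0 // gt_eqF // sqrtr_gt0.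
Qed.

Lemma C1par_sum x (I : Type) (r : seq I) (F : I -> X * R -> R) :
  (forall i, C1par x (F i)) -> C1par x (fun p => \sum_(i <- r) F i p).
Proof.
move=> cF; elim: r => [|i r IH].
  under [X in C1par _ X]funext do rewrite big_nil; exact: C1par_cst.
by under [X in C1par _ X]funext do rewrite big_cons; exact: C1parD.
Qed.

Lemma C1par_slice x u : C1par x u ->
  \forall p \near (x, 0 : R), {for p.1, continuous (fun z => u (z, p.2))}.
Proof.
move=> [u' H]; apply: filterS H => -[y t] [_ cu _].
have cp : {for y, continuous (fun z : X => (z, t))}.
  exact: (@cvg_pair _ _ _ (nbhs y) (nbhs y) (nbhs t) _ _ _ id (fun=> t) cvg_id (cvg_cst t)).
exact: (continuous_comp cp cu).
Qed.

(** By the mean value theorem the remainder is [t] times the oscillation of the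
    derivative, which is small near [(x, 0)] by joint continuity. *)
Lemma C1par_uniform x u (e : R) : 0 < e -> C1par x u ->
  \forall p \near (x, 0 : R),
    `|u p - u (p.1, 0) - p.2 * 'D_1 (fun s => u (p.1, s)) 0| <= e * `|p.2|.
Proof.
move=> e0 [u' H]; have [_ _ cu'] := nbhs_singleton H.
have e2 : 0 < e / 2 by rewrite divr_gt0.
have N : \forall p \near (x, 0 : R), `|u' (x, 0) - u' p| < e / 2.
  by have := cu'; move/cvgr_dist_lt => /(_ _ e2).
have [[A B] [/= Ax B0] AB] := filterI H N.
have [d /= d0 dB] := (nbhs_normP _ _).1 B0.
exists (A, ball_ Num.norm (0 : R) d) => /=.
  by split=> //; apply/nbhs_normP; exists d.
move=> [y t] [/= Ay td] /=.
have good (s : R) : `|s| <= `|t| -> is_derive s (1 : R) (fun t => u (y, t)) (u' (y, s)) /\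
    `|u' (x, 0) - u' (y, s)| < e / 2.
  move=> st; have [|[ds _ _] ns] := AB (y, s); last by split.
  split=> //; apply: dB; rewrite /ball_ /= sub0r normrN.
  by apply: le_lt_trans st _; move: td; rewrite /ball_ /= sub0r normrN.
have [s st ->] := MVT0 (fun s st => (good s st).1).
have [d0' n0] : is_derive (0 : R) (1 : R) (fun t => u (y, t)) (u' (y, 0)) /\
    `|u' (x, 0) - u' (y, 0)| < e / 2 by apply: good; rewrite normr0.
have -> : 'D_1 (fun s => u (y, s)) 0 = u' (y, 0) by exact: derive_val.
have [_ ns] := good s st.
have alg (a b c r : R) : `|c - a| < e / 2 -> `|c - b| < e / 2 ->
    `|a * r - r * b| <= e * `|r|.
  move=> ca cb; have -> : a * r - r * b = (a - b) * r by ring.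
  rewrite normrM ler_wpM2r //; have -> : a - b = (c - b) - (c - a) by ring.
  by apply: le_trans (ler_normB _ _) _; lra.
exact: alg ns n0.
Qed.

End ParametrisedDerivative.

Section EnergyDensity.
Variable R : realType.
Implicit Types (g h P : 'M[R]_2) (F T A S : ten3 R).

(** The cofactor formula, which exhibits the inverse as a differentiable function of
    the entries. *)
Definition adj_inv (A : 'M[R]_2) : 'M[R]_2 :=
  \matrix_(i, j) ((\det A)^-1 * (if i == 0 then if j == 0 then A 1 1 else - A 0 1
                                 else if j == 0 then - A 1 0 else A 0 0)).

Definition moving_tensor (inv : 'M[R]_2 -> 'M[R]_2) g h A T t : ten3 R :=
  trace_free (fun i j k => (\sum_(l < 2) inv g i l * A l j k)
     - t * \sum_(l < 2) inv (g + t *: h) i l * christoffel_change T l j k).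

(** The integrand of the energy of [g + t *: h] relative to the area measure of
    [g], when the trace-free difference tensor at [g] is [A] with an index
    raised and [T] is the covariant derivative of [h].  The inversion map is a
    parameter so that the cofactor formula can be substituted. *)
Definition density inv g h A T t : R :=
  contraction (inv (g + t *: h)) (g + t *: h) (moving_tensor inv g h A T t)
  * (Num.sqrt (\det (g + t *: h)) / Num.sqrt (\det g)).

Lemma contraction_adj g h A T t : \det g != 0 -> \det (g + t *: h) != 0 ->
  contraction (invmx (g + t *: h)) (g + t *: h) (moving_tensor invmx g h A T t) =
  contraction (adj_inv (g + t *: h)) (g + t *: h) (moving_tensor adj_inv g h A T t).
Proof. by move=> d dt; rewrite /moving_tensor (inv2 d) (inv2 dt). Qed.

Lemma density_adj g h A T t : \det g != 0 -> \det (g + t *: h) != 0 ->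
  density invmx g h A T t = density adj_inv g h A T t.
Proof. by move=> d dt; rewrite /density contraction_adj. Qed.

Lemma christoffel_change_pull P T :
  christoffel_change (pull3 P T) = pull3 P (christoffel_change T).
Proof.
apply/funext => i; apply/funext => j; apply/funext => k.
rewrite /christoffel_change /pull3 !sum2; ring.
Qed.

Lemma pull12_subZ P F F' S S' t : pull12 P F F' -> pull12 P S S' ->
  pull12 P (fun i j k => F i j k - t * S i j k) (fun i j k => F' i j k - t * S' i j k).
Proof.
move=> HF HS n j k; move: (HF n j k) (HS n j k); rewrite !sum2 => E1 E2.
transitivity (P n 0 * F' 0 j k + P n 1 * F' 1 j k - t * (P n 0 * S' 0 j k + P n 1 * S' 1 j k)).
  by ring.
by rewrite E1 E2; ring.
Qed.

Lemma shift_pull P g h t :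
  P^T *m g *m P + t *: (P^T *m h *m P) = P^T *m (g + t *: h) *m P.
Proof. by rewrite mulmxDr mulmxDl -scalemxAr -scalemxAl. Qed.

(** All ingredients are tensors, so the integrand can be computed in any frame:
    the coordinate frames of two charts, which makes it a function on the
    surface, or an orthonormal frame, in which its derivative is simple. *)
Lemma contraction_pull P g h A T t : P \in unitmx -> g \in unitmx -> g + t *: h \in unitmx ->
  let g' := P^T *m g *m P in let h' := P^T *m h *m P in
  contraction (invmx (g' + t *: h')) (g' + t *: h')
    (moving_tensor invmx g' h' (pull3 P A) (pull3 P T) t) =
  contraction (invmx (g + t *: h)) (g + t *: h) (moving_tensor invmx g h A T t).
Proof.
move=> uP ug ut /=; rewrite /moving_tensor !shift_pull.
apply: norm2_pull => //; apply: pull12_trace_free => //; apply: pull12_subZ.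
  exact: pull12_raise.
by rewrite christoffel_change_pull; exact: pull12_raise.
Qed.

Lemma density_pull P g h A T t : P \in unitmx -> g \in unitmx -> g + t *: h \in unitmx ->
  density invmx (P^T *m g *m P) (P^T *m h *m P) (pull3 P A) (pull3 P T) t =
  density invmx g h A T t.
Proof.
move=> uP ug ut; rewrite /density contraction_pull //; congr (_ * _).
rewrite shift_pull.
rewrite !det_mulmx det_tr.
have alg (x y : R) : Num.sqrt (x * y * x) = `|x| * Num.sqrt y.
  by rewrite mulrAC -expr2 sqrtrM ?sqr_ge0 // sqrtr_sqr.
rewrite !alg invfM mulrACA mulfV ?mul1r //.
by rewrite normr_eq0 -unitfE -unitmxE.
Qed.

(** Gram-Schmidt: the second vector is a multiple of [- g 0 1 e_0 + g 0 0 e_1],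
    which is orthogonal to the first basis vector [e_0]. *)
Lemma orthonormal_frame g : 0 < g 0 0 -> 0 < \det g -> g 1 0 = g 0 1 ->
  exists2 P, P \in unitmx & P^T *m g *m P = 1%:M.
Proof.
move=> g0 d0 gs; pose r := Num.sqrt (g 0 0); pose s := Num.sqrt (\det g).
have r0 : r != 0 by rewrite gt_eqF // sqrtr_gt0.
have s0 : s != 0 by rewrite gt_eqF // sqrtr_gt0.
have r2 : g 0 0 = r * r by rewrite -expr2 sqr_sqrtr // ltW.
have s2 : \det g = s * s by rewrite -expr2 sqr_sqrtr // ltW.
pose P : 'M[R]_2 := \matrix_(i, j) (if i == 0 then if j == 0 then r^-1 else - g 0 1 / (r * s)
   else if j == 0 then 0 else r / s).
have E : P^T *m g *m P = 1%:M.
  have E11 : g 1 1 = (s * s + g 0 1 * g 0 1) / (r * r).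
    rewrite -s2 det2 gs r2 subrK [r * r * _]mulrC mulfK //; exact: mulf_neq0.
  apply/matrixP; do 2![apply: ord2P]; rewrite !mxE !sum2 !mxE !sum2 !mxE /= gs ?E11 ?r2;
    by field; rewrite ?r0 ?s0.
exists P => //; rewrite det_unit //; apply/eqP => dP.
have := congr1 determinant E; rewrite det_mulmx dP mulr0 det1 => /eqP.
by rewrite eq_sym oner_eq0.
Qed.

End EnergyDensity.

Section DensityDerivative.
Variable R : realType.
Implicit Types (u v : R -> R) (h : 'M[R]_2) (A T : ten3 R).

(** The value and the derivative of [u] at 0. *)
Definition jet u (u0 u1 : R) := is_derive (0 : R) (1 : R) u u1 /\ u 0 = u0.

Lemma jet_cst (c : R) : jet (fun=> c) c 0.
Proof. by split => //; exact: is_derive_cst. Qed.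

Lemma jet_id : jet id 0 1.
Proof. by split => //; exact: is_derive_id. Qed.

Lemma jetD u v (u0 u1 v0 v1 : R) : jet u u0 u1 -> jet v v0 v1 ->
  jet (fun t => u t + v t) (u0 + v0) (u1 + v1).
Proof. by move=> [du <-] [dv <-]; split => //; exact: is_deriveD. Qed.

Lemma jetN u (u0 u1 : R) : jet u u0 u1 -> jet (fun t => - u t) (- u0) (- u1).
Proof. by move=> [du <-]; split => //; exact: is_deriveN. Qed.

Lemma jetM u v (u0 u1 v0 v1 : R) : jet u u0 u1 -> jet v v0 v1 ->
  jet (fun t => u t * v t) (u0 * v0) (u0 * v1 + v0 * u1).
Proof. by move=> [du <-] [dv <-]; split => //; exact: (is_deriveM du dv). Qed.

Lemma jetV u (u1 : R) : jet u 1 u1 -> jet (fun t => (u t)^-1) 1 (- u1).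
Proof.
move=> [du u0]; have n0 : u 0 != 0 by rewrite u0 oner_neq0.
split; last by rewrite u0 invr1.
have := is_deriveV n0 du; rewrite u0 expr1n invr1 => H.
by apply: is_derive_eq H _; rewrite scaleN1r.
Qed.

Lemma jet_sqrt u (u1 : R) : jet u 1 u1 -> jet (fun t => Num.sqrt (u t)) 1 (2^-1 * u1).
Proof.
move=> [du u0]; have p0 : 0 < u 0 by rewrite u0.
split; last by rewrite u0 sqrtr1.
have := is_derive1_comp (is_derive1_sqrt p0) du.
by rewrite u0 sqrtr1 mulr1 mulrC.
Qed.

Lemma jet_sum (F : 'I_2 -> R -> R) (F0 F1 : 'I_2 -> R) : (forall i, jet (F i) (F0 i) (F1 i)) ->
  jet (fun t => \sum_(i < 2) F i t) (\sum_(i < 2) F0 i) (\sum_(i < 2) F1 i).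
Proof.
move=> H; rewrite !sum2; have -> : (fun t => \sum_(i < 2) F i t) = fun t => F 0 t + F 1 t.
  by apply/funext => t; rewrite sum2.
exact: jetD.
Qed.

Lemma jet_eq u (u0 u1 w0 w1 : R) : jet u u0 u1 -> u0 = w0 -> u1 = w1 -> jet u w0 w1.
Proof. by move=> ? <- <-. Qed.

Lemma jet_metric h i j : jet (fun t => (1%:M + t *: h) i j) (i == j)%:R (h i j).
Proof.
have -> : (fun t => (1%:M + t *: h) i j) = fun t : R => (i == j)%:R + t * h i j.
  by apply/funext => t; rewrite !mxE.
apply: jet_eq (jetD (jet_cst _) (jetM jet_id (jet_cst _))) _ _; ring.
Qed.

Lemma jet_det h : jet (fun t => \det (1%:M + t *: h)) 1 (h 0 0 + h 1 1).
Proof.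
have -> : (fun t => \det (1%:M + t *: h)) = fun t => (1%:M + t *: h) 0 0 * (1%:M + t *: h) 1 1
   + - ((1%:M + t *: h) 0 1 * (1%:M + t *: h) 1 0).
  by apply/funext => t; rewrite det2.
apply: jet_eq (jetD (jetM (jet_metric h 0 0) (jet_metric h 1 1))
  (jetN (jetM (jet_metric h 0 1) (jet_metric h 1 0)))) _ _ => /=; ring.
Qed.

Lemma jet_inv h i j : h 1 0 = h 0 1 ->
  jet (fun t => adj_inv (1%:M + t *: h) i j) (i == j)%:R (- h i j).
Proof.
move=> hs; have D := jetV (jet_det h).
have E : (fun t => adj_inv (1%:M + t *: h) i j) = fun t => (\det (1%:M + t *: h))^-1 *
   (if i == 0 then if j == 0 then (1%:M + t *: h) 1 1 else - (1%:M + t *: h) 0 1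
    else if j == 0 then - (1%:M + t *: h) 1 0 else (1%:M + t *: h) 0 0).
  by apply/funext => t; rewrite mxE.
rewrite E; clear E; move: i j; do 2![apply: ord2P] => /=.
- by apply: jet_eq (jetM D (jet_metric h 1 1)) _ _ => /=; ring.
- by apply: jet_eq (jetM D (jetN (jet_metric h 0 1))) _ _ => /=; ring.
- by apply: jet_eq (jetM D (jetN (jet_metric h 1 0))) _ _ => /=; ring.
- by apply: jet_eq (jetM D (jet_metric h 0 0)) _ _ => /=; ring.
Qed.

Lemma adj_inv1 : adj_inv 1%:M = 1%:M :> 'M[R]_2.
Proof. by apply/matrixP => i j; rewrite /adj_inv -inv2 ?det1 ?oner_neq0 // invmx1. Qed.

Lemma sum_delta (v : 'I_2 -> R) i : \sum_(l < 2) (1%:M : 'M[R]_2) i l * v l = v i.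
Proof. by rewrite sum2; move: i; apply: ord2P; rewrite !mxE /=; ring. Qed.

(** The change of the Levi-Civita connection carries a factor [t], so the variation
    of the inverse metric does not contribute to first order. *)
Lemma jet_moving h A T i j k : h 1 0 = h 0 1 ->
  (forall k, \sum_(l < 2) A l k l = 0) ->
  jet (fun t => moving_tensor (@adj_inv R) 1%:M h A T t i j k) (A i j k)
    (- trace_free (christoffel_change T) i j k).
Proof.
move=> hs tr; set X := christoffel_change T.
pose B t i j k := \sum_(l < 2) adj_inv (1%:M + t *: h) i l * X l j k.
have JB i' j' k' : exists b, jet (fun t => B t i' j' k') (X i' j' k') b.
  eexists; apply: jet_eq; [|..].
    apply: jet_sum => l; apply: jetM; first exact: jet_inv.
    exact: jet_cst.
  - by rewrite sum2; move: i'; apply: ord2P => /=; ring.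
  - by [].
have J i' j' k' : jet (fun t => A i' j' k' + - (t * B t i' j' k')) (A i' j' k') (- X i' j' k').
  have [b Jb] := JB i' j' k'.
  by apply: jet_eq (jetD (jet_cst _) (jetN (jetM jet_id Jb))) _ _; ring.
have E : (fun t => moving_tensor (@adj_inv R) 1%:M h A T t i j k) = fun t =>
    (A i j k + - (t * B t i j k)) + - (3^-1 * ((i == j)%:R * \sum_(l < 2) (A l k l + - (t * B t l k l))
      + (i == k)%:R * \sum_(l < 2) (A l j l + - (t * B t l j l)))).
  apply/funext => t; rewrite /moving_tensor adj_inv1.
  have -> : (fun i j k => \sum_(l < 2) (1%:M : 'M[R]_2) i l * A l j k -
      t * \sum_(l < 2) adj_inv (1%:M + t *: h) i l * christoffel_change T l j k) =
      fun i j k => A i j k + - (t * B t i j k).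
    by do 3![apply/funext => ?]; rewrite sum_delta.
  by [].
rewrite E; apply: jet_eq.
- apply: jetD; first exact: J.
  apply: jetN; apply: jetM; first exact: jet_cst.
  by apply: jetD; apply: jetM; [exact: jet_cst|apply: jet_sum => l; exact: J
    |exact: jet_cst|apply: jet_sum => l; exact: J].
- by rewrite !tr; ring.
rewrite /trace_free !tr !sumrN; ring.
Qed.

End DensityDerivative.

Section FirstVariation.
Variable R : realType.
Implicit Types (g h P : 'M[R]_2) (A T : ten3 R).

Definition symmetric3 A := forall i j k, A i j k = A j i k /\ A i j k = A i k j.

Lemma contractionE (gi g : 'M[R]_2) A : contraction gi g A =
  \sum_(i < 2) \sum_(j < 2) \sum_(k < 2) A i j k *
    \sum_(a < 2) g i a * \sum_(b < 2) gi j b * \sum_(c < 2) gi k c * A a b c.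
Proof.
apply: eq_bigr => i _; apply: eq_bigr => j _; apply: eq_bigr => k _.
rewrite mulr_sumr; apply: eq_bigr => a _; rewrite mulrA mulr_sumr.
apply: eq_bigr => b _; rewrite mulrA mulr_sumr; apply: eq_bigr => c _; ring.
Qed.

(** An index contracted with a metric that is the identity at [t = 0]. *)
Lemma jet_delta (G : 'I_2 -> 'I_2 -> R -> R) (H : 'I_2 -> 'I_2 -> R) (v : 'I_2 -> R -> R)
    (v0 v1 : 'I_2 -> R) i :
  (forall l, jet (G i l) (i == l)%:R (H i l)) -> (forall l, jet (v l) (v0 l) (v1 l)) ->
  jet (fun t => \sum_(l < 2) G i l t * v l t) (v0 i) (v1 i + \sum_(l < 2) H i l * v0 l).
Proof.
move=> JG Jv; apply: jet_eq (jet_sum (fun l => jetM (JG l) (Jv l))) _ _; rewrite !sum2.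
  by move: i {JG}; apply: ord2P => /=; ring.
by move: i {JG}; apply: ord2P => /=; ring.
Qed.

(** Everything is expressed in an orthonormal frame.  As [A] is symmetric and
    trace-free and the dimension is 2, the contraction of [A] with itself over
    two pairs of indices is half its squared norm times the metric.  Hence the variation of the
    metric in the norm contributes [- \tr h / 2] times the squared norm, and the
    variation of the area form contributes the opposite.  What remains comes
    from the change of the Levi-Civita connection. *)
Lemma density_jet h A T : h 1 0 = h 0 1 -> symmetric3 A ->
  (forall k, \sum_(l < 2) A l k l = 0) ->
  exists c, jet (density (@adj_inv R) 1%:M h A T) c
    (- \sum_(j < 2) \sum_(k < 2) \sum_(l < 2) T j k l * A j k l).
Proof.
move=> hs sA tr.
have Js : jet (fun t => Num.sqrt (\det (1%:M + t *: h)) / Num.sqrt (\det (1%:M : 'M[R]_2)))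
    1 (2^-1 * (h 0 0 + h 1 1)).
  apply: jet_eq (jetM (jet_sqrt (jet_det h)) (jet_cst _)) _ _; rewrite det1 sqrtr1 invr1; ring.
have E : density (@adj_inv R) 1%:M h A T = fun t => (\sum_(i < 2) \sum_(j < 2) \sum_(k < 2)
     moving_tensor (@adj_inv R) 1%:M h A T t i j k * \sum_(a < 2) (1%:M + t *: h) i a *
       \sum_(b < 2) adj_inv (1%:M + t *: h) j b * \sum_(c < 2) adj_inv (1%:M + t *: h) k c *
         moving_tensor (@adj_inv R) 1%:M h A T t a b c) *
     (Num.sqrt (\det (1%:M + t *: h)) / Num.sqrt (\det (1%:M : 'M[R]_2))).
  by apply/funext => t; rewrite /density contractionE.
have Jm i j k := jet_moving T i j k hs tr.
have Ji i j := jet_inv i j hs.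
rewrite {}E; eexists; apply: jet_eq; [|reflexivity|].
  apply: jetM; last exact: Js.
  do 3![apply: jet_sum => ?]; apply: jetM; first exact: Jm.
  apply: (jet_delta (G := fun i a t => (1%:M + t *: h) i a) (H := fun i l => h i l)); first by move=> l; exact: jet_metric.
  move=> a; apply: (jet_delta (G := fun i a t => adj_inv (1%:M + t *: h) i a) (H := fun i l => - h i l)); first by move=> l; exact: Ji.
  move=> b; apply: (jet_delta (G := fun i a t => adj_inv (1%:M + t *: h) i a) (H := fun i l => - h i l)); first by move=> l; exact: Ji.
  move=> c; exact: Jm.
have A101 : A 1 0 1 = - A 0 0 0 by have := tr 0; rewrite sum2 => /eqP; rewrite addrC addr_eq0 => /eqP.
have A111 : A 1 1 1 = - A 0 0 1.
  by have := tr 1; rewrite sum2 => /eqP; rewrite addrC addr_eq0 => /eqP ->; have [_ ->] := sA 0 1 0.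
have E : A = fun i j k => if i == 0 then if j == 0 then if k == 0 then A 0 0 0 else A 0 0 1
      else if k == 0 then A 0 0 1 else - A 0 0 0
    else if j == 0 then if k == 0 then A 0 0 1 else - A 0 0 0
      else if k == 0 then - A 0 0 0 else - A 0 0 1.
  have [_ A010] := sA 0 1 0; have [A100 _] := sA 1 0 0; have [A011 _] := sA 0 1 1; have [_ A110] := sA 1 1 0.
  apply/funext => i; apply/funext => j; apply/funext => k.
  move: i j k; do 3![apply: ord2P] => //=.
  - by rewrite A011.
  - by rewrite A100.
  - by rewrite A110.
move: (A 0 0 0) (A 0 0 1) E => x y -> {sA tr A101 A111}; rewrite /trace_free /christoffel_change !sum2 /= hs.
move: (h 0 0) (h 0 1) (h 1 1) => p q r.
move: (T 0 0 0) (T 0 0 1) (T 0 1 0) (T 0 1 1) (T 1 0 0) (T 1 0 1) (T 1 1 0) (T 1 1 1).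
by clear => *; field.
Qed.

Lemma pull3_symmetric P A : symmetric3 A -> symmetric3 (pull3 P A).
Proof.
move=> sA i j k.
have A100 : A 1 0 0 = A 0 0 1 by have [-> _] := sA 1 0 0; have [_ ->] := sA 0 1 0.
have A010 : A 0 1 0 = A 0 0 1 by have [_ ->] := sA 0 1 0.
have A101 : A 1 0 1 = A 0 1 1 by have [-> _] := sA 1 0 1.
have A110 : A 1 1 0 = A 0 1 1 by have [_ ->] := sA 1 1 0; have [-> _] := sA 1 0 1.
rewrite /pull3 !sum2 A100 A010 A101 A110; split; ring.
Qed.

Lemma pull3_trace P g A k : P \in unitmx -> g \in unitmx ->
  (forall k, \sum_(l < 2) \sum_(s < 2) invmx g l s * A s k l = 0) ->
  \sum_(l < 2) \sum_(s < 2) invmx (P^T *m g *m P) l s * pull3 P A s k l = 0.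
Proof.
move=> uP ug tr.
have H := pull12_trace uP (pull12_raise A uP ug) k.
transitivity (\sum_(l < 2) raise (P^T *m g *m P) (pull3 P A) l k l); first by [].
rewrite H; apply: big1 => q _; have -> : \sum_(l < 2) raise g A l q l = 0 by exact: tr.
by rewrite mulr0.
Qed.

(** In an orthonormal frame [P] the inverse metric is [P *m P^T]. *)
Lemma pull3_contraction P g A T : P \in unitmx -> P^T *m g *m P = 1%:M -> g \in unitmx ->
  \sum_(j < 2) \sum_(k < 2) \sum_(l < 2) pull3 P T j k l * pull3 P A j k l =
  \sum_(j < 2) \sum_(k < 2) \sum_(l < 2) T j k l * raise3 g A j k l.
Proof.
move=> uP E ug.
have gi : invmx g = P *m P^T.
  have uPT : P^T \in unitmx by rewrite unitmx_tr.
  have -> : g = invmx P^T *m invmx P by rewrite -[invmx P^T]mulmx1 -E !mulmxA mulVmx // mul1mx mulmxK.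
  by rewrite invmxM ?unitmx_inv // !invmxK.
rewrite /raise3 /pull3 gi !sum2 !mxE !sum2 !mxE.
ring.
Qed.

End FirstVariation.

Section FirstVariationInvariant.
Variable R : realType.
Implicit Types (g h P : 'M[R]_2) (A T : ten3 R).

Lemma near_det g h : \det g != 0 -> \forall t \near (0 : R), \det (g + t *: h) != 0.
Proof.
move=> d0.
have E : (fun t => \det (g + t *: h)) =
    fun t : R => (g 0 0 + t * h 0 0) * (g 1 1 + t * h 1 1) - (g 0 1 + t * h 0 1) * (g 1 0 + t * h 1 0).
  by apply/funext => t; rewrite det2 !mxE.
have c : {for (0 : R), continuous (fun t : R => \det (g + t *: h))}.
  have ce i j : (g i j + (x : R) * h i j) @[x --> (0 : R)] --> g i j + 0 * h i j.
    by apply: cvgD; [exact: cvg_cst|apply: cvgM; [exact: cvg_id|exact: cvg_cst]].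
  by rewrite E; apply: cvgB; apply: cvgM; exact: ce.
apply: (near_preimage (P := fun y : R => y != 0) c); rewrite scale0r addr0.
by apply: open_nbhs_nbhs; split; [exact: open_neq|exact: d0].
Qed.

(** Both sides are invariant under a change of frame, by [density_pull] and
    [pull3_contraction], and [density_jet] treats orthonormal frames. *)
Lemma density_first_variation g h A T :
  0 < g 0 0 -> 0 < \det g -> g 1 0 = g 0 1 -> h^T = h -> symmetric3 A ->
  (forall k, \sum_(l < 2) \sum_(s < 2) invmx g l s * A s k l = 0) ->
  'D_1 (density (@adj_inv R) g h A T) 0 =
  - \sum_(j < 2) \sum_(k < 2) \sum_(l < 2) T j k l * raise3 g A j k l.
Proof.
move=> g0 d0 gs hs sA tr; have [P uP E] := orthonormal_frame g0 d0 gs.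
have dn : \det g != 0 by rewrite gt_eqF.
have ug := det_unit dn.
have H : (P^T *m h *m P) 1 0 = (P^T *m h *m P) 0 1.
  by rewrite -[in LHS](trmxK (P^T *m h *m P)) mxE !trmx_mul trmxK hs mulmxA.
have tr' k : \sum_(l < 2) pull3 P A l k l = 0.
  have := pull3_trace k uP ug tr; rewrite E invmx1 => {2}<-.
  by apply: eq_bigr => l _; rewrite (sum_delta (fun s => pull3 P A s k l)).
have [c [J _]] := density_jet (pull3 P T) H (pull3_symmetric P sA) tr'.
rewrite -(pull3_contraction A T uP E ug).
have -> : \sum_(j < 2) \sum_(k < 2) \sum_(l < 2) pull3 P T j k l * pull3 P A j k l =
    - 'D_1 (density (@adj_inv R) 1%:M (P^T *m h *m P) (pull3 P A) (pull3 P T)) 0.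
  by rewrite (@derive_val _ _ _ _ _ _ _ J) opprK.
rewrite opprK; apply: near_eq_derive.
have d1 : \det (1%:M : 'M[R]_2) != 0 by rewrite det1 oner_neq0.
apply: filterS2 (near_det h dn) (near_det (P^T *m h *m P) d1) => t nt nt1.
rewrite -density_adj // -density_adj // -E density_pull //; exact: det_unit.
Qed.

End FirstVariationInvariant.

Section DensityRegularity.
Variables (R : realType) (X : topologicalType) (x : X) (g h : X -> 'M[R]_2) (A T : X -> ten3 R).
Hypotheses (cg : forall i j, \forall y \near x, {for y, continuous (fun z => g z i j)})
  (ch : forall i j, \forall y \near x, {for y, continuous (fun z => h z i j)})
  (cA : forall i j k, \forall y \near x, {for y, continuous (fun z => A z i j k)})
  (cT : forall i j k, \forall y \near x, {for y, continuous (fun z => T z i j k)})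
  (d0 : 0 < \det (g x)).

Let gt (p : X * R) := g p.1 + p.2 *: h p.1.

Lemma C1par_metric i j : C1par x (fun p => gt p i j).
Proof.
have -> : (fun p => gt p i j) = fun p => g p.1 i j + p.2 * h p.1 i j.
  by apply/funext => p; rewrite /gt !mxE.
apply: C1parD; first exact: (C1par_const (f := fun y => g y i j)).
apply: C1parM; first exact: C1par_time.
exact: (C1par_const (f := fun y => h y i j)).
Qed.

Lemma C1par_det (G : X * R -> 'M[R]_2) : (forall i j, C1par x (fun p => G p i j)) ->
  C1par x (fun p => \det (G p)).
Proof.
move=> CG; have -> : (fun p => \det (G p)) = fun p => G p 0 0 * G p 1 1 + - (G p 0 1 * G p 1 0).
  by apply/funext => p; rewrite det2.
by apply: C1parD; [exact: C1parM|apply: C1parN; exact: C1parM].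
Qed.

Lemma C1par_inv (G : X * R -> 'M[R]_2) i j : \det (G (x, 0)) != 0 ->
  (forall i j, C1par x (fun p => G p i j)) -> C1par x (fun p => adj_inv (G p) i j).
Proof.
move=> d CG; have -> : (fun p => adj_inv (G p) i j) = fun p => (\det (G p))^-1 *
   (if i == 0 then if j == 0 then G p 1 1 else - G p 0 1
    else if j == 0 then - G p 1 0 else G p 0 0) by apply/funext => p; rewrite mxE.
apply: C1parM; first by apply: C1parV => //; exact: C1par_det.
by case: (i == 0); case: (j == 0) => //; exact: C1parN.
Qed.

Lemma gt0E y : gt (y, 0) = g y.
Proof. by rewrite /gt scale0r addr0. Qed.

Lemma C1par_trace_free (F : X * R -> ten3 R) : (forall i j k, C1par x (fun p => F p i j k)) ->
  forall i j k, C1par x (fun p => trace_free (F p) i j k).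
Proof.
move=> CF i j k; rewrite /trace_free; apply: C1parD => //; apply: C1parN.
apply: C1parM; first exact: C1par_cst.
by apply: C1parD; (apply: C1parM; first exact: C1par_cst); apply: C1par_sum => l.
Qed.

Lemma C1par_base i j : C1par x (fun p => g p.1 i j).
Proof. exact: (C1par_const (f := fun y => g y i j)). Qed.

Lemma C1par_ratio : C1par x (fun p => Num.sqrt (\det (gt p)) / Num.sqrt (\det (g p.1))).
Proof.
apply: C1parM.
  by apply: C1par_sqrt; [rewrite gt0E|apply: C1par_det; exact: C1par_metric].
apply: C1parV; first by rewrite gt_eqF // sqrtr_gt0.
by apply: C1par_sqrt => //; apply: C1par_det; exact: C1par_base.
Qed.

Lemma C1par_integrand : C1par x (fun p => contraction (adj_inv (gt p)) (gt p)
  (moving_tensor (@adj_inv R) (g p.1) (h p.1) (A p.1) (T p.1) p.2)).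
Proof.
have d1 : \det (gt (x, 0)) != 0 by rewrite gt0E gt_eqF.
have d2 : \det (g (x, 0 : R).1) != 0 by rewrite gt_eqF.
have Cm i j k : C1par x (fun p => moving_tensor (@adj_inv R) (g p.1) (h p.1) (A p.1) (T p.1) p.2 i j k).
  apply: C1par_trace_free => {}i {}j {}k; apply: C1parD.
    apply: C1par_sum => l; apply: C1parM; first by apply: (C1par_inv _ _ d2); exact: C1par_base.
    exact: (C1par_const (f := fun y => A y l j k)).
  apply: C1parN; apply: C1parM; first exact: C1par_time.
  apply: C1par_sum => l; apply: C1parM; first by apply: (C1par_inv _ _ d1); exact: C1par_metric.
  apply: C1parM; first exact: C1par_cst.
  have CT a b c : C1par x (fun p => T p.1 a b c) by exact: (C1par_const (f := fun y => T y a b c)).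
  by apply: C1parD; [exact: C1parD|exact: C1parN].
have Ci i j : C1par x (fun p => adj_inv (gt p) i j) by apply: C1par_inv => //; exact: C1par_metric.
do 6![apply: C1par_sum => ?]; apply: C1parM => //; apply: C1parM; last exact: C1par_metric.
by apply: C1parM => //; apply: C1parM.
Qed.

End DensityRegularity.

(** * The first variation of the energy *)

Section BlaschkeVariation.
Variables (R : realType) (M : closed_oriented_surface R).
Variables (g : cov2 M) (C : comp3C M) (h : cov2 M).
Hypotheses (riem : riemannian g) (hol : holomorphic_cubic_differential g C).
Hypotheses (lc_law : connection_law (levi_civita g)) (sh : sym2_field h).
Implicit Types (a b : chart M) (m : M) (t : R).

Local Notation gt t a m := (g a m + t *: h a m).
Local Notation A a m := (re_cubic C a m).
Local Notation T a m := (nab g h a m).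

Definition shift_integrand a t m := contraction (adj_inv (gt t a m)) (gt t a m)
  (moving_tensor (@adj_inv R) (g a m) (h a m) (A a m) (T a m) t).

Definition shift_area a t m := Num.sqrt (\det (gt t a m)) / Num.sqrt (\det (g a m)).

Lemma shift_law t a b m : dom a m -> dom b m ->
  gt t a m = (jac b a m)^T *m gt t b m *m jac b a m.
Proof.
have [[_ _ lawg] _] := riem; have [_ _ lawh] := sh.
by move=> am bm; rewrite (lawg a b) // (lawh a b) // shift_pull.
Qed.

Lemma shift_det_neq0 t a b m : dom a m -> dom b m ->
  \det (gt t a m) != 0 -> \det (gt t b m) != 0.
Proof.
move=> am bm; rewrite (shift_law t am bm) !det_mulmx.
by apply: contraNneq => ->; rewrite mulr0 mul0r.
Qed.

Lemma shift_integrand_chart t a b m : dom a m -> dom b m -> \det (gt t a m) != 0 ->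
  shift_integrand a t m = shift_integrand b t m.
Proof.
move=> am bm da; have db := shift_det_neq0 am bm da.
have [[_ _ lawg] _] := riem; have [_ _ lawh] := sh.
have ga : \det (g a m) != 0 by rewrite gt_eqF // riem_det.
have gb : \det (g b m) != 0 by rewrite gt_eqF // riem_det.
rewrite /shift_integrand -!contraction_adj //.
rewrite (_ : T a m = pull3 (jac b a m) (T b m)); last first.
  by do 3![apply/funext => ?]; exact: nab_law.
rewrite (re_cubic_pull hol am bm) (lawg a b) // (lawh a b) //.
by apply: contraction_pull; [exact: jac_unit|exact: det_unit|exact: det_unit].
Qed.

Lemma shift_area_chart t a b m : dom a m -> dom b m -> shift_area a t m = shift_area b t m.
Proof.
move=> am bm; have [[_ _ lawg] _] := riem.
have E1 : Num.sqrt (\det (gt t a m)) = \det (jac b a m) * Num.sqrt (\det (gt t b m)).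
  exact: (@det_metric_law _ _ (fun a m => gt t a m) a b m (shift_law t am bm) am bm).
rewrite /shift_area E1 (det_metric_law (lawg _ _ _ am bm) am bm).
have J0 : \det (jac b a m) != 0 by rewrite gt_eqF // det_jac.
by rewrite invfM mulrACA mulfV // mul1r.
Qed.

Lemma pd_continuous a m i (f : M -> R) : C1at a m f -> {for m, continuous (pd a i f)}.
Proof. by case=> _; exact. Qed.

Lemma nab_continuous a m j k l : dom a m -> {for m, continuous (fun z => T a z j k l)}.
Proof.
move=> am; have sg := riem.1.
have cd (h' : cov2 M) p q r : sym2_field h' -> {for m, continuous (fun z => dh_ h' a z p q r)}.
  by move=> sh'; exact: pd_continuous (sym2_C1 q r sh' am).
have ch p q : {for m, continuous (fun z => h a z p q)}.
  exact: C1at_continuous am (sym2_C1 p q sh am).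
have cL p q r : {for m, continuous (fun z => levi_civita g a z p q r)}.
  apply: (continuousMm (f := fun=> 2^-1)); first exact: continuous_cstm.
  apply: continuous_summ => s; apply: continuousMm.
    exact: C1at_continuous am (C1at_inv riem p s am).
  apply: continuousDm; last by apply: continuousNm; exact: (cd g).
  by apply: continuousDm; exact: (cd g).
apply: continuousDm; [apply: continuousDm|]; first exact: (cd h).
  by apply: continuousNm; apply: continuous_summ => p; exact: continuousMm.
by apply: continuousNm; apply: continuous_summ => p; exact: continuousMm.
Qed.

Lemma shift_C1par a m : dom a m ->
  [/\ C1par m (fun p => \det (gt p.2 a p.1)), C1par m (fun p => shift_integrand a p.2 p.1)
    & C1par m (fun p => shift_area a p.2 p.1)].
Proof.
move=> am; have N := near_dom am.
have cg i j : \forall y \near m, {for y, continuous (fun z => g a z i j)}.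
  by apply: filterS N => y ay; exact: C1at_continuous ay (sym2_C1 i j riem.1 ay).
have ch i j : \forall y \near m, {for y, continuous (fun z => h a z i j)}.
  by apply: filterS N => y ay; exact: C1at_continuous ay (sym2_C1 i j sh ay).
have cA i j k : \forall y \near m, {for y, continuous (fun z => A a z i j k)}.
  by apply: filterS N => y ay; exact: C1at_continuous ay (cubic_C1 hol i j k ay).1.
have cT i j k : \forall y \near m, {for y, continuous (fun z => T a z i j k)}.
  by apply: filterS N => y ay; exact: nab_continuous.
have d0 := riem_det riem am.
split.
- by apply: C1par_det; exact: (C1par_metric cg ch).
- exact: (C1par_integrand cg ch cA cT d0).
- exact: (C1par_ratio cg ch d0).
Qed.

Definition flux m := curl g (flux_form g C h) m.

Lemma flux_chart a m : dom a m -> flux m = flux_density g C h a m.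
Proof.
move=> am; rewrite /flux (curlE riem (flux_one_form riem hol sh) am).
rewrite /ext (flux_form_exterior riem hol sh am) [X in X / _]mulrC mulfK //.
by rewrite gt_eqF // sqrt_det_gt0.
Qed.

Lemma shift_derivative a m : dom a m ->
  'D_1 (fun t => shift_integrand a t m * shift_area a t m) 0 = - flux m.
Proof.
move=> am; have [gs g0 d0] := riem_positive riem am.
rewrite (flux_chart am); apply: density_first_variation => //.
- exact: sym2_sym.
- exact: cubic_sym.
- exact: cubic_tracefree.
Qed.

(** Near each point [C1par_uniform] gives the expansion in one chart.  The
    integrand, the area ratio and the flux are the same in all charts, and
    compactness yields a neighbourhood of [t = 0] common to all points. *)
Lemma shift_uniform (e : R) : 0 < e -> \forall t \near (0 : R), forall m,
  [/\ 0 < \det (gt t (chart_at m) m),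
      {for m, continuous (fun z => shift_integrand (chart_at z) t z)},
      {for m, continuous (fun z => shift_area (chart_at z) t z)}
    & `|shift_integrand (chart_at m) t m * shift_area (chart_at m) t m
        - shift_integrand (chart_at m) 0 m * shift_area (chart_at m) 0 m + t * flux m| <= e * `|t|].
Proof.
move=> e0; pose P t m := [/\ 0 < \det (gt t (chart_at m) m),
      {for m, continuous (fun z => shift_integrand (chart_at z) t z)},
      {for m, continuous (fun z => shift_area (chart_at z) t z)}
    & `|shift_integrand (chart_at m) t m * shift_area (chart_at m) t m
        - shift_integrand (chart_at m) 0 m * shift_area (chart_at m) 0 m + t * flux m| <= e * `|t|].
suff H : \forall t \near (0 : R), setT `<=` P t by apply: filterS H => t H m; exact: H.
have cov : near_covering (setT : set M) by apply/compact_near_coveringP; exact: carrier_compact.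
suff L m0 : \forall p \near (m0, 0 : R), P p.2 p.1.
  by apply: (cov R (nbhs (0 : R)) P) => m0 _; exact: L.
have am0 := chart_atP m0; set a := chart_at m0 in am0.
have [Cd CF Ca] := shift_C1par am0.
have dpos : \forall p \near (m0, 0 : R), 0 < \det (gt p.2 a p.1).
  have cd := C1par_continuous Cd.
  apply: (near_preimage (P := fun r : R => 0 < r) cd); apply: lt_nbhsr.
  by rewrite /= scale0r addr0; exact: riem_det.
have adom : \forall p \near (m0, 0 : R), dom a p.1.
  have c1 : {for (m0, 0 : R), continuous (@fst M R)} by exact: cvg_fst.
  by apply: (near_preimage (P := dom a) c1); exact: near_dom.
have U := C1par_uniform e0 (C1parM CF Ca).
have N2 := filterI (C1par_slice Cd) (C1par_slice CF).
have N3 := filterI (C1par_slice Ca) U.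
have FF : Filter (nbhs (m0, 0 : R)) by exact: nbhs_filter.
apply: (@filterS2 _ _ FF _ _ _ _ (@filterI _ _ FF _ _ dpos adom) (@filterI _ _ FF _ _ (N2 FF) (N3 FF)))
  => -[y t] [/= dy ay] [[/= cdy cFy] [cay Uy]].
have by_ := chart_atP y.
have dn : \forall z \near y, \det (gt t a z) != 0.
  by apply: (near_neq0 _ cdy); rewrite gt_eqF.
split.
- have := shift_law t by_ ay => ->; rewrite !det_mulmx det_tr.
  by rewrite mulr_gt0 ?mulr_gt0 ?det_jac.
- apply: continuous_near cFy; apply: filterS2 (near_dom ay) dn => z az nz.
  exact: (shift_integrand_chart az (chart_atP z) nz).
- apply: continuous_near cay; apply: filterS (near_dom ay) => z az.
  exact: (shift_area_chart t az (chart_atP z)).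
- have d0 : \det (gt 0 a y) != 0 by rewrite scale0r addr0 gt_eqF // riem_det.
  rewrite -(shift_integrand_chart ay by_ (nbhs_singleton dn)) -(shift_integrand_chart ay by_ d0).
  rewrite -!(shift_area_chart _ ay by_).
  by move: Uy; rewrite (shift_derivative ay) mulrN opprK.
Qed.

End BlaschkeVariation.

Section EnergyVariation.
Variables (R : realType) (M : closed_oriented_surface R).
Implicit Types (a b : chart M) (m : M) (g h : cov2 M).
Local Notation borel := (g_sigma_algebraType (@open M)).

Lemma trace_freeD (F G : ten3 R) i j k :
  trace_free (fun i j k => F i j k + G i j k) i j k = trace_free F i j k + trace_free G i j k.
Proof. rewrite /trace_free !big_split /=; ring. Qed.

Lemma volume_setT_finite g : riemannian g -> (volume g setT < +oo)%E.
Proof.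
move=> rg; have [E|nE] := pselect (exists mu, is_volume g mu).
  exact: volume_finite (riem_continuous rg) (volumeP E).
by rewrite /volume; case: pselect => [//|_]; rewrite /mzero ltry.
Qed.

Lemma integral_curl g om : riemannian g -> one_form om ->
  Rintegral (volume g) setT (curl g om) = 0.
Proof.
move=> rg fo; rewrite /Rintegral; have [E|nE] := pselect (exists mu, is_volume g mu).
  by rewrite (stokes rg (volumeP E) fo).
by rewrite /volume; case: pselect => [//|_]; rewrite integral_measure_zero.
Qed.

Lemma Rintegral_first_order (mu : {measure set borel -> \bar R}) (f0 f1 q : M -> R) (t c : R) :
  (mu setT < +oo)%E -> (forall m, {for m, continuous f0}) ->
  (forall m, {for m, continuous f1}) -> (forall m, {for m, continuous q}) ->
  Rintegral mu setT q = 0 -> (forall m, `|f1 m - f0 m + t * q m| <= c) ->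
  `|Rintegral mu setT f1 - Rintegral mu setT f0| <= c * fine (mu setT).
Proof.
move=> fin c0 c1 cq q0 H.
have cd m : {for m, continuous (fun m => f1 m - f0 m)}.
  by apply: continuousDm => //; exact: continuousNm.
have ctq m : {for m, continuous (fun m => t * q m)}.
  by apply: (continuousMm (f := fun=> t)); [exact: continuous_cstm|exact: cq].
have I0 := continuous_integrable fin c0; have I1 := continuous_integrable fin c1.
have Iq := continuous_integrable fin cq; have Id := continuous_integrable fin cd.
have Itq := continuous_integrable fin ctq.
have Is := continuous_integrable fin (fun m => continuousDm (cd m) (ctq m)).
have Ic : mu.-integrable setT (EFin \o (fun=> c)).
  by apply: (continuous_integrable fin) => m; exact: continuous_cstm.
have Ia : mu.-integrable setT (EFin \o (fun m => `|f1 m - f0 m + t * q m|)).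
  apply: (continuous_integrable fin) => m.
  exact: (continuous_comp (continuousDm (cd m) (ctq m)) (@norm_continuous _ _ _)).
have -> : Rintegral mu setT f1 - Rintegral mu setT f0 =
    Rintegral mu setT (fun m => f1 m - f0 m + t * q m).
  rewrite (RintegralD measurableT Id Itq) (RintegralZl _ measurableT Iq) (RintegralB measurableT I1 I0).
  by rewrite q0 mulr0 addr0.
apply: le_trans (le_normr_Rintegral measurableT Is) _.
rewrite -(Rintegral_cst mu measurableT c).
by apply: (le_Rintegral measurableT Ia Ic) => m _; exact: H.
Qed.

Section Functional.
Variables (p : set (comp12 M)) (g h : cov2 M) (C : comp3C M) (N : comp12 M).
Hypotheses (pp : projective_structure p) (pc : properly_convex p) (riem : riemannian g)
  (hol : holomorphic_cubic_differential g C)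
  (pB : p (fun a m i j k => levi_civita g a m i j k + alpha g C a m i j k))
  (pN : p N) (sh : sym2_field h).

(** Two connections of [p] differ by a pure trace, so that [N] can be replaced by
    the connection [levi_civita g + alpha g C]. *)
Lemma sqnorm_shift t a m : dom a m -> \det (g a m + t *: h a m) != 0 ->
  sqnorm (metric_shift g h t)
    (tracefree (fun a m i j k => N a m i j k - levi_civita (metric_shift g h t) a m i j k)) a m =
  shift_integrand g C h a t m.
Proof.
move=> am d; have ut := det_unit d.
have dg : \det (g a m) != 0 by rewrite gt_eqF // riem_det.
rewrite /shift_integrand -contraction_adj //.
rewrite [LHS](_ : _ = contraction (invmx (g a m + t *: h a m)) (g a m + t *: h a m)
  (tracefree (fun a m i j k => N a m i j k - levi_civita (metric_shift g h t) a m i j k) a m)) //.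
congr contraction; apply/funext => i; apply/funext => j; apply/funext => k.
set F : ten3 R := fun i j k => N a m i j k - (levi_civita g a m i j k + alpha g C a m i j k).
set G : ten3 R := fun i j k => (\sum_(l < 2) invmx (g a m) i l * re_cubic C a m l j k)
     - t * \sum_(l < 2) invmx (g a m + t *: h a m) i l * christoffel_change (nab g h a m) l j k.
transitivity (trace_free (fun i j k => F i j k + G i j k) i j k).
  congr trace_free; apply/funext => i'; apply/funext => j'; apply/funext => k'.
  rewrite (levi_civita_shift riem sh am ut) /F /G /raise -[alpha _ _ _ _ _ _ _]/(\sum_(l < 2) _).
  ring.
have := projective_tracefree pp pc pN pB am i j k => Z.
by rewrite trace_freeD [X in X + _](_ : _ = 0) ?add0r.
Qed.

Lemma blaschke_connection_law : connection_law (levi_civita g).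
Proof. by have [N0 _ pE] := pp; move: pB; rewrite pE => -[tf _]; exact: levi_civita_law riem hol tf. Qed.

Lemma shift_continuous_metric t : continuous_metric (metric_shift g h t).
Proof.
move=> a m i j am.
have -> : (fun z => metric_shift g h t a z i j) = fun z => g a z i j + t * h a z i j.
  by apply/funext => z; rewrite /metric_shift !mxE.
apply: continuousDm; first exact: C1at_continuous am (sym2_C1 i j riem.1 am).
apply: continuousMm; first exact: continuous_cstm.
exact: C1at_continuous am (sym2_C1 i j sh am).
Qed.

Lemma energy_shift t :
  (forall m, 0 < \det (g (chart_at m) m + t *: h (chart_at m) m)) ->
  (forall m, {for m, continuous (fun z => shift_integrand g C h (chart_at z) t z)}) ->
  (forall m, {for m, continuous (fun z => shift_area g h (chart_at z) t z)}) ->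
  energy N (metric_shift g h t) = Rintegral (volume g) setT
    (fun m => shift_integrand g C h (chart_at m) t m * shift_area g h (chart_at m) t m).
Proof.
move=> d cF ca; rewrite /energy /Rintegral; apply: (congr1 fine).
rewrite -(integral_volume_change (riem_continuous riem) (@shift_continuous_metric t) ca _ _ cF).
- apply: eq_integral => m _; congr EFin; apply: sqnorm_shift; first exact: chart_atP.
  by rewrite gt_eqF.
- by move=> m; rewrite divr_gt0 // sqrtr_gt0 // riem_det //; exact: chart_atP.
- move=> a m am; rewrite (shift_area_chart riem sh t (chart_atP m) am).
  by rewrite /shift_area divfK // gt_eqF // sqrt_det_gt0.
Qed.

(** The expansion of [shift_uniform] is integrated over the surface, of finite
    area; its linear term is the integral of an exterior derivative and
    vanishes by [stokes]. *)
Lemma energy_first_variation :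
  t^-1 * (energy N (metric_shift g h t) - energy N g) @[t --> 0^'] --> (0 : R).
Proof.
have law := blaschke_connection_law.
have fin := volume_setT_finite riem.
pose V := fine (volume g setT).
have V0 : 0 <= V by exact: fine_ge0.
have fo := flux_one_form riem hol sh.
pose F t m := shift_integrand g C h (chart_at m) t m * shift_area g h (chart_at m) t m.
have g0 : g = metric_shift g h 0.
  by apply/funext => a; apply/funext => m; rewrite /metric_shift scale0r addr0.
have bound e : 0 < e -> \forall t \near (0 : R),
    `|energy N (metric_shift g h t) - energy N g| <= e * `|t| * V.
  move=> e0; have U := shift_uniform riem hol law sh e0.
  have U0 := nbhs_singleton U.
  apply: filterS U => t Ut.
  have E s : (forall m, [/\ 0 < \det (g (chart_at m) m + s *: h (chart_at m) m),
      {for m, continuous (fun z => shift_integrand g C h (chart_at z) s z)},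
      {for m, continuous (fun z => shift_area g h (chart_at z) s z)}
    & `|F s m - F 0 m + s * flux g C h m| <= e * `|s|]) ->
      energy N (metric_shift g h s) = Rintegral (volume g) setT (F s) /\
      (forall m, {for m, continuous (F s)}).
    move=> H; split; last by move=> m; have [_ c1 c2 _] := H m; exact: continuousMm.
    by apply: energy_shift => m; have [] := H m.
  have [Et cFt] := E t Ut; have [E0 cF0] := E 0 U0.
  rewrite {2}g0 Et E0.
  apply: (Rintegral_first_order fin cF0 cFt _ (integral_curl riem fo)) => m.
    exact: curl_continuous riem fo.
  by have [_ _ _ Bm] := Ut m; exact: Bm.
apply/cvgr0Pnorm_le => e e0.
have e1 : 0 < e / (V + 1) by rewrite divr_gt0 // ltr_wpDl.
have B := bound _ e1.
have Bp : \forall t \near (0 : R)^', `|energy N (metric_shift g h t) - energy N g| <= e / (V + 1) * `|t| * V.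
  exact: cvg_within B.
apply: filterS2 Bp (nbhs_dnbhs_neq (0 : R)) => t Bt t0.
rewrite normrM normfV ler_pdivrMl ?normr_gt0 //; apply: le_trans Bt _.
have K : V / (V + 1) <= 1 by rewrite ler_pdivrMr ?ltr_wpDl // mul1r lerDl ler01.
have -> : e / (V + 1) * `|t| * V = `|t| * e * (V / (V + 1)) by ring.
by rewrite ler_piMr // mulr_ge0 // ltW.
Qed.

End Functional.
End EnergyVariation.

Theorem theoremA (R : realType) (M : closed_oriented_surface R) (p : set (comp12 M))
    (chi : int) (g : cov2 M) :
  projective_structure p -> properly_convex p ->
  euler_characteristic M chi -> chi < 0 ->
  blaschke_metric p g ->
  forall N : comp12 M, p N ->
  forall h : cov2 M, sym2_field h ->
    t^-1 * (energy N (metric_shift g h t) - energy N g) @[t --> 0^'] --> (0 : R).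
Proof.
move=> pp pc _ _ [riem [C [hol pB _]]] N pN h sh.
exact: energy_first_variation pp pc riem hol pB pN sh.
Qed.
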